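(* For $a>-2$ put $A(u)=A(u,a,1)=1+au^2+u^4$ (which is positive for all $u\in\mathbb R$) and consider the Hamiltonian $$H=A^{-1/2}(u)\left(d\varphi^2+A^{-1/2}(u)\,du^2\right)-\frac u2\left((a+2u^2)-2A^{1/2}(u)\right)\cos\varphi,\qquad \varphi\in[0,2\pi),\ u\in(-\infty,+\infty).$$ Then: (1) For every $a>-2$, $H$ defines a conservative system on the sphere $S^2$ possessing an integral of fourth degree in momenta. (2) If $a\neq 2$, this integral is nontrivial, i.e. the system has no quadratic or linear integral (no integral of degree $\le 2$ in momenta). If $a=2$, $H$ is the Hamiltonian of (the geodesic flow of) a metric of constant positive curvature. (3) The Hamiltonians $H$ for different values of the parameter $a>-2$ are not equivalent.
   Context: Conservative systems. Let $M$ be a Riemannian manifold and $U:M\to\mathbb R$ a smooth function. The conservative system on $M$ with kinetic energy $K$ and potential $U$ is the Hamiltonian system on $T^*M$ with Hamiltonian $H=\frac12\sum g^{ij}(q)p_ip_j+U(q)=K+U$, where $TM$ and $T^*M$ are identified by means of the Riemannian metric. As is customary, the Hamiltonian is written as a total energy in velocities: an expression (quadratic form in $d\varphi,du$) $+\,U$ means that the quadratic form, evaluated on velocities $(\dot\varphi,\dot u)$, is the kinetic energy $K$ and is transported to $T^*M$ by the Legendre transformation; the quadratic form is required to be positive definite. ''Defines a conservative system on $S^2$'': the coordinates $(\varphi \bmod 2\pi,u)$, $u\in\mathbb R$, parametrize $S^2$ minus two points (the two points being the limits $u\to+\infty$ and $u\to-\infty$) via a diffeomorphism from the cylinder onto $S^2$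 minus two points for which the quadratic form extends to a smooth Riemannian metric on all of $S^2$ and the potential extends to a smooth function on all of $S^2$. Integrals. An integral of degree $m$ in momenta of the system with Hamiltonian $H$ is a smooth function $F:T^*M\to\mathbb R$ that is a first integral of the Hamiltonian system, is independent of $H$, and in local coordinates has the form $F=\sum_{k_1+\dots+k_n\le m}a_{k_1\dots k_n}(q)p_1^{k_1}\cdots p_n^{k_n}$. Equivalence. Two Hamiltonians $H_1=K_1+U_1$, $H_2=K_2+U_2$ on $T^*M$ are equivalent if there exist a diffeomorphism $\phi:M\to M$ and a diffeomorphism $\Phi:T^*M\to T^*M$ covering $\phi$ (i.e. $\pi'\circ\Phi=\phi\circ\pi'$ with $\pi':T^*M\to M$ the projection), linear on each fibre, and nonzero constants $\kappa,\tilde\kappa$ such that $\Phi^*(K_1)=\kappa K_2$ and $\phi^*(U_1)=\tilde\kappa U_2$.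
   Formalization: In the definition of equivalence, Φ is additionally required to be the cotangent lift of φ: for arbitrary fibrewise linear Φ the condition on K is void, the potentials for any two a,b≠2 agree up to a diffeomorphism and a factor, and (3) would be false. *)

(* Defs.v *)
From HB Require Import structures.
From mathcomp Require Import all_boot all_order all_algebra.
From mathcomp Require Import all_classical all_reals all_analysis.

Set Implicit Arguments.
Unset Strict Implicit.
Unset Printing Implicit Defensive.

Import Order.TTheory GRing.Theory Num.Theory.
Import numFieldNormedType.Exports.

Local Open Scope classical_set_scope.
Local Open Scope ring_scope.

(* Smoothness in Euclidean (normed) spaces.  On an open subset of a
   finite-dimensional space, [Ck k] says that all iterated directional
   derivatives of order at most k exist and are continuous. *)

Fixpoint Ck (R : realType) (V W : normedModType R) (k : nat) (O : set V)
    (f : V -> W) : Prop :=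
  match k with
  | 0%N => forall x, O x -> {for x, continuous f}
  | k'.+1 => (forall x, O x -> differentiable f x) /\
             (forall v : V, Ck k' O (fun x => 'D_v f x))
  end.

(* Smoothness on an arbitrary subset X (Milnor): f locally coincides on X with
   a C^oo function defined on an open set of the ambient space. *)
Definition smooth_on (R : realType) (V W : normedModType R) (X : set V)
    (f : V -> W) : Prop :=
  forall x, X x -> exists (O : set V) (h : V -> W),
    [/\ open O, O x, forall k, Ck k O h &
        forall y, X y -> O y -> f y = h y].

Definition diffeo (R : realType) (V W : normedModType R) (X : set V)
    (Y : set W) (f : V -> W) : Prop :=
  [/\ smooth_on X f, set_bij X Y f &
      exists g : W -> V, smooth_on Y g /\ (forall x, X x -> g (f x) = x)].

Definition dot (R : realType) (n : nat) (u v : 'rV[R]_n) : R :=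
  (u *m v^T) 0 0.

Definition vec3 (R : realType) (x y z : R) : 'rV[R]_3 :=
  \row_(i < 3) [:: x; y; z]`_i.

Definition S2 (R : realType) : set 'rV[R]_3 := [set x | dot x x = 1].

(* The tangent plane of S2 at x is the orthogonal complement of x.  A covector
   at x is represented by the unique tangent vector xi such that the covector
   is v |-> dot xi v. *)
Definition tangent (R : realType) (x v : 'rV[R]_3) : Prop := dot x v = 0.

Definition TstarS2 (R : realType) : set ('rV[R]_3 * 'rV[R]_3) :=
  [set z | S2 z.1 /\ tangent z.1 z.2].

Definition local_coord (R : realType) (O : set 'rV[R]_2)
    (psi : 'rV[R]_2 -> 'rV[R]_3) : Prop :=
  [/\ open O, diffeo O (psi @` O) psi &
      exists W : set 'rV[R]_3, open W /\ psi @` O = S2 (R := R) `&` W].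

(* Metrics: only the values of the bilinear form g x on tangent vectors at
   points x of S2 matter. *)
Definition form (R : realType) (n : nat) (B : 'M[R]_n) (v w : 'rV[R]_n) : R :=
  (v *m B *m w^T) 0 0.

Definition riemannian (R : realType) (g : 'rV[R]_3 -> 'M[R]_3) : Prop :=
  [/\ smooth_on (S2 (R := R)) g,
      forall x v w, S2 x -> tangent x v -> tangent x w ->
        form (g x) v w = form (g x) w v &
      forall x v, S2 x -> tangent x v -> v != 0 -> 0 < form (g x) v v].

(* Inverse Legendre transformation: the velocity v with momentum
   xi = g(v, .). *)
Definition velocity (R : realType) (g : 'rV[R]_3 -> 'M[R]_3)
    (x xi : 'rV[R]_3) : 'rV[R]_3 :=
  xget 0 [set v | tangent x v /\
                  forall w, tangent x w -> form (g x) v w = dot xi w].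

Definition kinetic (R : realType) (g : 'rV[R]_3 -> 'M[R]_3)
    (z : 'rV[R]_3 * 'rV[R]_3) : R :=
  let v := velocity g z.1 z.2 in 2^-1 * form (g z.1) v v.

Definition hamiltonian (R : realType) (g : 'rV[R]_3 -> 'M[R]_3)
    (U : 'rV[R]_3 -> R) (z : 'rV[R]_3 * 'rV[R]_3) : R :=
  kinetic g z + U z.1.

(* The covector at psi q with components p_i = xi(d_i psi).  Here and below
   the rows of J = jacobian psi q are the coordinate vectors d_i psi, and
   dpsi(v) = v *m J. *)
Definition covector (R : realType) (psi : 'rV[R]_2 -> 'rV[R]_3)
    (q p : 'rV[R]_2) : 'rV[R]_3 :=
  let J := jacobian psi q in p *m invmx (J *m J^T) *m J.

Definition in_coord (R : realType) (psi : 'rV[R]_2 -> 'rV[R]_3)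
    (F : 'rV[R]_3 * 'rV[R]_3 -> R) (z : 'rV[R]_2 * 'rV[R]_2) : R :=
  F (psi z.1, covector psi z.1 z.2).

Definition Dq (R : realType) (i : 'I_2) (f : 'rV[R]_2 * 'rV[R]_2 -> R)
    (z : 'rV[R]_2 * 'rV[R]_2) : R := 'D_(delta_mx 0 i, 0) f z.

Definition Dp (R : realType) (i : 'I_2) (f : 'rV[R]_2 * 'rV[R]_2 -> R)
    (z : 'rV[R]_2 * 'rV[R]_2) : R := 'D_(0, delta_mx 0 i) f z.

(* Derivative of f along the Hamiltonian vector field
   q' = dh/dp, p' = - dh/dq. *)
Definition poisson (R : realType) (f h : 'rV[R]_2 * 'rV[R]_2 -> R)
    (z : 'rV[R]_2 * 'rV[R]_2) : R :=
  \sum_(i < 2) (Dq i f z * Dp i h z - Dp i f z * Dq i h z).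

Definition indep_at (R : realType) (f h : 'rV[R]_2 * 'rV[R]_2 -> R)
    (z : 'rV[R]_2 * 'rV[R]_2) : Prop :=
  forall s t : R,
    (forall i, s * Dq i f z + t * Dq i h z = 0 /\
               s * Dp i f z + t * Dp i h z = 0) ->
    s = 0 /\ t = 0.

(* An integral of degree (at most) m in momenta.  Independence of F and H is
   functional independence: dF and dH are linearly independent on a dense
   set. *)
Definition integral_of_degree (R : realType) (m : nat)
    (H F : 'rV[R]_3 * 'rV[R]_3 -> R) : Prop :=
  smooth_on (TstarS2 (R := R)) F /\
  forall O psi, local_coord O psi ->
    let f := in_coord psi F in let h := in_coord psi H in
    [/\ forall q p, O q -> poisson f h (q, p) = 0,
        O `*` setT `<=` closure [set z | indep_at f h z] &
        exists c : nat -> nat -> 'rV[R]_2 -> R, forall q p, O q ->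
          f (q, p) = \sum_(j < m.+1) \sum_(k < m.+1 | (j + k <= m)%N)
                       c j k q * p 0 0 ^+ j * p 0 1 ^+ k].

(* Gaussian curvature of a metric G given in coordinates on R^2. *)

Definition pd (R : realType) (i : 'I_2) (f : 'rV[R]_2 -> R) (q : 'rV[R]_2) : R :=
  'D_(delta_mx 0 i) f q.

Definition christoffel (R : realType) (G : 'rV[R]_2 -> 'M[R]_2)
    (k i j : 'I_2) (q : 'rV[R]_2) : R :=
  2^-1 * \sum_(l < 2) invmx (G q) k l *
    (pd i (fun q' => G q' j l) q + pd j (fun q' => G q' i l) q
     - pd l (fun q' => G q' i j) q).

(* R(d_i, d_j) d_k = \sum_l (riemann G l k i j) d_l, where
   R(X, Y) = [nabla_X, nabla_Y] - nabla_[X, Y]. *)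
Definition riemann (R : realType) (G : 'rV[R]_2 -> 'M[R]_2)
    (l k i j : 'I_2) (q : 'rV[R]_2) : R :=
  pd i (christoffel G l j k) q - pd j (christoffel G l i k) q
  + \sum_(m < 2) (christoffel G m j k q * christoffel G l i m q
                  - christoffel G m i k q * christoffel G l j m q).

(* <R(d_0, d_1) d_1, d_0> / det G *)
Definition gauss_curvature (R : realType) (G : 'rV[R]_2 -> 'M[R]_2)
    (q : 'rV[R]_2) : R :=
  (\sum_(l < 2) G q l 0 * riemann G l 1 0 1 q) / \det (G q).

Definition metric_in_coord (R : realType) (psi : 'rV[R]_2 -> 'rV[R]_3)
    (g : 'rV[R]_3 -> 'M[R]_3) (q : 'rV[R]_2) : 'M[R]_2 :=
  let J := jacobian psi q in J *m g (psi q) *m J^T.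

Definition constant_curvature (R : realType) (g : 'rV[R]_3 -> 'M[R]_3)
    (c : R) : Prop :=
  forall O psi, local_coord O psi ->
    forall q, O q -> gauss_curvature (metric_in_coord psi g) q = c.

(* Equivalence of K1 + U1 and K2 + U2.  The map Phi of T*S2 is required to be
   an isomorphism of Hamiltonian systems, i.e. to respect the canonical
   symplectic structure; for a fibrewise linear Phi covering phi this means
   that Phi is the cotangent lift of phi,
     (Phi xi)(dphi v) = xi(v),
   which is the fourth condition (a constant factor in front of the lift would
   only change kappa).  For an arbitrary fibrewise linear Phi the condition on
   the kinetic energies would be void: over any phi there is a fibrewise
   linear isometry of the cotangent bundles. *)
Definition equivalent (R : realType)
    (g1 : 'rV[R]_3 -> 'M[R]_3) (U1 : 'rV[R]_3 -> R)
    (g2 : 'rV[R]_3 -> 'M[R]_3) (U2 : 'rV[R]_3 -> R) : Prop :=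
  exists (phi : 'rV[R]_3 -> 'rV[R]_3)
         (Phi : 'rV[R]_3 * 'rV[R]_3 -> 'rV[R]_3 * 'rV[R]_3)
         (kappa kappa' : R),
    (diffeo (S2 (R := R)) (S2 (R := R)) phi /\
     diffeo (TstarS2 (R := R)) (TstarS2 (R := R)) Phi) /\
    (forall z, TstarS2 z -> (Phi z).1 = phi z.1) /\
    (forall x xi eta (s : R), TstarS2 (x, xi) -> TstarS2 (x, eta) ->
       (Phi (x, s *: xi + eta)).2 = s *: (Phi (x, xi)).2 + (Phi (x, eta)).2) /\
    (forall O psi, local_coord O psi -> forall q xi v, O q ->
       TstarS2 (psi q, xi) ->
       dot (Phi (psi q, xi)).2 (v *m jacobian (phi \o psi) q)
         = dot xi (v *m jacobian psi q)) /\
    (kappa != 0 /\ kappa' != 0) /\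
    (forall z, TstarS2 z -> kinetic g1 (Phi z) = kappa * kinetic g2 z) /\
    (forall x, S2 x -> U1 (phi x) = kappa' * U2 x).

Definition A (R : realType) (a u : R) : R := 1 + a * u ^+ 2 + u ^+ 4.

(* The quadratic form A^(-1/2) (dphi^2 + A^(-1/2) du^2). *)
Definition quad_form (R : realType) (a u : R) (v : 'rV[R]_2) : R :=
  (Num.sqrt (A a u))^-1 *
    (v 0 0 ^+ 2 + (Num.sqrt (A a u))^-1 * v 0 1 ^+ 2).

Definition potential (R : realType) (a phi u : R) : R :=
  - (u / 2 * ((a + 2 * u ^+ 2) - 2 * Num.sqrt (A a u)) * cos phi).

Definition cylinder (R : realType) : set 'rV[R]_3 :=
  [set x | x 0 0 ^+ 2 + x 0 1 ^+ 2 = 1].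

Definition cyl (R : realType) (q : 'rV[R]_2) : 'rV[R]_3 :=
  vec3 (cos (q 0 0)) (sin (q 0 0)) (q 0 1).

(* (g, U) is a conservative system on S2 given in the coordinates
   q = (phi mod 2 pi, u) by the Hamiltonian with parameter a.  The quadratic
   form is the kinetic energy in velocities, hence equals g / 2. *)
Definition defined_by (R : realType) (a : R)
    (g : 'rV[R]_3 -> 'M[R]_3) (U : 'rV[R]_3 -> R) : Prop :=
  riemannian g /\ smooth_on (S2 (R := R)) U /\
  exists (Psi : 'rV[R]_3 -> 'rV[R]_3) (N S : 'rV[R]_3),
    let psi := Psi \o cyl (R := R) in
    [/\ S2 N, S2 S & N <> S] /\
    diffeo (cylinder (R := R)) (S2 (R := R) `\` [set N; S]) Psi /\
    (forall phi : R,
       Psi (vec3 (cos phi) (sin phi) u) @[u --> +oo] --> N /\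
       Psi (vec3 (cos phi) (sin phi) u) @[u --> -oo] --> S) /\
    (forall q v : 'rV[R]_2,
       2^-1 * form (metric_in_coord psi g q) v v = quad_form a (q 0 1) v) /\
    (forall q : 'rV[R]_2, U (psi q) = potential a (q 0 0) (q 0 1)).

(* Main.v *)
(* Write [S = sqrt (A u)].  The form in the theorem is half of the metric, so that
   [K = (S p_phi^2 + A p_u^2) / 4].

   (1) Put [Psi (x, y, u) = (x, y, u) / sqrt (1 + u^2)].  With the height [t] on the
   sphere and [s = S / (1 + u^2) = sqrt (1 - (2 - a) t^2 (1 - t^2))], the metric becomes
   a combination of the Euclidean form and [dt^2] with coefficients smooth in [t].  The
   integral is, in coordinates,
     [p_phi^4 + 8 u cos phi p_phi^2 - 8 S sin phi p_phi p_u + (4 a - 8 (S - u^2)) sin^2 phi],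
   which on the sphere reads [L^4 + 8 L T + 4 (a^2 - 4) y^2 / den] for momenta [L], [T]
   linear in [xi].  In any chart the Poisson bracket is given by the gradients in the
   ambient space, which turns [{F, H} = 0] into three polynomial identities.

   (2) In the coordinates with [|phi| < pi / 2] the bracket of an integral of degree 2
   with [H] splits by degree in [p].  The top part is a Killing tensor; integrating the
   equations in [u] and comparing even and odd parts leaves only [c K + d p_phi^2], since
   [S'] is affine only for [a = 2].  Likewise the linear part is a multiple of [p_phi].
   The potential excludes both [p_phi^2] and [p_phi], so the integral is [c H + const].
   For [a = 2] one has [S = 1 + u^2], the potential vanishes and the metric is twice the
   pull-back of the round one by [Psi]; the Gauss equation gives curvature 1/2 away from
   the two poles, hence everywhere by continuity.

   (3) If one parameter is 2, the potentials vanish and so the other is 2 as well.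
   Otherwise lift the diffeomorphism locally to [(phi, u) |-> (Theta, w)].  The momentum
   [p_Theta] is a linear integral of the second kinetic energy, hence a constant multiple
   of [p_phi].  Then [w] is an affine function of [u] and [A (w u, a)] is a constant
   multiple of [A (u, b)], which forces [a = b]. *)
Require Import Defs.
From HB Require Import structures.
From mathcomp Require Import all_boot all_order all_algebra.
From mathcomp Require Import all_classical all_reals all_analysis.
From mathcomp Require Import ring lra.
(* Again, so that [form] is not the one of MathComp. *)
Require Import Defs.
Set Implicit Arguments.
Unset Strict Implicit.
Unset Printing Implicit Defensive.
Import Order.TTheory GRing.Theory Num.Theory.
Import numFieldNormedType.Exports.
Local Open Scope classical_set_scope.
Local Open Scope ring_scope.

(** * Iterated directional derivatives *)

Section Derivatives.
Variable R : realType.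
Implicit Types U V W : normedModType R.

(** The realisation [Psi] is arbitrary and the angle exists only modulo [2 pi]. Charts are therefore
    lifted to the cylinder in space, and only the differential of the angle is used there. Covectors
    are ambient vectors, and the bracket in a chart is reduced once to the Dirac bracket of the
    constraints [dot x x = 1] and [dot x xi = 0]. Of the three polynomial identities, one is the
    rotational symmetry of the kinetic energy; the other two are the parts of the bracket of degree
    3 and 1 in the momenta.

    The value [a = 2] matters twice. By [(a + 2 u^2)^2 - 4 A = a^2 - 4] the potential and the last
    term of the integral become fractions that are smooth at the poles and carry the factor
    [a^2 - 4]. For the metric [dphi^2 / S + du^2 / S^2] the curvature is [S S'' / 2 - S'^2 / 4],
    with derivative [S S''' / 2] in [u]: an affine [S'] means constant curvature, the case in which
    further Killing fields and tensors exist.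

    Neither the coefficients of an integral nor the solutions of the Killing equations come with
    second derivatives; these are recovered from values at finitely many momenta or heights. *)

Lemma near_eq_differentiable V W (f g : V -> W) (x : V) :
  (\near x, f x = g x) -> differentiable f x -> differentiable g x.
Proof.
move=> fg df; move: (df) => /diff_locallyP [cdf fE].
have fgx : f x = g x by exact: nbhs_singleton fg.
have gE : g \o shift x = cst (g x) + 'd f x +o_ 0 id.
  apply/eqaddoP => e e0.
  have /eqaddoP/(_ e e0) := fE => H.
  have nfg : \forall y \near (0 : V), f (y + x) = g (y + x).
    have : (fun y => y + x) @ (0 : V) --> x.
      by rewrite -{2}[x]add0r; apply: cvgD; [exact: cvg_id|exact: cvg_cst].
    by move=> /(_ _ fg).
  near=> y.
  have Hy : f (y + x) = g (y + x) by near: y.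
  rewrite -[X in `|X|]/(g (y + x) - (g x + 'd f x y)) -Hy -fgx.
  by near: y; exact: H.
have E : 'd g x = 'd f x :> (V -> W) by apply: diff_unique.
by apply/diff_locallyP; split; rewrite E.
Unshelve. all: by end_near. Qed.

(** Registering scaling as a bilinear map makes the product rule for [f y *: g y] an instance of the
    derivative of a bilinear map composed with a pair. *)
Lemma scale_bilinear V : bilinear_for
  (GRing.Scale.Law.clone _ _ *:%R _) (GRing.Scale.Law.clone _ _ *:%R _)
  (@GRing.scale R V : R^o -> V -> V).
Proof.
split=> [u'|u] a x y /=.
- by rewrite scalerDl scalerA.
- by rewrite scalerDr !scalerA mulrC.
Qed.

HB.instance Definition _ V := bilinear_isBilinear.Build R R^o V V _ _
  (@GRing.scale R V : R^o -> V -> V) (@scale_bilinear V).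

Lemma differentiable_scale V W (f : V -> R) (g : V -> W) x :
  differentiable f x -> differentiable g x ->
  differentiable (fun y => f y *: g y) x.
Proof.
move=> df dg.
apply: (@differentiable_comp _ _ _ _ (fun y => (f y, g y))
  (fun p : R^o * W => p.1 *: p.2)).
  exact: differentiable_pair.
apply: (@differentiable_bilin R R^o W W (@GRing.scale R W)).
exact: scale_continuous.
Qed.

Lemma derive_scale V W (f : V -> R) (g : V -> W) x v :
  differentiable f x -> differentiable g x ->
  'D_v (fun y => f y *: g y) x = f x *: 'D_v g x + 'D_v f x *: g x.
Proof.
move=> df dg.
rewrite deriveE; last exact: differentiable_scale.
pose B := (fun p : R^o * W => p.1 *: p.2).
have dB p : differentiable B p.
  apply: (@differentiable_bilin R R^o W W (@GRing.scale R W)).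
  exact: scale_continuous.
rewrite (_ : (fun y => _) = B \o (fun y => (f y, g y))) //.
rewrite diff_comp //; last exact: differentiable_pair.
rewrite /= diff_pair //.
rewrite (@diff_bilin R R^o W W (@GRing.scale R W)); last exact: scale_continuous.
by rewrite /= !deriveE.
Qed.

Lemma derive_comp U V W (f : U -> V) (h : V -> W) x v :
  differentiable f x -> differentiable h (f x) ->
  'D_v (h \o f) x = 'D_('D_v f x) h (f x).
Proof.
move=> df dh; rewrite deriveE; last exact: differentiable_comp.
by rewrite diff_comp //= -deriveE // -deriveE.
Qed.

End Derivatives.

(** * Closure properties of the classes [Ck] *)

Section CkCalculus.
Variable R : realType.
Implicit Types (U V W : normedModType R) (k : nat).

Lemma Ck_sub V W k (O O' : set V) (f : V -> W) :
  O' `<=` O -> Ck k O f -> Ck k O' f.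
Proof.
move=> OO; elim: k f => [|k IH] f /=; first by move=> Of x /OO; exact: Of.
by move=> [df Df]; split=> [x /OO|v]; [exact: df|exact: IH].
Qed.

Lemma CkS V W k (O : set V) (f : V -> W) : Ck k.+1 O f <->
  (forall x, O x -> differentiable f x) /\ (forall v, Ck k O ('D_v f)).
Proof. by []. Qed.

Lemma Ck_local V W k (O : set V) (f : V -> W) :
  (forall x, O x -> exists O', O' x /\ Ck k O' f) -> Ck k O f.
Proof.
elim: k f => [|k IH] f H /=.
  by move=> x Ox; have [Q [Qx cf]] := H x Ox; exact: cf.
split=> [x Ox|v]; first by have [Q [Qx [df _]]] := H _ Ox; exact: df.
by apply: IH => x Ox; have [Q [Qx /CkS[_ Df]]] := H _ Ox; exists Q; split=> //; exact: Df.
Qed.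

Lemma Ck_eq V W k (O : set V) (f g : V -> W) :
  open O -> (forall x, O x -> f x = g x) -> Ck k O f -> Ck k O g.
Proof.
move=> oO; have near_eq (W' : normedModType R) (f' g' : V -> W') :
    (forall x, O x -> f' x = g' x) -> forall x, O x -> \near x, f' x = g' x.
  by move=> fg x Ox; apply: filterS (open_nbhs_nbhs (conj oO Ox)).
elim: k f g => [|k IH] f g fg /=.
  move=> Of x Ox; have : g @ x --> f x.
    by apply: cvg_trans (Of _ Ox); apply: near_eq_cvg; exact: near_eq.
  by rewrite fg.
move=> [df Df]; split=> [x Ox|v].
  by apply: near_eq_differentiable (df _ Ox); exact: near_eq.
by apply: IH (Df v) => x Ox; apply: near_eq_derive; exact: near_eq.
Qed.

Lemma Ck_continuous V W k (O : set V) (f : V -> W) x :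
  Ck k O f -> O x -> {for x, continuous f}.
Proof.
case: k => [|k] /=; first by move=> + Ox; exact.
by move=> [df _] Ox; exact/differentiable_continuous/df.
Qed.

Lemma Ck_pred V W k (O : set V) (f : V -> W) : Ck k.+1 O f -> Ck k O f.
Proof.
elim: k f => [|k IH] f; first by move=> H x; exact: (Ck_continuous H).
by move=> [df Df]; split=> // v; exact: IH.
Qed.

Lemma Ck_cst V W k (O : set V) (c : W) : Ck k O (fun _ : V => c).
Proof.
elim: k c => [|k IH] c /=; first by move=> x _; exact: cst_continuous.
split=> [x _|v]; first exact: differentiable_cst.
have -> : 'D_v (fun _ : V => c) = (fun=> 0) by apply/funext => x; exact: derive_cst.
exact: IH.
Qed.

Lemma Ck_comp_linear V W W' k (O : set V) (f : V -> W) (l : {linear W -> W'}) :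
  continuous l -> Ck k O f -> open O -> Ck k O (l \o f).
Proof.
move=> cl + oO; elim: k f => [|k IH] f /=.
  by move=> cf x Ox; apply: continuous_comp; [exact: cf|exact: cl].
have dl y : differentiable l y by exact: linear_differentiable.
move=> [df Df]; split=> [x Ox|v].
  by apply: differentiable_comp; [exact: df|].
apply: Ck_eq (IH _ (Df v)) => //= x Ox.
rewrite derive_comp //; last exact: df.
by rewrite [RHS]deriveE // diff_lin.
Qed.

Lemma Ck_id V k (O : set V) : Ck k O (@id V).
Proof.
case: k => [|k] /=; first by move=> x _; exact: cvg_id.
split=> [x _|v]; first exact: ex_diff.
have -> : 'D_v (@id V) = (fun=> v) by apply/funext => x; exact: derive_id.
exact: Ck_cst.
Qed.

Lemma Ck_linear V W k (O : set V) (l : {linear V -> W}) :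
  continuous l -> open O -> Ck k O l.
Proof. by move=> cl oO; apply: (Ck_comp_linear (f := id)) => //; exact: Ck_id. Qed.

Lemma Ck_add V W k (O : set V) (f g : V -> W) : open O ->
  Ck k O f -> Ck k O g -> Ck k O (fun x => f x + g x).
Proof.
move=> oO; elim: k f g => [|k IH] f g /=.
  by move=> cf cg x Ox; apply: cvgD; [exact: cf|exact: cg].
move=> [df Df] [dg Dg]; split=> [x Ox|v].
  by apply: differentiableD; [exact: df|exact: dg].
apply: Ck_eq (IH _ _ (Df v) (Dg v)) => //= x Ox.
by apply/esym/deriveD; apply: diff_derivable; [exact: df|exact: dg].
Qed.

Lemma Ck_scale V W k (O : set V) (f : V -> R) (g : V -> W) : open O ->
  Ck k O f -> Ck k O g -> Ck k O (fun x => f x *: g x).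
Proof.
move=> oO; elim: k f g => [|k IH] f g.
  by move=> cf cg x Ox; apply: cvgZ; [exact: cf|exact: cg].
move=> Cf Cg; have [df Df] := (CkS _ _ _).1 Cf; have [dg Dg] := (CkS _ _ _).1 Cg; split=> [x Ox|v].
  by apply: differentiable_scale; [exact: df|exact: dg].
apply: (@Ck_eq _ _ _ _ (fun x => f x *: 'D_v g x + 'D_v f x *: g x)) => //.
  by move=> x Ox; rewrite derive_scale //; [exact: df|exact: dg].
by apply: Ck_add => //; apply: IH => //; exact: Ck_pred.
Qed.

Lemma Ck_mul V k (O : set V) (f g : V -> R) : open O ->
  Ck k O f -> Ck k O g -> Ck k O (fun x => f x * g x).
Proof. exact: Ck_scale. Qed.

Lemma Ck_opp V k (O : set V) (f : V -> R) : open O ->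
  Ck k O f -> Ck k O (fun x => - f x).
Proof.
move=> oO Of; apply: (Ck_eq oO _ (Ck_mul oO (@Ck_cst V R k O (-1)) Of)) => x _.
by rewrite mulN1r.
Qed.

Lemma Ck_exp V k (O : set V) (f : V -> R) n : open O ->
  Ck k O f -> Ck k O (fun x => f x ^+ n).
Proof.
move=> oO Of; elim: n => [|n IH]; first exact: Ck_cst.
by apply: (Ck_eq oO _ (Ck_mul oO Of IH)) => x _; rewrite exprS.
Qed.

Lemma Ck_sum V W k (O : set V) (I : Type) (r : seq I) (P : pred I) (f : I -> V -> W) : open O ->
  (forall i, P i -> Ck k O (f i)) -> Ck k O (fun x => \sum_(i <- r | P i) f i x).
Proof.
move=> oO H; elim: r => [|i r IH].
  by apply: (Ck_eq oO _ (Ck_cst k O 0)) => x _; rewrite big_nil.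
case Pi : (P i); last by apply: (Ck_eq oO _ IH) => x _; rewrite big_cons Pi.
by apply: (Ck_eq oO _ (Ck_add oO (H i Pi) IH)) => x _; rewrite big_cons Pi.
Qed.

(* A finite-dimensional space: a finite family of vectors with continuous
   coordinate functionals. *)
Definition finite_basis V := exists (n : nat) (e : 'I_n -> V) (l : 'I_n -> {linear V -> R^o}),
  (forall i, continuous (l i)) /\ forall v, v = \sum_i (l i v : R) *: e i.

(** In the chain rule the direction ['D_v f x] varies with [x], whereas [Ck] speaks of fixed
    directions. A basis of the middle space turns the derivative into a finite sum of products, to
    which the induction hypothesis applies. *)
Lemma Ck_comp V U W k (O : set V) (Q : set U) (f : V -> U) (h : U -> W) :
  finite_basis U -> open O -> f @` O `<=` Q ->
  Ck k O f -> Ck k Q h -> Ck k O (h \o f).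
Proof.
move=> [n [e [l [cl lE]]]] oO fO; have fQ x : O x -> Q (f x) by move=> Ox; apply: fO; exists x.
elim: k h => [|k IH] h.
  by move=> cf ch x Ox; apply: continuous_comp; [exact: cf|exact/ch/fQ].
move=> Cf /CkS [dh Dh]; have [df Df] := (CkS _ _ _).1 Cf; split=> [x Ox|v].
  by apply: differentiable_comp; [exact: df|exact/dh/fQ].
apply: (@Ck_eq _ _ _ _ (fun x => \sum_i (l i ('D_v f x) : R) *: ('D_(e i) h \o f) x)) => //.
  move=> x Ox; have dhx := dh _ (fQ _ Ox).
  rewrite derive_comp //; last exact: df.
  transitivity ('d h (f x) ('D_v f x)); last by apply/esym/deriveE.
  rewrite [in RHS](lE ('D_v f x)) linear_sum; apply: eq_bigr => i _.
  by rewrite linearZ; congr (_ *: _); exact: deriveE.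
apply: Ck_sum => // i _; apply: Ck_scale => //.
  exact: (@Ck_comp_linear V U R^o k O ('D_v f) (l i)).
by apply: IH; [exact: (Ck_pred Cf)|exact: Dh].
Qed.

Lemma finite_basisR : finite_basis (R : normedModType R).
Proof.
exists 1%N, (fun=> 1), (fun=> idfun); split=> [_ x|v]; first exact: cvg_id.
by rewrite big_ord1 /= [RHS]mulr1.
Qed.

Lemma finite_basis_row n : finite_basis ('rV[R]_n : normedModType R).
Proof.
have lin i : linear (fun v : 'rV[R]_n => v 0 i : R^o) by move=> a u v; rewrite !mxE.
pose L i : {linear 'rV[R]_n -> R^o} :=
  HB.pack (fun v : 'rV[R]_n => v 0 i : R^o) (GRing.isLinear.Build _ _ _ _ _ (lin i)).
exists n, (fun i => delta_mx 0 i), L; split=> [i|v]; last exact: row_sum_delta.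
exact: coord_continuous.
Qed.

Lemma finite_basis_prod V W : finite_basis V -> finite_basis W ->
  finite_basis (V * W)%type.
Proof.
move=> [n [e [l [cl lE]]]] [m [e' [l' [cl' lE']]]].
pose E (i : 'I_(n + m)) : V * W :=
  match fintype.split i with inl i => (e i, 0) | inr j => (0, e' j) end.
pose l1 i (p : V * W) : R^o := l i p.1; pose l2 i (p : V * W) : R^o := l' i p.2.
have lin1 i : linear (l1 i) by move=> a u v; rewrite /l1 linearP.
have lin2 i : linear (l2 i) by move=> a u v; rewrite /l2 linearP.
pose L1 i : {linear (V * W)%type -> R^o} := HB.pack (l1 i) (GRing.isLinear.Build _ _ _ _ _ (lin1 i)).
pose L2 i : {linear (V * W)%type -> R^o} := HB.pack (l2 i) (GRing.isLinear.Build _ _ _ _ _ (lin2 i)).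
pose L (i : 'I_(n + m)) := match fintype.split i with inl i => L1 i | inr j => L2 j end.
exists (n + m)%N, E, L; split=> [i|[v w]].
  rewrite /L; case: (fintype.split i) => j x.
    by apply: (@continuous_comp _ _ _ (@fst V W) (l j)); [exact: cvg_fst|exact: cl].
  by apply: (@continuous_comp _ _ _ (@snd V W) (l' j)); [exact: cvg_snd|exact: cl'].
rewrite big_split_ord /=.
rewrite (eq_bigr (fun i => (l i v *: e i, 0))); last first.
  move=> i _; rewrite /L /E (unsplitK (inl i)) /=.
  by rewrite -[LHS]/(_ *: _, _ *: _) /= scaler0.
rewrite [X in _ + X](eq_bigr (fun i => (0, l' i w *: e' i))); last first.
  move=> i _; rewrite /L /E (unsplitK (inr i)) /=.
  by rewrite -[LHS]/(_ *: _, _ *: _) /= scaler0.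
have sum1 (I : finType) (F : I -> V) : \sum_i (F i, 0 : W) = (\sum_i F i, 0).
  by elim/big_rec2: _ => // i x y _ ->; rewrite -[LHS]/(_ + _, _ + _) /= addr0.
have sum2 (I : finType) (F : I -> W) : \sum_i (0 : V, F i) = (0, \sum_i F i).
  by elim/big_rec2: _ => // i x y _ ->; rewrite -[LHS]/(_ + _, _ + _) /= addr0.
by rewrite sum1 sum2 -lE -lE' -[RHS]/(_ + _, _ + _) /= addr0 add0r.
Qed.

Lemma Ck_pair V U W k (O : set V) (f : V -> U) (g : V -> W) : open O ->
  Ck k O f -> Ck k O g -> Ck k O (fun x => (f x, g x)).
Proof.
move=> oO; elim: k f g => [|k IH] f g.
  by move=> cf cg x Ox; apply: cvg_pair; [exact: cf|exact: cg].
move=> [df Df] [dg Dg]; split=> [x Ox|v].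
  by apply: differentiable_pair; [exact: df|exact: dg].
apply: Ck_eq (IH _ _ (Df v) (Dg v)) => //= x Ox.
have dfx := df _ Ox; have dgx := dg _ Ox.
rewrite [RHS]deriveE; last exact: differentiable_pair.
by rewrite diff_pair //= !deriveE.
Qed.

Lemma Ck_fst V W k (O : set (V * W)) : open O -> Ck k O (@fst V W).
Proof.
move=> oO; have lin : linear (@fst V W) by [].
pose L : {linear (V * W)%type -> V} := HB.pack (@fst V W) (GRing.isLinear.Build _ _ _ _ _ lin).
by apply: (@Ck_linear _ _ k O L) => // x; exact: cvg_fst.
Qed.

Lemma Ck_snd V W k (O : set (V * W)) : open O -> Ck k O (@snd V W).
Proof.
move=> oO; have lin : linear (@snd V W) by [].
pose L : {linear (V * W)%type -> W} := HB.pack (@snd V W) (GRing.isLinear.Build _ _ _ _ _ lin).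
by apply: (@Ck_linear _ _ k O L) => // x; exact: cvg_snd.
Qed.

Lemma Ck_coord V m n k (O : set V) (f : V -> 'M[R]_(m, n)) i j : open O ->
  Ck k O f -> Ck k O (fun x => f x i j).
Proof.
move=> oO Of.
have lin : linear (fun v : 'M[R]_(m, n) => v i j : R^o) by move=> a u v; rewrite !mxE.
pose L : {linear 'M[R]_(m, n) -> R^o} :=
  HB.pack (fun v : 'M[R]_(m, n) => v i j : R^o) (GRing.isLinear.Build _ _ _ _ _ lin).
apply: (@Ck_comp_linear V _ R^o k O f L) => //; exact: coord_continuous.
Qed.

Lemma Ck_matrix V m n k (O : set V) (f : V -> 'M[R]_(m, n)) : open O ->
  (forall i j, Ck k O (fun x => f x i j)) -> Ck k O f.
Proof.
move=> oO H.
apply: (@Ck_eq _ _ _ _ (fun x => \sum_i \sum_j f x i j *: delta_mx i j)) => //.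
  by move=> x _; rewrite -matrix_sum_delta.
by do 2![apply: Ck_sum => // ? _]; apply: Ck_scale => //; exact: Ck_cst.
Qed.

(** A bootstrap for functions of one variable whose derivative is expressed through functions
    already known to have class [k]: inverse, square root, arc tangent, cosine and sine. *)
Lemma Ck_derivative1 k (I : set R) (f f' : R -> R) : open I ->
  (forall x, I x -> is_derive x 1 f (f' x)) -> Ck k I f' -> Ck k.+1 I f.
Proof.
move=> oI df Cf'; split=> [x Ix|v].
  by apply/derivable1_diffP; have [] := df _ Ix.
apply: (@Ck_eq _ _ _ _ (fun x => v * f' x)) => //; last exact: Ck_mul (Ck_cst _ _ _) _.
move=> x Ix; have [dx dE] := df _ Ix.
have dfx : differentiable f x by apply/derivable1_diffP.
by rewrite -dE !deriveE // -[in RHS](mulr1 v) linearZ.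
Qed.

Lemma Ck_inv1 k : Ck k [set x : R | x != 0] (@GRing.inv R).
Proof.
have oI : open [set x : R | x != 0].
  rewrite (_ : [set x | _] = ~` [set 0]); first exact/closed_openC/accessible_closed_set1/hausdorff_accessible.
  by apply/seteqP; split=> x /= /eqP.
elim: k => [|k IH]; first by move=> x /= x0; exact: inv_continuous.
apply: (@Ck_derivative1 _ _ _ (fun x => - (x^-1 ^+ 2))) => //.
  move=> x /= x0; have := @is_deriveV R id x 1 1 x0 (is_derive_id _ _).
  by rewrite exprVn [_ *: _]mulr1.
by apply: Ck_opp => //; exact: Ck_exp.
Qed.

Lemma Ck_inv V k (O : set V) (f : V -> R) : open O -> (forall x, O x -> f x != 0) ->
  Ck k O f -> Ck k O (fun x => (f x)^-1).
Proof.
move=> oO f0 Of; apply: (Ck_comp finite_basisR oO _ Of (@Ck_inv1 k)).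
by move=> _ [x Ox <-]; exact: f0.
Qed.

Lemma Ck_sqrt1 k : Ck k [set x : R | 0 < x] (@Num.sqrt R).
Proof.
have oI : open [set x : R | 0 < x] by exact: open_gt.
elim: k => [|k IH]; first by move=> x _; exact: sqrt_continuous.
apply: (@Ck_derivative1 _ _ _ (fun x => (2 * Num.sqrt x)^-1)) => //.
apply: Ck_inv => //; last exact: Ck_mul (Ck_cst _ _ _) IH.
by move=> x /= x0; rewrite mulf_neq0 ?sqrtr_eq0 -?ltNge // pnatr_eq0.
Qed.

Lemma Ck_sqrt V k (O : set V) (f : V -> R) : open O -> (forall x, O x -> 0 < f x) ->
  Ck k O f -> Ck k O (fun x => Num.sqrt (f x)).
Proof.
move=> oO f0 Of; apply: (Ck_comp finite_basisR oO _ Of (@Ck_sqrt1 k)).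
by move=> _ [x Ox <-]; exact: f0.
Qed.

Lemma Ck_atan V k (O : set V) (f : V -> R) : open O ->
  Ck k O f -> Ck k O (fun x => atan (f x)).
Proof.
move=> oO Of; apply: (Ck_comp finite_basisR oO (@subsetT _ _) Of).
case: {Of} k => [|k]; first by move=> x _; exact: continuous_atan.
apply: (@Ck_derivative1 _ _ _ (fun x => (1 + x ^+ 2)^-1)); first exact: openT.
apply: Ck_inv; first exact: openT.
  by move=> x _; rewrite gt_eqF // ltr_wpDr ?sqr_ge0.
by apply: Ck_add (Ck_cst _ _ _) _; [exact: openT|apply: Ck_exp (Ck_id _ _); exact: openT].
Qed.

Lemma Ck_cos_sin k : Ck k setT (@cos R) /\ Ck k setT (@sin R).
Proof.
elim: k => [|k [IHc IHs]]; first by split=> x _; [exact: continuous_cos|exact: continuous_sin].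
split; [apply: (@Ck_derivative1 _ _ _ (fun x => - sin x))|apply: (@Ck_derivative1 _ _ _ cos)] => //;
  try exact: openT.
by apply: Ck_opp => //; exact: openT.
Qed.

Lemma Ck_cos V k (O : set V) (f : V -> R) : open O -> Ck k O f -> Ck k O (fun x => cos (f x)).
Proof.
by move=> oO Of; apply: (Ck_comp finite_basisR oO (@subsetT _ _) Of); have [] := Ck_cos_sin k.
Qed.

Lemma Ck_sin V k (O : set V) (f : V -> R) : open O -> Ck k O f -> Ck k O (fun x => sin (f x)).
Proof.
by move=> oO Of; apply: (Ck_comp finite_basisR oO (@subsetT _ _) Of); have [] := Ck_cos_sin k.
Qed.

Lemma Ck_mulmx V m n p k (O : set V) (f : V -> 'M[R]_(m, n)) (g : V -> 'M[R]_(n, p)) : open O ->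
  Ck k O f -> Ck k O g -> Ck k O (fun x => f x *m g x).
Proof.
move=> oO Of Og; apply: Ck_matrix => // i j.
apply: (@Ck_eq _ _ _ _ (fun x => \sum_l f x i l * g x l j)) => //.
  by move=> x _; rewrite mxE.
by apply: Ck_sum => // l _; apply: Ck_mul => //; exact: Ck_coord.
Qed.

Lemma Ck_trmx V m n k (O : set V) (f : V -> 'M[R]_(m, n)) : open O ->
  Ck k O f -> Ck k O (fun x => (f x)^T).
Proof.
move=> oO Of; apply: Ck_matrix => // i j.
apply: (@Ck_eq _ _ _ _ (fun x => f x j i)) => //; first by move=> x _; rewrite mxE.
exact: Ck_coord.
Qed.

End CkCalculus.

(** * Symmetry of second derivatives *)

Section Schwarz.
Variable R : realType.
Implicit Types (V W : normedModType R).

Lemma mvt (g dg : R -> R) (r : R) : 0 < r ->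
  (forall s, 0 <= s <= r -> is_derive s 1 g (dg s)) ->
  exists2 c, 0 < c < r & g r - g 0 = r * dg c.
Proof.
move=> r0 dG.
have dG' s : s \in `]0, r[%R -> is_derive s 1 g (dg s).
  by rewrite in_itv /= => /andP[/ltW s0 /ltW sr]; apply: dG; rewrite s0.
have cG : {within `[0, r], continuous g}.
  apply: derivable_within_continuous => s; rewrite in_itv /= => sr.
  by have [] := dG s sr.
have [c] := MVT r0 dG' cG.
by rewrite in_itv /= subr0 mulrC => cr E; exists c.
Qed.

Lemma is_derive_line V W (f : V -> W) (y u : V) (s : R) :
  differentiable f (s *: u + y) ->
  is_derive s 1 (fun t : R => f (t *: u + y)) ('D_u f (s *: u + y)).
Proof.
move=> df.
have H : is_diff s ((fun t : R => t *: u) + cst y) ((fun t : R => t *: u) + 0).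
  by apply: is_diffD.
have dl' : differentiable (fun t : R => t *: u + y) s by case: H.
have dl : 'D_1 (fun t : R => t *: u + y) s = u.
  by rewrite deriveE // (@diff_val _ _ _ _ _ _ _ H) /= fctE addr0 scale1r.
split.
  by apply/derivable1_diffP; exact: (differentiable_comp dl').
by rewrite -[LHS]/('D_1 (f \o (fun t : R => t *: u + y)) s) derive_comp // dl.
Qed.

(** Two mean value theorems: one along [u] for the difference of [h] in the direction [v], then one
    along [v] for ['D_u h]. *)
Lemma second_difference V (h : V -> R) (O : set V) (x u v : V) (r : R) : 0 < r ->
  Ck 2 O h -> (forall s t, 0 <= s <= r -> 0 <= t <= r -> O (s *: u + (t *: v + x))) ->
  exists s t, [/\ 0 < s < r, 0 < t < r &
    h (r *: u + (r *: v + x)) - h (r *: u + x) - (h (r *: v + x) - h x)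
      = r * r * 'D_v ('D_u h) (s *: u + (t *: v + x))].
Proof.
move=> r0 /CkS[dh Dh] sq; have [dDu _] := (CkS _ _ _).1 (Dh u).
have r00 : 0 <= (0 : R) <= r by rewrite lexx ltW.
have rr : 0 <= r <= r by rewrite lexx ltW.
pose g s := h (s *: u + (r *: v + x)) - h (s *: u + x).
have dg s : 0 <= s <= r ->
    is_derive s 1 g ('D_u h (s *: u + (r *: v + x)) - 'D_u h (s *: u + x)).
  move=> sr; apply: is_deriveB; apply: is_derive_line; apply: dh; first exact: sq.
  by have := sq s 0 sr r00; rewrite scale0r add0r.
have [s s0r] := mvt r0 dg.
rewrite /g !scale0r !add0r => E.
have sr : 0 <= s <= r by case/andP: s0r => /ltW -> /ltW ->.
have dg' t : 0 <= t <= r -> is_derive t 1 (fun t => 'D_u h (t *: v + (s *: u + x)))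
    ('D_v ('D_u h) (t *: v + (s *: u + x))).
  by move=> tr; apply: is_derive_line; apply: dDu; rewrite addrCA; exact: sq.
have [t t0r] := mvt r0 dg'.
rewrite scale0r add0r => E'.
have A1 : t *: v + (s *: u + x) = s *: u + (t *: v + x) by exact: addrCA.
have A2 : r *: v + (s *: u + x) = s *: u + (r *: v + x) by exact: addrCA.
exists s, t; split; [exact: s0r|exact: t0r|].
rewrite A1 A2 in E'; rewrite E E' mulrA; reflexivity.
Qed.

(** The mean value theorem matches values of [D1] and [D2] only at two different points near [x];
    continuity of both functions closes the gap. *)
Lemma eq_at_of_eq_near V (D1 D2 : V -> R) (O : set V) (x u v : V) : open O -> O x ->
  {for x, continuous D1} -> {for x, continuous D2} ->
  (forall r, 0 < r -> (forall s t, 0 <= s <= r -> 0 <= t <= r -> O (s *: u + (t *: v + x))) ->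
    exists s t s' t', [/\ 0 < s < r, 0 < t < r, 0 < s' < r, 0 < t' < r &
      D2 (s *: u + (t *: v + x)) = D1 (s' *: u + (t' *: v + x))]) ->
  D1 x = D2 x.
Proof.
move=> oO Ox c1 c2 H; apply/eqP; rewrite -subr_eq0 -normr_le0; apply/ler_addgt0Pr => e e0.
rewrite add0r; have e2 : 0 < e / 2 by rewrite divr_gt0.
pose P y := [/\ O y, `|D1 x - D1 y| < e / 2 & `|D2 x - D2 y| < e / 2].
have N : nbhs x P.
  have N1 : nbhs x O by exact: open_nbhs_nbhs.
  move/cvgrPdist_lt : c1 => /(_ _ e2) N2; move/cvgrPdist_lt : c2 => /(_ _ e2) N3.
  by apply: filterS (filterI N1 (filterI N2 N3)) => y [? []].
have cl : (fun p : R * R => p.1 *: u + (p.2 *: v + x)) p @[p --> ((0 : R), (0 : R))] --> x.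
  have E0 : x = (0 : R) *: u + ((0 : R) *: v + x) by rewrite !scale0r !add0r.
  rewrite [X in _ --> X]E0.
  apply: cvgD; first by apply: cvgZ; [exact: cvg_fst|exact: cvg_cst].
  apply: cvgD; last exact: cvg_cst.
  by apply: cvgZ; [exact: cvg_snd|exact: cvg_cst].
have [d /= d0 dN] : exists2 d : R, 0 < d & forall s t, `|s| < d -> `|t| < d ->
   P (s *: u + (t *: v + x)).
  have /nbhs_ballP[d /= d0 dN] := cl _ N; exists d => // s t sd td.
  by apply: (dN (s, t)); split; rewrite /= /ball /= sub0r normrN.
pose r := d / 2.
have r0 : 0 < r by rewrite divr_gt0.
have rd : r < d by rewrite /r ltr_pdivrMr // ltr_pMr // ltr1n.
have small s : 0 <= s <= r -> `|s| < d.
  by case/andP=> s0 sr; rewrite ger0_norm // (le_lt_trans sr).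
have small' s : 0 < s < r -> `|s| < d by case/andP=> /ltW s0 /ltW sr; apply: small; rewrite s0.
have [|s [t [s' [t' [sr tr sr' tr' E]]]]] := H r r0.
  by move=> s t sr tr; have [] := dN s t (small _ sr) (small _ tr).
have [_ _ h1] := dN s t (small' _ sr) (small' _ tr).
have [_ h2 _] := dN s' t' (small' _ sr') (small' _ tr').
rewrite -(subrKA (D2 (s *: u + (t *: v + x)))) {1}E.
rewrite (le_trans (ler_normD _ _)) // (splitr e) lerD // ltW //.
by rewrite distrC.
Qed.

(** The second difference over the parallelogram spanned by [r *: u] and [r *: v] does not depend on
    the order of the directions, and [second_difference] expresses it by either mixed derivative at
    some point of the parallelogram. *)
Lemma schwarz V (h : V -> R) (O : set V) (x u v : V) : open O -> O x ->
  Ck 2 O h -> 'D_u ('D_v h) x = 'D_v ('D_u h) x.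
Proof.
move=> oO Ox Ch; have [_ Dh] := (CkS _ _ _).1 Ch.
have [_ Dv] := (CkS _ _ _).1 (Dh v); have [_ Du] := (CkS _ _ _).1 (Dh u).
apply: (@eq_at_of_eq_near _ _ _ O x u v oO Ox (Dv u x Ox) (Du v x Ox)) => r r0 sq.
have sq' s t : 0 <= s <= r -> 0 <= t <= r -> O (s *: v + (t *: u + x)).
  by move=> sr tr; rewrite addrCA; exact: sq.
have [s [t [sr tr E]]] := second_difference r0 Ch sq.
have [s' [t' [sr' tr' E']]] := second_difference r0 Ch sq'.
exists s, t, t', s'; split; [exact: sr|exact: tr|exact: tr'|exact: sr'|].
have rr0 : r * r != 0 by rewrite mulf_neq0 // gt_eqF.
have E2 := congr1 ('D_u ('D_v h)) (addrCA (t' *: u) (s' *: v) x).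
apply: (etrans _ (esym E2)); apply: (mulfI rr0).
apply: (etrans (esym E)); apply: (etrans _ E'); rewrite (addrCA (r *: v)).
by rewrite !opprB addrACA [RHS]addrACA; congr (_ + _); exact: addrC.
Qed.

Lemma derive_coord V m n (f : V -> 'M[R]_(m, n)) x v i j : derivable f x v ->
  ('D_v f x) i j = 'D_v (fun y => f y i j) x.
Proof. by move=> df; rewrite derive_mx // mxE. Qed.

End Schwarz.

(** * Smoothness on subsets of the ambient space *)

Section SmoothOn.
Variable R : realType.
Implicit Types (U V W : normedModType R).

Lemma smooth_on_open V W (O : set V) (f : V -> W) k :
  open O -> smooth_on O f -> Ck k O f.
Proof.
move=> oO sf; apply: Ck_local => x Ox; have [Q [h [oQ Qx Ch hE] ] ] := sf x Ox.
exists (O `&` Q); split=> //; apply: (@Ck_eq _ _ _ _ _ h); first exact: openI.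
  by move=> y [Oy Qy]; rewrite hE.
by apply: Ck_sub (Ch k) => y [].
Qed.

Lemma Ck_smooth_on V W (X Q : set V) (f : V -> W) :
  open Q -> X `<=` Q -> (forall k, Ck k Q f) -> smooth_on X f.
Proof. by move=> oQ XQ Cf x /XQ Qx; exists Q, f; split. Qed.

Lemma smooth_on_sub V W (X Y : set V) (f : V -> W) :
  Y `<=` X -> smooth_on X f -> smooth_on Y f.
Proof.
move=> YX sf x /YX /sf [N [h [oN Nx Ch hE]]]; exists N, h; split=> // y /YX; exact: hE.
Qed.

Lemma smooth_on_comp U V W (X : set U) (Y : set V) (f : U -> V) (g : V -> W) :
  finite_basis V -> f @` X `<=` Y -> smooth_on X f -> smooth_on Y g ->
  smooth_on X (g \o f).
Proof.
move=> bV fXY sf sg x Xx; have Yfx : Y (f x) by apply: fXY; exists x.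
have [N [h [oN Nx Ch hE]]] := sf x Xx; have [Q [l [oQ Qfx Cl lE]]] := sg _ Yfx.
have oNQ : open (N `&` h @^-1` Q).
  rewrite openE => y [Ny Qy]; apply: filterI; first exact: open_nbhs_nbhs.
  by apply: (Ck_continuous (Ch 0%N) Ny); exact: open_nbhs_nbhs.
exists (N `&` h @^-1` Q), (l \o h); split=> //.
- by split=> //=; rewrite -hE.
- move=> k; apply: (Ck_comp bV oNQ _ _ (Cl k)); first by move=> _ [y [_ Qy] <-].
  by apply: Ck_sub (Ch k) => y [].
- by move=> y Xy [Ny Qy] /=; rewrite hE // lE //; rewrite -hE //; apply: fXY; exists y.
Qed.

(** Relative openness of preimages, in the form of the ambient open set that [local_coord] asks
    for. *)
Lemma smooth_on_preimage V W (X : set V) (f : V -> W) (B : set W) x :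
  smooth_on X f -> X x -> nbhs (f x) B ->
  exists O, [/\ open O, O x & forall y, X y -> O y -> B (f y)].
Proof.
move=> sf Xx Bfx; have [N [h [oN Nx Ch hE]]] := sf x Xx.
have : nbhs x (N `&` h @^-1` B).
  apply: filterI; first exact: open_nbhs_nbhs.
  by apply: (Ck_continuous (Ch 0%N) Nx); rewrite /= -hE.
rewrite nbhsE => -[Q [oQ Qx] QN]; exists Q; split=> // y Xy /QN [Ny].
by rewrite /= -hE.
Qed.

End SmoothOn.

(** * Charts of the sphere and covectors *)

Section RowVectors.
Variable R : realType.
Implicit Types (V W : normedModType R).

Lemma dotE n (u v : 'rV[R]_n) : dot u v = \sum_i u 0 i * v 0 i.
Proof. by rewrite /dot !mxE; apply: eq_bigr => i _; rewrite !mxE. Qed.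

Lemma dotC n (u v : 'rV[R]_n) : dot u v = dot v u.
Proof. by rewrite !dotE; apply: eq_bigr => i _; rewrite mulrC. Qed.

Lemma dotDl n (u v w : 'rV[R]_n) : dot (u + v) w = dot u w + dot v w.
Proof. by rewrite /dot mulmxDl mxE. Qed.

Lemma dotDr n (u v w : 'rV[R]_n) : dot w (u + v) = dot w u + dot w v.
Proof. by rewrite !(dotC w) dotDl. Qed.

Lemma dotZl n a (u v : 'rV[R]_n) : dot (a *: u) v = a * dot u v.
Proof. by rewrite /dot -scalemxAl mxE. Qed.

Lemma dotZr n a (u v : 'rV[R]_n) : dot u (a *: v) = a * dot u v.
Proof. by rewrite !(dotC u) dotZl. Qed.

Lemma dot0l n (v : 'rV[R]_n) : dot 0 v = 0.
Proof. by rewrite /dot mul0mx mxE. Qed.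

Lemma dot0r n (v : 'rV[R]_n) : dot v 0 = 0.
Proof. by rewrite dotC dot0l. Qed.

Lemma dotBl n (u v w : 'rV[R]_n) : dot (u - v) w = dot u w - dot v w.
Proof. by rewrite -scaleN1r dotDl dotZl mulN1r. Qed.

Lemma dot_ge0 n (v : 'rV[R]_n) : 0 <= dot v v.
Proof. by rewrite dotE; apply: sumr_ge0 => i _; rewrite -expr2 sqr_ge0. Qed.

Lemma dot_eq0 n (v : 'rV[R]_n) : dot v v = 0 -> v = 0.
Proof.
rewrite dotE => /eqP; rewrite psumr_eq0 => [/allP H|i _]; last by rewrite -expr2 sqr_ge0.
apply/rowP => i; rewrite mxE; have := H i (mem_index_enum _).
by rewrite mulf_eq0 orbb => /eqP.
Qed.

Lemma dot_mul n m (u : 'rV[R]_n) (v : 'rV[R]_m) (M : 'M[R]_(m, n)) :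
  dot u (v *m M) = dot (u *m M^T) v.
Proof. by rewrite /dot trmx_mul mulmxA. Qed.

Lemma dot_delta n (u : 'rV[R]_n) i : dot u (delta_mx 0 i) = u 0 i.
Proof.
rewrite dotE (bigD1 i) //= big1 ?addr0 => [|j ji]; first by rewrite mxE !eqxx mulr1.
by rewrite mxE (negbTE ji) andbF mulr0.
Qed.

Lemma formE n (B : 'M[R]_n) (v w : 'rV[R]_n) : form B v w = dot (v *m B) w.
Proof. by []. Qed.

Lemma form_mul n m (B : 'M[R]_n) (J : 'M[R]_(m, n)) (v w : 'rV[R]_m) :
  form (J *m B *m J^T) v w = form B (v *m J) (w *m J).
Proof. by rewrite /form trmx_mul !mulmxA. Qed.

Lemma unitmx_inj n (M : 'M[R]_n) :
  (forall v : 'rV_n, v *m M = 0 -> v = 0) -> M \in unitmx.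
Proof. by move=> H; rewrite -row_free_unit; apply: inj_row_free. Qed.

Lemma differentiable_coord' V m n (f : V -> 'M[R]_(m, n)) z i j :
  differentiable f z -> differentiable (fun y => f y i j) z.
Proof.
by move=> df; apply: (differentiable_comp (g := fun M : 'M[R]_(m, n) => M i j)) => //; exact: differentiable_coord.
Qed.

Lemma dot_fun V n (f g : V -> 'rV[R]_n) :
  (fun y => dot (f y) (g y)) = \sum_(i < n) (fun y => f y 0 i * g y 0 i).
Proof. by apply/funext => y; rewrite dotE fct_sumE. Qed.

Lemma differentiable_dot V n (f g : V -> 'rV[R]_n) z :
  differentiable f z -> differentiable g z ->
  differentiable (fun y => dot (f y) (g y)) z.
Proof.
move=> df dg; rewrite dot_fun; apply: differentiable_sum => i.
by apply: differentiableM; exact: differentiable_coord'.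
Qed.

Lemma derive_dot V n (f g : V -> 'rV[R]_n) z v :
  differentiable f z -> differentiable g z ->
  'D_v (fun y => dot (f y) (g y)) z = dot ('D_v f z) (g z) + dot (f z) ('D_v g z).
Proof.
move=> df dg; rewrite dot_fun derive_sum => [|i]; last first.
  by apply: diff_derivable; apply: differentiableM; exact: differentiable_coord'.
rewrite !dotE -big_split /=; apply: eq_bigr => i _.
rewrite deriveM; [|exact/diff_derivable/differentiable_coord'|exact/diff_derivable/differentiable_coord'].
rewrite !derive_coord; [|exact: diff_derivable|exact: diff_derivable].
by rewrite [LHS]addrC; congr (_ + _); exact: mulrC.
Qed.

Lemma schwarz_mx V m n (psi : V -> 'M[R]_(m, n)) (O : set V) x u v : open O -> O x ->
  Ck 2 O psi -> 'D_u ('D_v psi) x = 'D_v ('D_u psi) x.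
Proof.
move=> oO Ox Cpsi; have [dpsi Dpsi] := (CkS _ _ _).1 Cpsi.
have dD w : differentiable ('D_w psi) x by have [+ _] := (CkS _ _ _).1 (Dpsi w); apply.
have EE w w' i j : ('D_w' ('D_w psi) x) i j = 'D_w' ('D_w (fun y => psi y i j)) x.
  rewrite derive_coord; last exact: diff_derivable.
  apply: near_eq_derive; apply: filterS (open_nbhs_nbhs (conj oO Ox)) => y Oy.
  by apply: derive_coord; apply: diff_derivable; exact: dpsi.
apply/matrixP => i j; apply: (etrans (EE _ _ i j)); apply: (etrans _ (esym (EE _ _ i j))).
by apply: (schwarz _ _ oO Ox); exact: Ck_coord.
Qed.

Lemma derive_fst V W (W' : normedModType R) (f : V -> W') (z : V * W) v w :
  @derive R (V * W)%type W' (fun y => f y.1) z (v, w) = 'D_v f z.1.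
Proof. by []. Qed.

Lemma derive_snd V W (W' : normedModType R) (f : W -> W') (z : V * W) v w :
  @derive R (V * W)%type W' (fun y => f y.2) z (v, w) = 'D_w f z.2.
Proof. by []. Qed.

Lemma differentiable_fst V W (W' : normedModType R) (f : V -> W') (z : V * W) :
  differentiable f z.1 -> differentiable (fun y : V * W => f y.1) z.
Proof.
move=> df; have [dfst _] := (CkS _ _ _).1 (@Ck_fst R V W 1 setT openT).
exact: (differentiable_comp (dfst z I)).
Qed.

End RowVectors.

(** * The bracket in terms of ambient positions and covectors *)

Section PoissonLift.
Variable R : realType.
Local Notation e := (fun i : 'I_2 => delta_mx 0 i : 'rV[R]_2).

(* [E] and [L] are the derivatives of the covector along the momenta and along
   the positions; [c = 1] on the unit sphere, and [x = 0], [c = 0] in the plane. *)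
Lemma poisson_lift_algebra n (x xi Fx Fxi Hx Hxi : 'rV[R]_n) (c : R) (p : 'rV[R]_2)
    (J L E : 'I_2 -> 'rV[R]_n) :
  (forall a b, dot a b = dot a x * dot b x + \sum_i dot a (E i) * dot b (J i)) ->
  (forall i k, dot (L i) (J k) = dot (L k) (J i)) ->
  (forall i, dot (L i) x = - (c * p 0 i)) ->
  (forall a, dot a xi = \sum_i p 0 i * dot a (E i)) ->
  \sum_(i < 2) ((dot Fx (J i) + dot Fxi (L i)) * dot Hxi (E i)
                - dot Fxi (E i) * (dot Hx (J i) + dot Hxi (L i)))
  = dot Fx Hxi - dot Fx x * dot Hxi x - (dot Fxi Hx - dot Fxi x * dot Hx x)
    + c * (dot Hxi x * dot Fxi xi - dot Fxi x * dot Hxi xi).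
Proof.
move=> D S T X.
rewrite (dotC Fx) (D Hxi Fx) (D Fxi Hx) !X.
rewrite !big_ord_recl !big_ord0 /=.
have := S ord0 (lift ord0 ord0).
rewrite (D Fxi (L ord0)) (D Hxi (L ord0)) (D Fxi (L (lift ord0 ord0))) (D Hxi (L (lift ord0 ord0))).
rewrite !T !big_ord_recl !big_ord0 /=.
move: (dot (L _) (J _)) => S01 ->; ring.
Qed.

(** Differentiating [dot xi (d_k psi) = p_k] along [q_i] gives minus [dot xi (d_i d_k psi)], which
    is symmetric by Schwarz. Geometrically, the lift of the chart pulls the ambient symplectic form
    back to the standard one. *)
Lemma covector_deriv_sym n (psi : 'rV[R]_2 -> 'rV[R]_n) (xi : 'rV[R]_2 * 'rV[R]_2 -> 'rV[R]_n)
    (O : set 'rV[R]_2) z (i k : 'I_2) :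
  open O -> O z.1 -> Ck 2 O psi -> differentiable xi z ->
  (forall y, O y.1 -> forall k, dot (xi y) ('D_(e k) psi y.1) = y.2 0 k) ->
  dot ('D_(e i, 0) xi z) ('D_(e k) psi z.1) = dot ('D_(e k, 0) xi z) ('D_(e i) psi z.1).
Proof.
move=> oO Oz Cpsi dxi xiE.
have [dpsi Dpsi] := (CkS _ _ _).1 Cpsi.
have dD l : differentiable ('D_(e l) psi) z.1 by have [+ _] := (CkS _ _ _).1 (Dpsi (e l)); apply.
have key j l : dot ('D_(e j, 0) xi z) ('D_(e l) psi z.1)
    = - dot (xi z) ('D_(e j) ('D_(e l) psi) z.1).
  have dc1 := @differentiable_fst R _ 'rV[R]_2 _ _ z (dD l).
  have H : 'D_(e j, 0) (fun y : 'rV[R]_2 * 'rV[R]_2 => dot (xi y) ('D_(e l) psi y.1)) z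
      = dot ('D_(e j, 0) xi z) ('D_(e l) psi z.1) + dot (xi z) ('D_(e j) ('D_(e l) psi) z.1)
    := derive_dot (e j, 0) dxi dc1.
  have nO : nbhs z [set y : 'rV[R]_2 * 'rV[R]_2 | O y.1].
    have [+ _] := (CkS _ _ _).1 (@Ck_fst R 'rV[R]_2 'rV[R]_2 1 setT openT).
    by move=> /(_ z I) /differentiable_continuous; apply; exact: open_nbhs_nbhs.
  have H2 : 'D_(e j, 0) (fun y : 'rV[R]_2 * 'rV[R]_2 => dot (xi y) ('D_(e l) psi y.1)) z
      = 'D_(0 : 'rV[R]_2) (fun p : 'rV[R]_2 => p 0 l) z.2.
    rewrite (near_eq_derive (g := fun y : 'rV[R]_2 * 'rV[R]_2 => y.2 0 l)); first exact: derive_snd.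
    by apply: filterS nO => y Oy; exact: xiE.
  rewrite derive0 in H2; rewrite H2 in H.
  by apply/eqP; rewrite -addr_eq0 -H.
have S := congr1 (fun y => - dot (xi z) y) (schwarz_mx (e i) (e k) oO Oz Cpsi).
exact: etrans (key i k) (etrans S (esym (key k i))).
Qed.

End PoissonLift.

(** * Immersed charts, tangent planes and covectors *)

Section Charts.
Variable R : realType.
Local Notation e := (fun i : 'I_2 => delta_mx 0 i : 'rV[R]_2).

(* Unlike [local_coord], not injective: the angle of [cyl] is only defined modulo [2 pi]. *)
Definition immersed_chart (O : set 'rV[R]_2) (psi : 'rV[R]_2 -> 'rV[R]_3) : Prop :=
  [/\ open O, forall k, Ck k O psi, forall q, O q -> S2 (psi q) &
      forall q (v : 'rV_2), O q -> v *m jacobian psi q = 0 -> v = 0].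

Lemma jacobianE n m (psi : 'rV[R]_n -> 'rV[R]_m) q (v : 'rV[R]_n) : differentiable psi q ->
  v *m jacobian psi q = 'D_v psi q.
Proof. by move=> d; rewrite deriveEjacobian. Qed.

Lemma derive_left_inverse n m (psi : 'rV[R]_n -> 'rV[R]_m) (g : 'rV[R]_m -> 'rV[R]_n) q (v : 'rV[R]_n) :
  differentiable psi q -> differentiable g (psi q) ->
  (\forall y \near q, g (psi y) = y) -> v *m jacobian psi q = 0 -> v = 0.
Proof.
move=> dpsi dg gpsi; rewrite jacobianE // => v0.
have := @derive_id R _ q v; rewrite -(near_eq_derive (f := g \o psi)) //.
by rewrite derive_comp // v0 derive0.
Qed.

Lemma local_coord_immersed O psi : local_coord O psi -> immersed_chart O psi.
Proof.
move=> [oO [sm [ff inj surj] [g [sg gK]]] [W [oW imE]]].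
have Cpsi k : Ck k O psi by exact: smooth_on_open.
split=> // [q Oq|q v Oq].
  by have : (psi @` O) (psi q) by [exists q]; rewrite imE => -[].
have [N [h [oN Nq Ch hE]]] := sg (psi q) (ex_intro2 _ _ q Oq erefl).
have [dh _] := (CkS _ _ _).1 (Ch 1%N).
have [dpsi _] := (CkS _ _ _).1 (Cpsi 1%N).
have dq := dpsi q Oq.
apply: (derive_left_inverse (g := h)) => //; first exact: dh.
have nN : nbhs q (psi @^-1` N).
  by apply: (differentiable_continuous dq); exact: open_nbhs_nbhs.
apply: filterS (filterI (open_nbhs_nbhs (conj oO Oq)) nN) => y [Oy Ny].
by rewrite -hE ?gK //; exists y.
Qed.

Section AtPoint.
Variables (O : set 'rV[R]_2) (psi : 'rV[R]_2 -> 'rV[R]_3) (q : 'rV[R]_2).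
Hypotheses (ic : immersed_chart O psi) (Oq : O q).
Let J := jacobian psi q.

Lemma chart_differentiable : differentiable psi q.
Proof. by have [_ C _ _] := ic; have [+ _] := (CkS _ _ _).1 (C 1%N); apply. Qed.

Lemma chart_tangent (v : 'rV[R]_2) : tangent (psi q) (v *m J).
Proof.
have [oO C onS _] := ic; have d := chart_differentiable.
rewrite /tangent /J jacobianE //.
have := derive_dot v d d; rewrite (near_eq_derive (g := cst (1 : R))); last first.
  by apply: filterS (open_nbhs_nbhs (conj oO Oq)) => y; exact: onS.
rewrite derive_cst dotC -mulr2n => /esym/eqP.
by rewrite mulrn_eq0 /= => /eqP.
Qed.

Lemma gram_unit : J *m J^T \in unitmx.
Proof.
apply: unitmx_inj => v; rewrite mulmxA => H; have [_ _ _ inj] := ic; apply: (inj q) => //.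
by apply: dot_eq0; rewrite dot_mul H dot0l.
Qed.

Lemma chart_normal : psi q *m J^T = 0.
Proof.
apply/rowP => i; rewrite -(dot_delta (psi q *m J^T)) -dot_mul [RHS]mxE; exact: chart_tangent.
Qed.

(** Both sides are the orthogonal projection onto the tangent plane. They agree on the rows of [J]
    and on the normal [psi q], and these three rows form an invertible matrix. *)
Lemma chart_projection : J^T *m invmx (J *m J^T) *m J = 1%:M - (psi q)^T *m psi q.
Proof.
have [_ _ onS inj] := ic; have x1 : psi q *m (psi q)^T = 1%:M.
  by rewrite [LHS]mx11_scalar; congr (_%:M); exact: onS.
have Jx : J *m (psi q)^T = 0 by rewrite -[J]trmxK -trmx_mul chart_normal trmx0.
(* The size [2 + 1] keeps the blocks visible and is convertible to 3. *)
pose B : matrix R (2 + 1) 3 := col_mx J (psi q).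
have uB : (B : matrix R 3 3) \in unitmx.
  apply: unitmx_inj => v vB.
  pose w : matrix R 1 (2 + 1) := v.
  have : w *m B = 0 by exact: vB.
  rewrite -[w]hsubmxK mul_row_col => H.
  have c0 : rsubmx w = 0.
    have := congr1 (mulmx^~ (psi q)^T) H.
    by rewrite mulmxDl -!mulmxA Jx x1 mulmx0 mulmx1 mul0mx add0r.
  have a0 : lsubmx w = 0.
    by apply: (inj q) => //; rewrite c0 mul0mx addr0 in H; exact: H.
  by rewrite -[v]/w -[w]hsubmxK c0 a0 row_mx0.
have E : B *m (J^T *m invmx (J *m J^T) *m J) = B *m (1%:M - (psi q)^T *m psi q).
  rewrite !mul_col_mx; congr col_mx.
    rewrite !mulmxA mulmxV ?gram_unit // mul1mx.
    by rewrite mulmxBr mulmx1 mulmxA Jx mul0mx subr0.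
  by rewrite !mulmxA chart_normal !mul0mx mulmxBr mulmx1 mulmxA x1 mul1mx subrr.
exact: (can_inj (mulKmx uB) E).
Qed.

Lemma covector_comp p : covector psi q p *m J^T = p.
Proof. by rewrite /covector -/J -!mulmxA mulVmx ?mulmx1 // gram_unit. Qed.

Lemma covector_tangent p : tangent (psi q) (covector psi q p).
Proof. exact: chart_tangent. Qed.

Lemma covector_unique xi : tangent (psi q) xi -> xi = covector psi q (xi *m J^T).
Proof.
move=> t; rewrite /covector -/J -!mulmxA (mulmxA J^T) chart_projection mulmxBr mulmx1 mulmxA.
have -> : xi *m (psi q)^T = 0.
  by rewrite [LHS]mx11_scalar -[_ 0 0]/(dot xi (psi q)) dotC t raddf0.
by rewrite mul0mx subr0.
Qed.

Lemma tangent_chart w : tangent (psi q) w -> exists v, w = v *m J.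
Proof. by move=> /covector_unique ->; rewrite /covector -/J; eexists. Qed.

(** The covectors of the unit momenta and the coordinate vectors are dual bases of the tangent
    plane. This is the decomposition that [poisson_lift_algebra] takes as its first hypothesis. *)
Lemma chart_dot (a b : 'rV[R]_3) :
  dot a b = dot a (psi q) * dot b (psi q) +
    \sum_i dot a (covector psi q (e i)) * dot b ('D_(e i) psi q).
Proof.
have -> : dot a b = dot a (psi q) * dot b (psi q) + dot (a *m (1%:M - (psi q)^T *m psi q)) b.
  rewrite mulmxBr mulmx1 dotBl mulmxA [a *m (psi q)^T]mx11_scalar mul_scalar_mx dotZl.
  by rewrite -[(a *m _) 0 0]/(dot a (psi q)) (dotC (psi q)) addrC subrK.
congr (_ + _); rewrite -chart_projection mulmxA dotC dot_mul dotE.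
apply: eq_bigr => i _; rewrite mulrC; congr (_ * _).
  by rewrite /covector -/J -(mulmxA (e i)) dot_mul dot_delta trmx_mul trmx_inv trmx_mul trmxK.
rewrite -dot_delta -dot_mul /J jacobianE //; exact: chart_differentiable.
Qed.

End AtPoint.

End Charts.

Section ChartCalculus.
Variable R : realType.
Implicit Types V W : normedModType R.
Local Notation e := (fun i : 'I_2 => delta_mx 0 i : 'rV[R]_2).

(** The adjugate formula, where [1 - i] in ['I_2] is the other index. It exhibits the inverse as a
    smooth function of the entries. *)
Lemma invmx2 (M : 'M[R]_2) : M \in unitmx ->
  invmx M = (M 0 0 * M 1 1 - M 0 1 * M 1 0)^-1 *:
    \matrix_(i, j) (if i == j then M (1 - i) (1 - i) else - M i j).
Proof.
move=> uM; set d := _ - _; set N := \matrix_(i, j) _.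
have o1 : lift ord0 ord0 = 1 :> 'I_2 by apply/val_inj.
have z10 : 1 - 1 = 0 :> 'I_2 by apply/val_inj.
have z11 : 1 - 0 = 1 :> 'I_2 by apply/val_inj.
have ord2 (i : 'I_2) : i = 0 \/ i = 1.
  by case: i => [[|[|//]] ?]; [left|right]; apply/val_inj.
have MN : M *m N = d%:M.
  apply/matrixP => i j; rewrite !mxE !big_ord_recl big_ord0 !mxE o1 addr0 /d.
  by case: (ord2 i) => ->; case: (ord2 j) => ->; rewrite /= ?z10 ?z11 ?mulr1n ?mulr0n; ring.
have d0 : d != 0.
  apply/eqP => d0; have N0 : N = 0.
    by apply: (can_inj (mulKmx uM)); rewrite MN d0 mulmx0 raddf0.
  have M0 : M = 0.
    apply/matrixP => i j; have := congr1 (fun A : 'M[R]_2 => A i j) N0.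
    have := congr1 (fun A : 'M[R]_2 => A (1 - i) (1 - j)) N0; rewrite !mxE.
    case: (ord2 i) => ->; case: (ord2 j) => ->; rewrite /= ?z10 ?z11 ?z10 ?z11 //.
      by move=> _ /eqP; rewrite oppr_eq0 => /eqP.
    by move=> _ /eqP; rewrite oppr_eq0 => /eqP.
  have := mulmxV uM; rewrite M0 mul0mx => /matrixP /(_ 0 0).
  by rewrite !mxE eqxx => /esym/eqP; rewrite oner_eq0.
apply: (can_inj (mulKmx uM)); rewrite mulmxV // -scalemxAr MN.
by rewrite scale_scalar_mx mulVf.
Qed.

Lemma Ck_invmx2 V k (O : set V) (M : V -> 'M[R]_2) : open O ->
  (forall x, O x -> M x \in unitmx) -> Ck k O M -> Ck k O (fun x => invmx (M x)).
Proof.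
move=> oO uM CM.
have CMij i j : Ck k O (fun x => M x i j) by exact: Ck_coord.
pose d x := M x 0 0 * M x 1 1 - M x 0 1 * M x 1 0.
have Cd : Ck k O d by apply: Ck_add => //; [exact: Ck_mul|apply: Ck_opp => //; exact: Ck_mul].
apply: (@Ck_eq _ _ _ _ _ (fun x => (d x)^-1 *:
    \matrix_(i, j) (if i == j then M x (1 - i) (1 - i) else - M x i j))) => //.
  by move=> x Ox; rewrite invmx2 // uM.
apply: Ck_scale => //.
  apply: Ck_inv => // x Ox; apply/eqP => d0.
  have := uM x Ox; rewrite unitmxE unitfE.
  have u := uM x Ox.
  have := mulmxV u; rewrite (invmx2 u) -/(d x) d0 invr0 scale0r mulmx0 => /matrixP /(_ 0 0).
  by rewrite !mxE eqxx => /esym/eqP; rewrite oner_eq0.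
apply: Ck_matrix => // i j.
case ij : (i == j).
  by apply: (@Ck_eq _ _ _ _ _ (fun x => M x (1 - i) (1 - i))) => // x _; rewrite mxE ij.
apply: (@Ck_eq _ _ _ _ _ (fun x => - M x i j)) => //; last exact: Ck_opp.
by move=> x _; rewrite mxE ij.
Qed.

Lemma Ck_jacobian n m k (O : set 'rV[R]_n) (psi : 'rV[R]_n -> 'rV[R]_m) : open O ->
  Ck k.+1 O psi -> Ck k O (jacobian psi).
Proof.
move=> oO /CkS [dpsi Dpsi]; apply: Ck_matrix => // i j.
apply: (@Ck_eq _ _ _ _ _ (fun x => 'D_(delta_mx 0 i : 'rV_n) psi x 0 j)) => //.
  by move=> x Ox; rewrite -jacobianE -?rowE ?mxE //; exact: dpsi.
by apply: Ck_coord => //; exact: Dpsi.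
Qed.

Lemma open_fst V W (O : set V) : open O -> open [set z : V * W | O z.1].
Proof. by move=> oO; apply: open_comp => // z _; exact: cvg_fst. Qed.

Lemma Ck_comp_fst V W W' k (O : set V) (f : V -> W') : finite_basis V -> open O ->
  Ck k O f -> Ck k [set z : V * W | O z.1] (fun z => f z.1).
Proof.
move=> bV oO Cf; have oO' := @open_fst V W O oO.
apply: (@Ck_comp R (V * W)%type V W' k _ O (@fst V W) f bV oO' _ _ Cf); last exact: Ck_fst.
by move=> _ [z Oz <-].
Qed.

Lemma Ck_gram O (psi : 'rV[R]_2 -> 'rV[R]_3) k : immersed_chart O psi ->
  Ck k O (fun q => invmx (jacobian psi q *m (jacobian psi q)^T)).
Proof.
move=> ic; have [oO C _ _] := ic; have CJ : Ck k O (jacobian psi) by exact: Ck_jacobian.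
apply: Ck_invmx2 => //; first by move=> q Oq; exact: (gram_unit ic).
by apply: Ck_mulmx => //; exact: Ck_trmx.
Qed.

Lemma Ck_covector O (psi : 'rV[R]_2 -> 'rV[R]_3) k : immersed_chart O psi ->
  Ck k [set z : 'rV[R]_2 * 'rV[R]_2 | O z.1] (fun z => covector psi z.1 z.2).
Proof.
move=> ic; have [oO C _ _] := ic; have oO' := @open_fst 'rV[R]_2 'rV[R]_2 O oO.
have CJ : Ck k O (jacobian psi) by exact: Ck_jacobian.
have b2 := finite_basis_row R 2.
have C1 := @Ck_comp_fst 'rV[R]_2 'rV[R]_2 _ k O _ b2 oO CJ.
have C2 := @Ck_comp_fst 'rV[R]_2 'rV[R]_2 _ k O _ b2 oO (Ck_gram k ic).
have C3 := @Ck_snd R 'rV[R]_2 'rV[R]_2 k _ oO'.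
exact: (Ck_mulmx oO' (Ck_mulmx oO' C3 C2) C1).
Qed.

Section Velocity.
Variables (g : 'rV[R]_3 -> 'M[R]_3).
Hypothesis rg : riemannian g.

(** [velocity] picks some solution by choice. The difference of two solutions is orthogonal to
    itself for the metric, so positivity makes the solution unique. *)
Lemma velocity_eq x xi v : S2 x -> tangent x v ->
  (forall w, tangent x w -> form (g x) v w = dot xi w) -> velocity g x xi = v.
Proof.
move=> Sx tv vE; have [_ _ pos] := rg; rewrite /velocity.
case: xgetP => [w _ [tw wE]|/(_ v)]; last by case; split.
apply/eqP; rewrite -subr_eq0; apply/negP => /negP n0.
have tvw : tangent x (w - v) by rewrite /tangent dotC dotBl !(dotC _ x) tw tv subrr.
have := pos x (w - v) Sx tvw n0.
by rewrite formE mulmxBl dotBl -!formE wE // vE // subrr ltxx.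
Qed.

Lemma metric_in_coord_sym O psi q : immersed_chart O psi -> O q ->
  (metric_in_coord psi g q)^T = metric_in_coord psi g q.
Proof.
move=> ic Oq; have [_ sym _] := rg; have [_ _ onS _] := ic.
apply/matrixP => i j; rewrite mxE.
have ME (M : 'M[R]_2) k l : M k l = form M (e k) (e l).
  by rewrite formE dot_delta -rowE mxE.
rewrite ME [RHS]ME /metric_in_coord !form_mul.
by apply: sym; [exact: onS|exact: (chart_tangent ic)|exact: (chart_tangent ic)].
Qed.

Lemma metric_in_coord_unit O psi q : immersed_chart O psi -> O q ->
  metric_in_coord psi g q \in unitmx.
Proof.
move=> ic Oq; have [_ _ pos] := rg; have [_ _ onS inj] := ic.
apply: unitmx_inj => v v0; apply: (inj q) => //; apply/eqP/negPn/negP => n0.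
have := pos _ _ (onS _ Oq) (chart_tangent ic Oq v) n0.
by rewrite -form_mul formE -/(metric_in_coord psi g q) v0 dot0l ltxx.
Qed.

Lemma kinetic_chart O psi q xi : immersed_chart O psi -> O q -> tangent (psi q) xi ->
  let p := xi *m (jacobian psi q)^T in
  kinetic g (psi q, xi) = 2^-1 * form (invmx (metric_in_coord psi g q)) p p.
Proof.
move=> ic Oq txi p; have [_ _ onS inj] := ic.
set G := metric_in_coord psi g q; set J := jacobian psi q.
have uG : G \in unitmx by exact: (metric_in_coord_unit ic).
have GT : G^T = G by exact: (metric_in_coord_sym ic).
have -> : kinetic g (psi q, xi) = 2^-1 * form (g (psi q)) (p *m invmx G *m J) (p *m invmx G *m J).
  rewrite /kinetic /= (velocity_eq (v := p *m invmx G *m J)) //; first exact: onS.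
    exact: (chart_tangent ic).
  move=> w /(tangent_chart ic Oq) [v ->].
  rewrite -form_mul -/J -[J *m _ *m _]/G formE mulmxKV // dot_mul //.
rewrite -form_mul -[J *m _ *m _]/G formE mulmxKV // formE.
by rewrite dotC.
Qed.

End Velocity.

Section Poisson.
Variables (O : set 'rV[R]_2) (psi : 'rV[R]_2 -> 'rV[R]_3) (q p : 'rV[R]_2).
Hypotheses (ic : immersed_chart O psi) (Oq : O q).
Let cov (z : 'rV[R]_2 * 'rV[R]_2) := covector psi z.1 z.2.
Let pos (z : 'rV[R]_2 * 'rV[R]_2) := psi z.1.

(** An ambient gradient along the lifted chart. It is not unique, as only its pairing with
    directions tangent to the cotangent bundle is prescribed, and [f] need not be defined off that
    bundle. *)
Definition has_gradient (f : 'rV[R]_2 * 'rV[R]_2 -> R) (Fx Fxi : 'rV[R]_3) :=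
  forall v, 'D_v f (q, p) = dot Fx ('D_v pos (q, p)) + dot Fxi ('D_v cov (q, p)).

Lemma derive_pos v w : 'D_(v, w) pos (q, p) = 'D_v psi q.
Proof. exact: derive_fst. Qed.

Lemma differentiable_pos_cov : differentiable pos (q, p) /\ differentiable cov (q, p).
Proof.
split; first by apply: differentiable_fst; exact: (chart_differentiable ic).
by have [+ _] := (CkS _ _ _).1 (Ck_covector 1 ic); apply.
Qed.

Let nO : nbhs (q, p) [set z : 'rV[R]_2 * 'rV[R]_2 | O z.1].
Proof.
have [oO _ _ _] := ic; have oO' := @open_fst 'rV[R]_2 'rV[R]_2 O oO.
exact: open_nbhs_nbhs.
Qed.

Let covJ y k : O y.1 -> dot (cov y) ('D_(e k) psi y.1) = y.2 0 k.
Proof.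
move=> Oy; rewrite -jacobianE; last exact: (chart_differentiable ic).
by rewrite dot_mul (covector_comp ic) // dot_delta.
Qed.

Lemma derive_covector_normal v w :
  dot ('D_(v, w) cov (q, p)) (psi q) = - dot (covector psi q p) ('D_v psi q).
Proof.
have [dpos dcov] := differentiable_pos_cov.
have := derive_dot (v, w) dcov dpos; rewrite derive_pos.
rewrite (near_eq_derive (g := cst (0 : R))); last first.
  by apply: filterS nO => y Oy; rewrite dotC; exact: (covector_tangent ic).
by rewrite derive_cst => /esym/eqP; rewrite addr_eq0 => /eqP.
Qed.

Lemma derive_covector_momentum i : 'D_(0, e i) cov (q, p) = covector psi q (e i).
Proof.
have [dpos dcov] := differentiable_pos_cov; have [_ C _ _] := ic.
have t : tangent (psi q) ('D_(0, e i) cov (q, p)).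
  by rewrite /tangent dotC derive_covector_normal derive0 dot0r oppr0.
rewrite (covector_unique ic Oq t); congr covector; apply/rowP => k.
rewrite -dot_delta -dot_mul jacobianE; last exact: (chart_differentiable ic).
have dD : differentiable ('D_(e k) psi) q.
  have [_ D] := (CkS _ _ _).1 (C 2%N); have [+ _] := (CkS _ _ _).1 (D (e k)); exact.
have dD' : differentiable (fun y : 'rV[R]_2 * 'rV[R]_2 => 'D_(e k) psi y.1) (q, p).
  exact: (@differentiable_fst R _ _ _ ('D_(e k) psi) (q, p)).
have H : 'D_(0, e i) (fun y : 'rV[R]_2 * 'rV[R]_2 => dot (cov y) ('D_(e k) psi y.1)) (q, p)
    = dot ('D_(0, e i) cov (q, p)) ('D_(e k) psi q)
      + dot (covector psi q p) ('D_(0 : 'rV[R]_2) ('D_(e k) psi) q)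
  := derive_dot (0, e i) dcov dD'.
have H2 : 'D_(0, e i) (fun y : 'rV[R]_2 * 'rV[R]_2 => dot (cov y) ('D_(e k) psi y.1)) (q, p)
    = 'D_(e i) (fun y : 'rV[R]_2 => y 0 k) p.
  rewrite (near_eq_derive (g := fun y : 'rV[R]_2 * 'rV[R]_2 => y.2 0 k)); first exact: derive_snd.
  by apply: filterS nO => y Oy; exact: covJ.
have H3 : dot ('D_(0, e i) cov (q, p)) ('D_(e k) psi q) = 'D_(e i) (fun y : 'rV[R]_2 => y 0 k) p.
  apply: (etrans _ H2); apply: esym; apply: (etrans H).
  by rewrite (derive0 ('D_(e k) psi) q) dot0r addr0.
apply: (etrans H3).
by rewrite -derive_coord ?derive_id //; exact: derivable_id.
Qed.

Lemma covector_sum b : dot b (covector psi q p) = \sum_i p 0 i * dot b (covector psi q (e i)).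
Proof.
rewrite {1}/covector {1}(row_sum_delta p) !mulmx_suml dotC dotE.
under eq_bigr do rewrite summxE mulr_suml.
rewrite exchange_big /=; apply: eq_bigr => i _; rewrite dotC dotE mulr_sumr.
by apply: eq_bigr => j _; rewrite /covector -!scalemxAl mxE mulrA.
Qed.

Lemma has_gradient_Dp f (Fx Fxi : 'rV[R]_3) i : has_gradient f Fx Fxi ->
  Dp i f (q, p) = dot Fxi (covector psi q (e i)).
Proof.
by move=> fE; rewrite /Dp fE derive_covector_momentum derive_pos derive0 dot0r add0r.
Qed.

(** The right-hand side is the Dirac bracket of the constraints [dot x x = 1] and [dot x xi = 0]. No
    derivative of the chart is left in it, so that one computation serves all charts. *)
Lemma poisson_sphere f h (Fx Fxi Hx Hxi : 'rV[R]_3) :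
  has_gradient f Fx Fxi -> has_gradient h Hx Hxi ->
  let x := psi q in let xi := covector psi q p in
  poisson f h (q, p) =
    dot Fx Hxi - dot Fx x * dot Hxi x - (dot Fxi Hx - dot Fxi x * dot Hx x)
    + (dot Hxi x * dot Fxi xi - dot Fxi x * dot Hxi xi).
Proof.
move=> fE hE x xi; have [_ dcov] := differentiable_pos_cov; have [oO C _ _] := ic.
pose J i := 'D_(e i) psi q; pose L i := 'D_(e i, 0) cov (q, p).
pose E i := covector psi q (e i).
have HA a b : dot a b = dot a x * dot b x + \sum_i dot a (E i) * dot b (J i) by exact: (chart_dot ic).
have HB i k : dot (L i) (J k) = dot (L k) (J i).
  apply: (@covector_deriv_sym R 3 psi cov O (q, p) i k oO Oq (C 2%N) dcov).
  by move=> y Oy l; exact: covJ.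
have HC i : dot (L i) x = - (1 * p 0 i).
  rewrite mul1r; apply: (etrans (derive_covector_normal (e i) 0)).
  have Hp : dot (covector psi q p) ('D_(e i) psi q) = p 0 i := covJ (y := (q, p)) i Oq.
  by rewrite Hp.
have K := poisson_lift_algebra Fx Fxi Hx Hxi HA HB HC covector_sum; rewrite mul1r in K.
apply: (etrans _ K); rewrite /poisson; apply: eq_bigr => i _.
rewrite (has_gradient_Dp i fE) (has_gradient_Dp i hE) /Dq fE hE !derive_pos; reflexivity.
Qed.

End Poisson.

End ChartCalculus.

(** * The model system and its quartic integral *)

Section BracketIdentities.
Variable R : realType.

(** The right-hand side of [poisson_sphere] in components, ready for [ring] and [field]. *)
Definition bracket (fx0 fx1 fx2 fp0 fp1 fp2 hx0 hx1 hx2 hp0 hp1 hp2 x y z p0 p1 p2 : R) : R :=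
  (fx0 * hp0 + fx1 * hp1 + fx2 * hp2) - (fx0 * x + fx1 * y + fx2 * z) * (hp0 * x + hp1 * y + hp2 * z)
  - ((fp0 * hx0 + fp1 * hx1 + fp2 * hx2) - (fp0 * x + fp1 * y + fp2 * z) * (hx0 * x + hx1 * y + hx2 * z))
  + ((hp0 * x + hp1 * y + hp2 * z) * (fp0 * p0 + fp1 * p1 + fp2 * p2)
     - (fp0 * x + fp1 * y + fp2 * z) * (hp0 * p0 + hp1 * p1 + hp2 * p2)).

(** [L = x p1 - y p0] generates the rotations about the axis, which preserve the kinetic energy.
    Here and below the covector is the cross product of [(m1, m2, m3)] with [(x, y, z)], which
    builds in its tangency. *)
Lemma bracket_LK (x y z m1 m2 m3 s k s' k' : R) : x ^+ 2 = 1 - y ^+ 2 - z ^+ 2 ->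
  let p0 := m2 * z - m3 * y in let p1 := m3 * x - m1 * z in let p2 := m1 * y - m2 * x in
  bracket p1 (- p0) 0 (- y) x 0
    0 0 (4^-1 * (s' * (p0 ^+ 2 + p1 ^+ 2 + p2 ^+ 2) - k' * p2 ^+ 2))
    (2^-1 * s * p0) (2^-1 * s * p1) (2^-1 * (s * p2 - k * p2)) x y z p0 p1 p2 = 0.
Proof. by move=> Hx; rewrite /bracket /=; ring: Hx. Qed.

(** With [F = L^4 + 8 L T + Y], [H = K + U] and [{L, K} = 0], the part of degree 3 of [{F, H}] is
    [4 L] times this expression. Primes are derivatives in the height [z], and [e] is the inverse of
    [den]. *)
Lemma bracket_LU_TK (x y z m1 m2 m3 s a : R) : x ^+ 2 = 1 - y ^+ 2 - z ^+ 2 ->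
  s ^+ 2 = 1 - (2 - a) * z ^+ 2 * (1 - z ^+ 2) -> s != 0 -> 1 + s != 0 ->
  a + (2 - a) * z ^+ 2 + 2 * s != 0 ->
  let p0 := m2 * z - m3 * y in let p1 := m3 * x - m1 * z in let p2 := m1 * y - m2 * x in
  let b := 2 - a in
  let s' := - b * (z - 2 * z ^+ 3) / s in let w := (1 + s)^-1 in let w' := - w ^+ 2 * s' in
  let k := b * z ^+ 2 * s * w in
  let k' := b * (2 * z * s * w + z ^+ 2 * s' * w + z ^+ 2 * s * w') in
  let e := (a + (2 - a) * z ^+ 2 + 2 * s)^-1 in
  let e' := - e ^+ 2 * (2 * b * z + 2 * s') in
  let C := (4 - a ^+ 2) / 2 in
  (x * p1 - y * p0) ^+ 2 *
  bracket p1 (- p0) 0 (- y) x 0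
    (C * z * e) 0 (C * x * (e + z * e')) 0 0 0 x y z p0 p1 p2
  + 2 * bracket 0 (- p2 + b * z ^+ 2 * w * p2) (p1 + b * y * p2 * (2 * z * w + z ^+ 2 * w'))
     0 z (- y + b * z ^+ 2 * w * y)
    0 0 (4^-1 * (s' * (p0 ^+ 2 + p1 ^+ 2 + p2 ^+ 2) - k' * p2 ^+ 2))
    (2^-1 * s * p0) (2^-1 * s * p1) (2^-1 * (s * p2 - k * p2)) x y z p0 p1 p2 = 0.
Proof.
move=> Hx Hs s0 w0 d0 p0 p1 p2 b s' w w' k k' e e' C.
rewrite /bracket /C /e' /e /k' /k /w' /w /s' /b /p0 /p1 /p2.
by field: Hx Hs; rewrite s0 w0 d0.
Qed.


(** The part of degree 1, [8 (T {L, U} + L {T, U}) + {Y, K}], where [Y] is the term of the integral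
    without momenta. *)
Lemma bracket_LT_U_Y_K (x y z m1 m2 m3 s a : R) : x ^+ 2 = 1 - y ^+ 2 - z ^+ 2 ->
  s ^+ 2 = 1 - (2 - a) * z ^+ 2 * (1 - z ^+ 2) -> s != 0 -> 1 + s != 0 ->
  a + (2 - a) * z ^+ 2 + 2 * s != 0 ->
  let p0 := m2 * z - m3 * y in let p1 := m3 * x - m1 * z in let p2 := m1 * y - m2 * x in
  let b := 2 - a in
  let s' := - b * (z - 2 * z ^+ 3) / s in let w := (1 + s)^-1 in let w' := - w ^+ 2 * s' in
  let k := b * z ^+ 2 * s * w in
  let k' := b * (2 * z * s * w + z ^+ 2 * s' * w + z ^+ 2 * s * w') in
  let e := (a + (2 - a) * z ^+ 2 + 2 * s)^-1 in
  let e' := - e ^+ 2 * (2 * b * z + 2 * s') in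
  let C := (4 - a ^+ 2) / 2 in
  8 * ((z * p1 - y * p2 + b * z ^+ 2 * w * y * p2) *
  bracket p1 (- p0) 0 (- y) x 0
    (C * z * e) 0 (C * x * (e + z * e')) 0 0 0 x y z p0 p1 p2
  + (x * p1 - y * p0) *
   bracket 0 (- p2 + b * z ^+ 2 * w * p2) (p1 + b * y * p2 * (2 * z * w + z ^+ 2 * w'))
     0 z (- y + b * z ^+ 2 * w * y)
    (C * z * e) 0 (C * x * (e + z * e')) 0 0 0 x y z p0 p1 p2)
  + 4 * (a ^+ 2 - 4) * bracket 0 (2 * y * e) (y ^+ 2 * e') 0 0 0
    0 0 (4^-1 * (s' * (p0 ^+ 2 + p1 ^+ 2 + p2 ^+ 2) - k' * p2 ^+ 2))
    (2^-1 * s * p0) (2^-1 * s * p1) (2^-1 * (s * p2 - k * p2)) x y z p0 p1 p2 = 0.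
Proof.
move=> Hx Hs s0 w0 d0 p0 p1 p2 b s' w w' k k' e e' C.
rewrite /bracket /C /e' /e /k' /k /w' /w /s' /b /p0 /p1 /p2.
by field: Hx Hs; rewrite s0 w0 d0.
Qed.

Lemma quartic_bracket (x y z m1 m2 m3 s a : R) : x ^+ 2 = 1 - y ^+ 2 - z ^+ 2 ->
  s ^+ 2 = 1 - (2 - a) * z ^+ 2 * (1 - z ^+ 2) -> s != 0 -> 1 + s != 0 ->
  a + (2 - a) * z ^+ 2 + 2 * s != 0 ->
  let p0 := m2 * z - m3 * y in let p1 := m3 * x - m1 * z in let p2 := m1 * y - m2 * x in
  let b := 2 - a in
  let s' := - b * (z - 2 * z ^+ 3) / s in let w := (1 + s)^-1 in let w' := - w ^+ 2 * s' in
  let k := b * z ^+ 2 * s * w in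
  let k' := b * (2 * z * s * w + z ^+ 2 * s' * w + z ^+ 2 * s * w') in
  let e := (a + (2 - a) * z ^+ 2 + 2 * s)^-1 in
  let e' := - e ^+ 2 * (2 * b * z + 2 * s') in
  let C := (4 - a ^+ 2) / 2 in
  let l := x * p1 - y * p0 in let t := z * p1 - y * p2 + b * z ^+ 2 * w * y * p2 in
  let f := 4 * l ^+ 3 + 8 * t in let c := 4 * (a ^+ 2 - 4) in
  bracket (f * p1)
      (- f * p0 + 8 * l * (- p2 + b * z ^+ 2 * w * p2) + c * (2 * y * e))
      (8 * l * (p1 + b * y * p2 * (2 * z * w + z ^+ 2 * w')) + c * (y ^+ 2 * e'))
      (- f * y) (f * x + 8 * l * z) (8 * l * (- y + b * z ^+ 2 * w * y))
    (C * z * e) 0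
    (4^-1 * (s' * (p0 ^+ 2 + p1 ^+ 2 + p2 ^+ 2) - k' * p2 ^+ 2) + C * x * (e + z * e'))
    (2^-1 * s * p0) (2^-1 * s * p1) (2^-1 * (s * p2 - k * p2)) x y z p0 p1 p2 = 0.
Proof.
move=> Hx Hs s0 w0 d0 p0 p1 p2 b s' w w' k k' e e' C l t f c.
have E1 := bracket_LK m1 m2 m3 s k s' k' Hx.
have E2 := bracket_LU_TK m1 m2 m3 Hx Hs s0 w0 d0.
have E3 := bracket_LT_U_Y_K m1 m2 m3 Hx Hs s0 w0 d0.
move: E1 E2 E3; rewrite /= -/p0 -/p1 -/p2 -/b -/s' -/w -/w' -/k -/k' -/e -/e' -/C -/l -/t.
(* With the definitions forgotten, what remains is only the bilinearity of [bracket] in the two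
   gradients. *)
clearbody p0 p1 p2 s' w w' k k' e e' C l t => E1 E2 E3.
match type of E1 with ?B1 = _ => match type of E2 with ?B2 = _ => match type of E3 with ?B3 = _ =>
  transitivity (f * B1 + 4 * l * B2 + B3); last by rewrite E1 E2 E3 !mulr0 !addr0
end end end.
by rewrite /bracket /f /c; ring.
Qed.

End BracketIdentities.

Section Model.
Variable R : realType.
Implicit Types (V : normedModType R) (a t u : R).

Lemma sum3 (F : 'I_3 -> R) : \sum_i F i = F 0 + F 1 + F 2.
Proof.
rewrite !big_ord_recl big_ord0 addr0 addrA.
by congr (F _ + F _ + F _); apply/val_inj.
Qed.

Lemma dot3 (u v : 'rV[R]_3) : dot u v = u 0 0 * v 0 0 + u 0 1 * v 0 1 + u 0 2 * v 0 2.
Proof. by rewrite dotE sum3. Qed.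

Lemma ord3 (i : 'I_3) : [\/ i = 0, i = 1 | i = 2].
Proof.
by case: i => [[|[|[|//]]] ?]; [constructor 1|constructor 2|constructor 3]; apply/val_inj.
Qed.

Lemma row3P (u v : 'rV[R]_3) : u 0 0 = v 0 0 -> u 0 1 = v 0 1 -> u 0 2 = v 0 2 -> u = v.
Proof. by move=> h0 h1 h2; apply/rowP => i; case: (ord3 i) => ->. Qed.

Lemma vec3E (x y z : R) : ((vec3 x y z 0 0 = x) * (vec3 x y z 0 1 = y) * (vec3 x y z 0 2 = z))%type.
Proof. by rewrite !mxE. Qed.

Lemma dot_vec3 (x y z : R) v : dot (vec3 x y z) v = x * v 0 0 + y * v 0 1 + z * v 0 2.
Proof. by rewrite dot3 !vec3E. Qed.

Lemma S2E (x : 'rV[R]_3) : S2 x -> x 0 0 ^+ 2 = 1 - x 0 1 ^+ 2 - x 0 2 ^+ 2.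
Proof. by rewrite /S2 /= dot3 -!expr2 => <-; ring. Qed.

Lemma S2_height (x : 'rV[R]_3) : S2 x -> 0 <= x 0 2 ^+ 2 <= 1.
Proof.
by move=> /S2E H; rewrite sqr_ge0 /=; have := sqr_ge0 (x 0 0); have := sqr_ge0 (x 0 1); lra.
Qed.

(* In terms of the height [t] on the unit sphere, [u^2 = t^2 / (1 - t^2)] and
   [sqrt (A u) = sq t / (1 - t^2)]. *)
Definition sq (a t : R) := Num.sqrt (1 - (2 - a) * t ^+ 2 * (1 - t ^+ 2)).
Definition den (a t : R) := a + (2 - a) * t ^+ 2 + 2 * sq a t.

(** [t^2 (1 - t^2)] lies between 0 and 1/4, and [(2 - a) / 4 < 1] is the hypothesis on [a]. *)
Lemma sq_arg_gt0 a t : -2 < a -> 0 <= t ^+ 2 <= 1 -> 0 < 1 - (2 - a) * t ^+ 2 * (1 - t ^+ 2).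
Proof.
move=> a2; move: (t ^+ 2) => T /andP[T0 T1]; rewrite -mulrA.
have y0 : 0 <= T * (1 - T) by rewrite mulr_ge0 // subr_ge0.
have y1 : T * (1 - T) <= 4^-1 by have := sqr_ge0 (T - 2^-1); nra.
move: (T * (1 - T)) y0 y1 => y y0 y1.
by have [|] := leP a 2 => ha; nra.
Qed.

Lemma sq_gt0 a t : -2 < a -> 0 <= t ^+ 2 <= 1 -> 0 < sq a t.
Proof. by move=> a2 t1; rewrite sqrtr_gt0 sq_arg_gt0. Qed.

Lemma sqr_sq a t : -2 < a -> 0 <= t ^+ 2 <= 1 ->
  sq a t ^+ 2 = 1 - (2 - a) * t ^+ 2 * (1 - t ^+ 2).
Proof. by move=> a2 t1; rewrite sqr_sqrtr // ltW // sq_arg_gt0. Qed.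

(** If [den] were at most 0, then [a < 0], and squaring [2 s <= - (a + (2 - a) t^2)] would give
    [(4 - a^2) (1 - t^2)^2 <= 0]. This forces [t^2 = 1], where [den] is [2 + 2 s]. *)
Lemma den_gt0 a t : -2 < a -> 0 <= t ^+ 2 <= 1 -> 0 < den a t.
Proof.
move=> a2 t1; have s0 := sq_gt0 a2 t1; have s2 := sqr_sq a2 t1.
rewrite /den ltNge; apply/negP => d0; move: t1 s2 s0 d0.
move: (sq a t) (t ^+ 2) => s T /andP[T0 T1] s2 s0 d0.
have a0 : a < 0 by nra.
have N : 4 * s ^+ 2 <= (a + (2 - a) * T) ^+ 2 by nra.
have : (4 - a ^+ 2) * (1 - T) ^+ 2 <= 0 by rewrite s2 in N; nra.
have a4 : 0 < 4 - a ^+ 2 by nra.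
rewrite pmulr_rle0 // => T2.
have : (1 - T) ^+ 2 = 0 by apply: le_anti; rewrite T2 sqr_ge0.
by move=> /eqP; rewrite sqrf_eq0 subr_eq0 => /eqP E; rewrite -E in d0; nra.
Qed.

(** Subtracting [2 / s] times the Euclidean form from the metric leaves
    [2 (1 - s) / (s^2 (1 - t^2)) dt^2]. As [1 - s = (2 - a) t^2 (1 - t^2) / (1 + s)], the
    singularity at the poles cancels. *)
Definition model_metric (a : R) (x : 'rV[R]_3) : 'M[R]_3 :=
  let t := x 0 2 in
  (2 / sq a t) *: 1%:M + (2 * (2 - a) * t ^+ 2 / (sq a t ^+ 2 * (1 + sq a t))) *: delta_mx 2 2.

(** The potential after rationalising: [a + 2 u^2 - 2 S] equals [(a^2 - 4) / (a + 2 u^2 + 2 S)],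
    whose denominator is [den / (1 - t^2)], while [u cos phi] is [x_0 t / (1 - t^2)]. *)
Definition model_potential (a : R) (x : 'rV[R]_3) : R :=
  (4 - a ^+ 2) / 2 * x 0 0 * x 0 2 / den a (x 0 2).

Definition model_kinetic (a : R) (x p : 'rV[R]_3) : R :=
  let t := x 0 2 in
  4^-1 * (sq a t * (p 0 0 ^+ 2 + p 0 1 ^+ 2 + p 0 2 ^+ 2)
    - (2 - a) * t ^+ 2 * sq a t / (1 + sq a t) * p 0 2 ^+ 2).

(** On tangent covectors [l] is [p_phi] and [r] is [u cos phi p_phi - S sin phi p_u]. The last term
    is [4 (a + 2 u^2 - 2 S) sin^2 phi], rationalised as in the potential. *)
Definition model_integral (a : R) (z : 'rV[R]_3 * 'rV[R]_3) : R :=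
  let x := z.1 in let p := z.2 in let t := x 0 2 in
  let l := x 0 0 * p 0 1 - x 0 1 * p 0 0 in
  let r := t * p 0 1 - x 0 1 * p 0 2 + (2 - a) * t ^+ 2 / (1 + sq a t) * x 0 1 * p 0 2 in
  l ^+ 4 + 8 * (l * r) + 4 * (a ^+ 2 - 4) * (x 0 1 ^+ 2 / den a t).

(** A neighbourhood of the sphere on which the radicand and the denominator stay positive, so that
    the formulas themselves serve as smooth ambient extensions. *)
Definition model_domain (a : R) : set 'rV[R]_3 :=
  [set x | 0 < 1 - (2 - a) * x 0 2 ^+ 2 * (1 - x 0 2 ^+ 2)] `&` [set x | 0 < den a (x 0 2)].

Lemma S2_model_domain a : -2 < a -> S2 (R := R) `<=` model_domain a.
Proof.
by move=> a2 x Sx; split; rewrite /=; [apply: sq_arg_gt0|apply: den_gt0] => //; exact: S2_height.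
Qed.

Lemma continuous_height (f : R -> R) : continuous f -> continuous (fun x : 'rV[R]_3 => f (x 0 2)).
Proof.
move=> cf x; apply: (@continuous_comp _ _ _ (fun x : 'rV[R]_3 => x 0 2) f); last exact: cf.
exact: coord_continuous.
Qed.

Lemma open_model_domain a : open (model_domain a).
Proof.
have c1 : continuous (fun t : R => 1 - (2 - a) * t ^+ 2 * (1 - t ^+ 2)).
  move=> t; apply: (Ck_continuous (k := 0) (O := setT)) => //.
  by do ![apply: Ck_add|apply: Ck_mul|apply: Ck_opp|apply: Ck_exp|apply: Ck_cst|apply: Ck_id|exact: openT].
have c2 : continuous (den a).
  move=> t; apply: cvgD; last apply: cvgM; [|exact: cvg_cst|].
    apply: cvgD; first exact: cvg_cst.
    by apply: cvgM; [exact: cvg_cst|exact: exprn_continuous].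
  apply: (@continuous_comp _ _ _ (fun t : R => 1 - (2 - a) * t ^+ 2 * (1 - t ^+ 2)) Num.sqrt).
    exact: c1.
  exact: sqrt_continuous.
apply: openI.
    apply: (@open_comp _ _ (fun x : 'rV[R]_3 => 1 - (2 - a) * x 0 2 ^+ 2 * (1 - x 0 2 ^+ 2)) [set y | 0 < y]).
    by move=> x _; exact: (continuous_height c1).
  exact: open_gt.
apply: (@open_comp _ _ (fun x : 'rV[R]_3 => den a (x 0 2)) [set y | 0 < y]).
  by move=> x _; exact: (continuous_height c2).
exact: open_gt.
Qed.

Section ModelSmooth.
Variables (a : R) (k : nat).
Let D := model_domain a.
Let oD : open D := @open_model_domain a.

Lemma Ck_height i : Ck k D (fun x : 'rV[R]_3 => x 0 i).
Proof. by apply: Ck_coord; [exact: oD|exact: Ck_id]. Qed.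

Lemma Ck_sq : Ck k D (fun x : 'rV[R]_3 => sq a (x 0 2)).
Proof.
apply: Ck_sqrt; [exact: oD|by move=> x []|].
by do ![apply: Ck_add|apply: Ck_mul|apply: Ck_opp|apply: Ck_exp|apply: Ck_cst|exact: Ck_height|exact: oD].
Qed.

Lemma Ck_den : Ck k D (fun x : 'rV[R]_3 => (den a (x 0 2))^-1).
Proof.
apply: Ck_inv; [exact: oD|by move=> x [_ /= /gt_eqF ->]|].
by do ![exact: Ck_sq|apply: Ck_add|apply: Ck_mul|apply: Ck_opp|apply: Ck_exp|apply: Ck_cst|exact: Ck_height|exact: oD].
Qed.

Lemma Ck_invsq : Ck k D (fun x : 'rV[R]_3 => (sq a (x 0 2))^-1).
Proof.
apply: Ck_inv; [exact: oD| |exact: Ck_sq].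
by move=> x [/= h _]; rewrite gt_eqF // sqrtr_gt0.
Qed.

Lemma Ck_inv1sq : Ck k D (fun x : 'rV[R]_3 => (1 + sq a (x 0 2))^-1).
Proof.
apply: Ck_inv; [exact: oD| |by apply: Ck_add; [exact: oD|exact: Ck_cst|exact: Ck_sq]].
by move=> x _; rewrite gt_eqF // ltr_pwDl // sqrtr_ge0.
Qed.

Lemma Ck_model_metric : Ck k D (model_metric a).
Proof.
apply: Ck_add; [exact: oD| |]; apply: Ck_scale; try exact: oD; try exact: Ck_cst.
  by apply: Ck_mul; [exact: oD|exact: Ck_cst|exact: Ck_invsq].
apply: Ck_mul; first exact: oD.
  by do ![apply: Ck_mul|apply: Ck_exp|apply: Ck_cst|exact: Ck_height|exact: oD].
apply: (@Ck_eq _ _ _ _ _ (fun x : 'rV[R]_3 => (sq a (x 0 2))^-1 ^+ 2 * (1 + sq a (x 0 2))^-1)).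
- exact: oD.
- by move=> x _; rewrite invfM exprVn.
- by apply: Ck_mul; [exact: oD|apply: Ck_exp; [exact: oD|exact: Ck_invsq]|exact: Ck_inv1sq].
Qed.

Lemma Ck_model_potential : Ck k D (model_potential a).
Proof.
apply: Ck_mul; [exact: oD| |exact: Ck_den].
by do ![apply: Ck_mul|apply: Ck_cst|exact: Ck_height|exact: oD].
Qed.

Lemma Ck_model_integral : Ck k [set z | D z.1] (model_integral a).
Proof.
have oD' := @open_fst R 'rV[R]_3 'rV[R]_3 D oD.
have b3 := finite_basis_row R 3.
have lift (f : 'rV[R]_3 -> R) : Ck k D f ->
    Ck k [set z : 'rV[R]_3 * 'rV[R]_3 | D z.1] (fun z => f z.1).
  by move=> Cf; exact: (@Ck_comp_fst R _ _ _ k D f b3 oD Cf).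
have cx i := lift _ (Ck_height i).
have cp i : Ck k [set z : 'rV[R]_3 * 'rV[R]_3 | D z.1] (fun z => z.2 0 i).
  by apply: Ck_coord => //; exact: Ck_snd.
have cw := lift _ Ck_inv1sq; have cd := lift _ Ck_den.
rewrite /model_integral /=.
by do ![exact: cx|exact: cp|exact: cw|exact: cd|apply: Ck_add|apply: Ck_opp|apply: Ck_exp|apply: Ck_mul|apply: Ck_cst|exact: oD'].
Qed.

End ModelSmooth.

Section ModelMetric.
Variable a : R.
Hypothesis a2 : -2 < a.

Lemma model_formE x v w : form (model_metric a x) v w =
  2 / sq a (x 0 2) * dot v w
  + 2 * (2 - a) * x 0 2 ^+ 2 / (sq a (x 0 2) ^+ 2 * (1 + sq a (x 0 2))) * v 0 2 * w 0 2.
Proof.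
have E : dot (v *m delta_mx 2 2) w = v 0 2 * w 0 2.
  rewrite dotE (bigD1 2) //= big1 ?addr0 => [|i i2].
    rewrite !mxE (bigD1 2) //= big1 ?addr0 => [|j j2]; first by rewrite !mxE !eqxx mulr1.
    by rewrite !mxE (negbTE j2) mulr0.
  by rewrite !mxE big1 ?mul0r // => j _; rewrite !mxE (negbTE i2) andbF mulr0.
by rewrite formE /model_metric mulmxDr dotDl -!scalemxAr !dotZl mulmx1 E !mulrA.
Qed.

(* On tangent vectors [v 0 2 ^+ 2 <= (1 - t^2) |v|^2], and
   [1 / s + c (1 - t^2) = 1 / s^2] for [s = sq a t] and [c] the second coefficient. *)
Lemma model_riemannian : riemannian (model_metric a).
Proof.
split.
- apply: (Ck_smooth_on (@open_model_domain a) (S2_model_domain a2)) => k.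
  exact: Ck_model_metric.
- by move=> x v w _ _ _; rewrite !model_formE dotC; ring.
move=> x v Sx tv v0; have t1 := S2_height Sx.
have s0 := sq_gt0 a2 t1; have s2 := sqr_sq a2 t1.
have vv : 0 < dot v v.
  by rewrite lt_neqAle dot_ge0 andbT eq_sym; apply/eqP => /dot_eq0 /eqP; exact/negP.
have cs : v 0 2 ^+ 2 <= (1 - x 0 2 ^+ 2) * dot v v.
  move: tv (S2E Sx); rewrite /tangent !dot3 => tv Sx'.
  have -> : 1 - x 0 2 ^+ 2 = x 0 0 ^+ 2 + x 0 1 ^+ 2 by rewrite Sx'; ring.
  have : x 0 2 * v 0 2 = - (x 0 0 * v 0 0 + x 0 1 * v 0 1).
    by move/eqP: tv; rewrite addrC addr_eq0 => /eqP.
  move: (x 0 0) (x 0 1) (x 0 2) (v 0 0) (v 0 1) (v 0 2) Sx' => X Y Z A B C HX HZ.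
  have H2 : Z ^+ 2 * C ^+ 2 = (X * A + Y * B) ^+ 2 by rewrite -exprMn HZ sqrrN.
  have : 0 <= (X * B - Y * A) ^+ 2 by exact: sqr_ge0.
  have H3 : Z ^+ 2 = 1 - X ^+ 2 - Y ^+ 2 by rewrite HX; ring.
  by rewrite H3 in H2; nra.
rewrite model_formE; move: t1 s0 s2 cs vv; move: (x 0 2 ^+ 2) (sq a _) (dot v v) => T s N t1 s0 s2 cs vv.
have -> : 2 / s * N + 2 * (2 - a) * T / (s ^+ 2 * (1 + s)) * v 0 2 * v 0 2
   = 2 / (s ^+ 2 * (1 + s)) * ((s + s ^+ 2) * N + (2 - a) * T * v 0 2 ^+ 2).
  by field; rewrite !gt_eqF // ltr_wpDl // ltW.
have d0 : 0 < 2 / (s ^+ 2 * (1 + s)) by rewrite divr_gt0 // mulr_gt0 ?exprn_gt0 // addr_gt0.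
rewrite pmulr_rgt0 //; move: (v 0 2 ^+ 2) (sqr_ge0 (v 0 2)) cs => c c0 cs.
have n1 : 0 < (s + s ^+ 2) * N by rewrite mulr_gt0 // addr_gt0 // exprn_gt0.
case/andP: t1 => T0 T1.
have [|] := leP a 2 => ha.
  by have : 0 <= (2 - a) * T * c; [rewrite !mulr_ge0 // subr_ge0|lra].
have H : (2 - a) * T * ((1 - T) * N) <= (2 - a) * T * c.
  by rewrite ler_wnM2l // mulr_le0_ge0 // subr_le0 ltW.
have : (s + s ^+ 2) * N + (2 - a) * T * ((1 - T) * N) = (1 + s) * N by rewrite s2; ring.
by have : 0 < (1 + s) * N; [rewrite mulr_gt0 // addr_gt0|lra].
Qed.

Lemma model_kineticE x p : S2 x -> tangent x p ->
  kinetic (model_metric a) (x, p) = model_kinetic a x p.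
Proof.
move=> Sx tp; have t1 := S2_height Sx.
have s0 := sq_gt0 a2 t1; have s2 := sqr_sq a2 t1.
have w0 : 1 + sq a (x 0 2) != 0 by rewrite gt_eqF // addr_gt0.
move: (tp); rewrite /tangent dot3 => xp.
set s := sq a (x 0 2) in s0 s2 w0.
pose k := (2 - a) * x 0 2 ^+ 2 * s / (1 + s).
(* This is [(s p - k p_2 (e_3 - t x)) / 2], where [e_3 - t x] is the tangential part of the axis;
   hence [v] is tangent. *)
pose v := vec3 (2^-1 * (s * p 0 0 + k * p 0 2 * x 0 2 * x 0 0))
  (2^-1 * (s * p 0 1 + k * p 0 2 * x 0 2 * x 0 1))
  (2^-1 * (s * p 0 2 - k * p 0 2 * (1 - x 0 2 ^+ 2))).
have tv : tangent x v.
  rewrite /tangent dot3 !vec3E.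
  transitivity (2^-1 * s * (x 0 0 * p 0 0 + x 0 1 * p 0 1 + x 0 2 * p 0 2)
    + 2^-1 * k * p 0 2 * x 0 2 * (x 0 0 ^+ 2 + x 0 1 ^+ 2 + x 0 2 ^+ 2 - 1)); first by ring.
  by rewrite xp (S2E Sx); ring.
have vE w : tangent x w -> form (model_metric a x) v w = dot p w.
  rewrite /tangent model_formE !dot3 !vec3E -/s => xw.
  transitivity (p 0 0 * w 0 0 + p 0 1 * w 0 1 + p 0 2 * w 0 2 +
     k / s * p 0 2 * x 0 2 * (x 0 0 * w 0 0 + x 0 1 * w 0 1 + x 0 2 * w 0 2)).
    by rewrite /k; field: s2; rewrite w0 gt_eqF.
  by rewrite xw mulr0 addr0.
rewrite /kinetic /= (velocity_eq model_riemannian Sx tv vE) vE // dot3 !vec3E /model_kinetic -/s.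
have -> : p 0 0 * (2^-1 * (s * p 0 0 + k * p 0 2 * x 0 2 * x 0 0)) +
   p 0 1 * (2^-1 * (s * p 0 1 + k * p 0 2 * x 0 2 * x 0 1)) +
   p 0 2 * (2^-1 * (s * p 0 2 - k * p 0 2 * (1 - x 0 2 ^+ 2))) =
   2^-1 * (s * (p 0 0 ^+ 2 + p 0 1 ^+ 2 + p 0 2 ^+ 2) - k * p 0 2 ^+ 2)
   + 2^-1 * k * p 0 2 * x 0 2 * (x 0 0 * p 0 0 + x 0 1 * p 0 1 + x 0 2 * p 0 2) by ring.
by rewrite xp mulr0 addr0 /k; field.
Qed.

End ModelMetric.

End Model.

(** * Gradients of the energy and of the integral *)

Section Gradients.
Variables (R : realType) (V : normedModType R) (X0 X1 X2 P0 P1 P2 : V -> R) (z : V).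
Hypotheses (dX0 : differentiable X0 z) (dX1 : differentiable X1 z) (dX2 : differentiable X2 z).
Hypotheses (dP0 : differentiable P0 z) (dP1 : differentiable P1 z) (dP2 : differentiable P2 z).

(** Forward differentiation of expressions in six given functions: every operation has a rule,
    [grad6_auto] assembles the rules with unknown coefficients, and [grad6_eq] compares the outcome
    with the expected gradient. *)
Definition grad6 (f : V -> R) (a0 a1 a2 b0 b1 b2 : R) :=
  differentiable f z /\ forall v, 'D_v f z =
    a0 * 'D_v X0 z + a1 * 'D_v X1 z + a2 * 'D_v X2 z
    + (b0 * 'D_v P0 z + b1 * 'D_v P1 z + b2 * 'D_v P2 z).

Lemma grad6_eq f (a0 a1 a2 b0 b1 b2 a0' a1' a2' b0' b1' b2' : R) :
  grad6 f a0 a1 a2 b0 b1 b2 -> a0 = a0' -> a1 = a1' -> a2 = a2' -> b0 = b0' -> b1 = b1' ->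
  b2 = b2' -> grad6 f a0' a1' a2' b0' b1' b2'.
Proof. by move=> h <- <- <- <- <- <-. Qed.

Lemma grad6_cst (c : R) : grad6 (fun=> c) 0 0 0 0 0 0.
Proof.
split=> [|v]; first exact: differentiable_cst.
by rewrite derive_cst; ring.
Qed.

Lemma grad6_X0 : grad6 X0 1 0 0 0 0 0. Proof. by split=> // v; ring. Qed.
Lemma grad6_X1 : grad6 X1 0 1 0 0 0 0. Proof. by split=> // v; ring. Qed.
Lemma grad6_X2 : grad6 X2 0 0 1 0 0 0. Proof. by split=> // v; ring. Qed.
Lemma grad6_P0 : grad6 P0 0 0 0 1 0 0. Proof. by split=> // v; ring. Qed.
Lemma grad6_P1 : grad6 P1 0 0 0 0 1 0. Proof. by split=> // v; ring. Qed.
Lemma grad6_P2 : grad6 P2 0 0 0 0 0 1. Proof. by split=> // v; ring. Qed.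

Lemma grad6_add f g (a0 a1 a2 b0 b1 b2 a0' a1' a2' b0' b1' b2' : R) :
  grad6 f a0 a1 a2 b0 b1 b2 -> grad6 g a0' a1' a2' b0' b1' b2' ->
  grad6 (fun y => f y + g y) (a0 + a0') (a1 + a1') (a2 + a2') (b0 + b0') (b1 + b1') (b2 + b2').
Proof.
move=> [df fE] [dg gE]; split=> [|v]; first exact: differentiableD.
have d1 : derivable f z v by exact: diff_derivable.
have d2 : derivable g z v by exact: diff_derivable.
apply: (etrans (deriveD d1 d2)).
by rewrite fE gE; ring.
Qed.

Lemma grad6_mul f g (a0 a1 a2 b0 b1 b2 a0' a1' a2' b0' b1' b2' : R) :
  grad6 f a0 a1 a2 b0 b1 b2 -> grad6 g a0' a1' a2' b0' b1' b2' ->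
  grad6 (fun y => f y * g y) (f z * a0' + g z * a0) (f z * a1' + g z * a1) (f z * a2' + g z * a2)
   (f z * b0' + g z * b0) (f z * b1' + g z * b1) (f z * b2' + g z * b2).
Proof.
move=> [df fE] [dg gE]; split=> [|v]; first exact: differentiableM.
apply: (etrans (derive_scale v df dg)).
by rewrite fE gE -![_ *: _]/(_ * _); ring.
Qed.

Lemma grad6_opp f (a0 a1 a2 b0 b1 b2 : R) :
  grad6 f a0 a1 a2 b0 b1 b2 -> grad6 (fun y => - f y) (- a0) (- a1) (- a2) (- b0) (- b1) (- b2).
Proof.
move=> [df fE]; split=> [|v]; first exact: differentiableN.
have d1 : derivable f z v by exact: diff_derivable.
by apply: (etrans (deriveN d1)); rewrite fE; ring.
Qed.

Lemma grad6_comp1 (f : V -> R) (phi : R -> R) (d a0 a1 a2 b0 b1 b2 : R) :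
  is_derive (f z) 1 phi d -> grad6 f a0 a1 a2 b0 b1 b2 ->
  grad6 (fun y => phi (f y)) (d * a0) (d * a1) (d * a2) (d * b0) (d * b1) (d * b2).
Proof.
move=> [dphi phiE] [df fE]; move/derivable1_diffP : (dphi) => dphi'.
split=> [|v]; first exact: (differentiable_comp df).
apply: (etrans (derive_comp v df dphi')); rewrite deriveE //.
rewrite -[X in 'd _ _ X]mulr1 linearZ /= -deriveE // phiE -[_ *: _]/(_ * _) fE.
by ring.
Qed.

Lemma grad6_exp f n (a0 a1 a2 b0 b1 b2 : R) : let c := n.+1%:R * f z ^+ n in
  grad6 f a0 a1 a2 b0 b1 b2 ->
  grad6 (fun y => f y ^+ n.+1) (c * a0) (c * a1) (c * a2) (c * b0) (c * b1) (c * b2).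
Proof.
move=> c; apply: (@grad6_comp1 f (fun t => t ^+ n.+1) c).
split; first exact: exprn_derivable.
by rewrite exp_derive [_ *: 1]mulr1.
Qed.

Lemma is_derive_inv (t : R) : t != 0 -> is_derive t 1 (@GRing.inv R) (- t^-1 ^+ 2).
Proof.
move=> t0; have := @is_deriveV R id t 1 1 t0 (is_derive_id _ _).
by rewrite exprVn [_ *: _]mulr1.
Qed.

Variable a : R.
Hypotheses (a2 : -2 < a) (h1 : 0 <= X2 z ^+ 2 <= 1).
Let x := X0 z. Let y := X1 z. Let t := X2 z. Let p0 := P0 z. Let p1 := P1 z. Let p2 := P2 z.
Let s := sq a t. Let b := 2 - a.
Let s' := - b * (t - 2 * t ^+ 3) / s. Let w := (1 + s)^-1. Let w' := - w ^+ 2 * s'.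
Let k := b * t ^+ 2 * s * w.
Let k' := b * (2 * t * s * w + t ^+ 2 * s' * w + t ^+ 2 * s * w').
Let e := (a + (2 - a) * t ^+ 2 + 2 * s)^-1.
Let e' := - e ^+ 2 * (2 * b * t + 2 * s').
Let C := (4 - a ^+ 2) / 2.
Let l := x * p1 - y * p0.
Let r := t * p1 - y * p2 + b * t ^+ 2 * w * y * p2.
Let f := 4 * l ^+ 3 + 8 * r.
Let c := 4 * (a ^+ 2 - 4).

Let s_gt0 : 0 < s. Proof. exact: sq_gt0. Qed.
Let s_neq0 : s != 0. Proof. by rewrite gt_eqF. Qed.
Let w_neq0 : 1 + s != 0. Proof. by rewrite gt_eqF // addr_gt0. Qed.
Let e_neq0 : a + (2 - a) * t ^+ 2 + 2 * s != 0. Proof. by rewrite gt_eqF // den_gt0. Qed.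

Ltac grad6_auto := repeat (first [exact: grad6_X0 | exact: grad6_X1 | exact: grad6_X2
  | exact: grad6_P0 | exact: grad6_P1 | exact: grad6_P2 | eassumption
  | apply: grad6_cst | apply: grad6_add | apply: grad6_opp | apply: grad6_exp | apply: grad6_mul]).

Lemma grad6_sq : grad6 (fun y => sq a (X2 y)) 0 0 s' 0 0 0.
Proof.
eapply grad6_eq.
  apply: (@grad6_comp1 (fun y => 1 - (2 - a) * X2 y ^+ 2 * (1 - X2 y ^+ 2)) Num.sqrt).
    by apply: is_derive1_sqrt; exact: sq_arg_gt0.
  by grad6_auto.
all: by rewrite /= -/t -[Num.sqrt _]/s /s' /b; field.
Qed.

Lemma grad6_inv1sq : grad6 (fun y => (1 + sq a (X2 y))^-1) 0 0 w' 0 0 0.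
Proof.
have gs := grad6_sq.
eapply grad6_eq.
  apply: (@grad6_comp1 (fun y => 1 + sq a (X2 y)) GRing.inv).
    by apply: is_derive_inv; exact: w_neq0.
  by grad6_auto.
all: rewrite -/t -/s -/w /w'; ring.
Qed.

Lemma grad6_invden : grad6 (fun y => (den a (X2 y))^-1) 0 0 e' 0 0 0.
Proof.
have gs := grad6_sq.
eapply grad6_eq.
  apply: (@grad6_comp1 (fun y => den a (X2 y)) GRing.inv).
    by apply: is_derive_inv; exact: e_neq0.
  by rewrite /den; grad6_auto.
all: rewrite -/t /den -/s -/e /e' /b; ring.
Qed.

Lemma grad6_energy : grad6 (fun y =>
    4^-1 * (sq a (X2 y) * (P0 y ^+ 2 + P1 y ^+ 2 + P2 y ^+ 2)
      - (2 - a) * X2 y ^+ 2 * sq a (X2 y) / (1 + sq a (X2 y)) * P2 y ^+ 2)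
    + (4 - a ^+ 2) / 2 * X0 y * X2 y / den a (X2 y))
  (C * t * e) 0
  (4^-1 * (s' * (p0 ^+ 2 + p1 ^+ 2 + p2 ^+ 2) - k' * p2 ^+ 2) + C * x * (e + t * e'))
  (2^-1 * s * p0) (2^-1 * s * p1) (2^-1 * (s * p2 - k * p2)).
Proof.
have gs := grad6_sq; have gw := grad6_inv1sq; have ge := grad6_invden.
eapply grad6_eq; first by grad6_auto.
all: by rewrite /= -/t /den -/s -/w -/e -/x -/p0 -/p1 -/p2 /k /k' /C /b; field.
Qed.

Lemma grad6_quartic : grad6 (fun y =>
    (X0 y * P1 y - X1 y * P0 y) ^+ 4
    + 8 * ((X0 y * P1 y - X1 y * P0 y) * (X2 y * P1 y - X1 y * P2 y
           + (2 - a) * X2 y ^+ 2 / (1 + sq a (X2 y)) * X1 y * P2 y))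
    + 4 * (a ^+ 2 - 4) * (X1 y ^+ 2 / den a (X2 y)))
  (f * p1)
  (- f * p0 + 8 * l * (- p2 + b * t ^+ 2 * w * p2) + c * (2 * y * e))
  (8 * l * (p1 + b * y * p2 * (2 * t * w + t ^+ 2 * w')) + c * (y ^+ 2 * e'))
  (- f * y) (f * x + 8 * l * t) (8 * l * (- y + b * t ^+ 2 * w * y)).
Proof.
have gs := grad6_sq; have gw := grad6_inv1sq; have ge := grad6_invden.
eapply grad6_eq; first by grad6_auto.
all: by rewrite /= -/t /den -/s -/w -/e -/x -/y -/p0 -/p1 -/p2 /f /l /r /c /b; ring.
Qed.

End Gradients.

(** * The quartic integral in arbitrary charts *)

Section ModelIntegral.
Variables (R : realType) (a : R).
Hypothesis a2 : -2 < a.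
Local Notation rV2 := 'rV[R]_2.
Local Notation rV3 := 'rV[R]_3.
Local Notation e := (fun i : 'I_2 => delta_mx 0 i : 'rV[R]_2).
Local Notation H := (hamiltonian (model_metric a) (model_potential a)).
Local Notation F := (model_integral a).

Section InChart.
Variables (O : set rV2) (psi : rV2 -> rV3).
Hypothesis ic : immersed_chart O psi.
Let X i (z : rV2 * rV2) := psi z.1 0 i.
Let P i (z : rV2 * rV2) := covector psi z.1 z.2 0 i.

Lemma differentiable_pos (z : rV2 * rV2) : O z.1 ->
  differentiable (fun y : rV2 * rV2 => psi y.1) z.
Proof. by move=> Oz; apply: differentiable_fst; exact: (chart_differentiable ic). Qed.

Lemma differentiable_cov (z : rV2 * rV2) : O z.1 ->
  differentiable (fun y : rV2 * rV2 => covector psi y.1 y.2) z.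
Proof. by move=> Oz; have [+ _] := (CkS _ _ _).1 (Ck_covector 1 ic); apply. Qed.

Lemma has_gradient_grad6 q p f (a0 a1 a2' b0 b1 b2 : R) : O q ->
  grad6 (X 0) (X 1) (X 2) (P 0) (P 1) (P 2) (q, p) f a0 a1 a2' b0 b1 b2 ->
  has_gradient psi q p f (vec3 a0 a1 a2') (vec3 b0 b1 b2).
Proof.
move=> Oq [_ fE] v; rewrite fE !dot_vec3.
have dX := @diff_derivable _ _ _ _ _ v (differentiable_pos (z := (q, p)) Oq).
have dP := @diff_derivable _ _ _ _ _ v (differentiable_cov (z := (q, p)) Oq).
have XE i : 'D_v (X i) (q, p) = ('D_v (fun y : rV2 * rV2 => psi y.1) (q, p)) 0 i.
  by apply/esym; exact: (derive_coord 0 i dX).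
have PE i : 'D_v (P i) (q, p) = ('D_v (fun y : rV2 * rV2 => covector psi y.1 y.2) (q, p)) 0 i.
  by apply/esym; exact: (derive_coord 0 i dP).
by rewrite !XE !PE.
Qed.

Lemma in_coord_energy (z : rV2 * rV2) : O z.1 ->
  in_coord psi H z = model_kinetic a (psi z.1) (covector psi z.1 z.2) + model_potential a (psi z.1).
Proof.
move=> Oz; have [_ _ onS _] := ic; rewrite /in_coord /hamiltonian /=.
by rewrite model_kineticE //; [exact: onS|exact: (covector_tangent ic)].
Qed.

Section AtPoint.
Variables (q p : rV2).
Hypothesis Oq : O q.
Let x := psi q 0 0. Let y := psi q 0 1. Let t := psi q 0 2.
Let p0 := covector psi q p 0 0. Let p1 := covector psi q p 0 1. Let p2 := covector psi q p 0 2.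
Let s := sq a t. Let b := 2 - a.
Let s' := - b * (t - 2 * t ^+ 3) / s. Let w := (1 + s)^-1. Let w' := - w ^+ 2 * s'.
Let k := b * t ^+ 2 * s * w.
Let k' := b * (2 * t * s * w + t ^+ 2 * s' * w + t ^+ 2 * s * w').
Let d := (a + (2 - a) * t ^+ 2 + 2 * s)^-1.
Let d' := - d ^+ 2 * (2 * b * t + 2 * s').
Let C := (4 - a ^+ 2) / 2.
Let l := x * p1 - y * p0.
Let r := t * p1 - y * p2 + b * t ^+ 2 * w * y * p2.
Let f := 4 * l ^+ 3 + 8 * r.
Let c := 4 * (a ^+ 2 - 4).

Let onS : S2 (psi q). Proof. by have [_ _ onS _] := ic; exact: onS. Qed.
Let t1 : 0 <= t ^+ 2 <= 1. Proof. exact: S2_height. Qed.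

Lemma gradient_energy : has_gradient psi q p (in_coord psi H)
  (vec3 (C * t * d) 0
    (4^-1 * (s' * (p0 ^+ 2 + p1 ^+ 2 + p2 ^+ 2) - k' * p2 ^+ 2) + C * x * (d + t * d')))
  (vec3 (2^-1 * s * p0) (2^-1 * s * p1) (2^-1 * (s * p2 - k * p2))).
Proof.
have dX i : differentiable (X i) (q, p) by apply: differentiable_coord'; exact: differentiable_pos.
have dP i : differentiable (P i) (q, p) by apply: differentiable_coord'; exact: differentiable_cov.
have G := has_gradient_grad6 Oq (grad6_energy (X 1) (dX 0) (dX 2) (dP 0) (dP 1) (dP 2) a2 t1).
move=> v; apply: etrans (G v); apply: near_eq_derive.
have oO' : open [set z : rV2 * rV2 | O z.1] by apply: open_fst; have [] := ic.
by apply: filterS (open_nbhs_nbhs (conj oO' (Oq : [set z : rV2 * rV2 | O z.1] (q, p)))) => z Oz;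
  exact: in_coord_energy.
Qed.

Lemma gradient_integral : has_gradient psi q p (in_coord psi F)
  (vec3 (f * p1)
    (- f * p0 + 8 * l * (- p2 + b * t ^+ 2 * w * p2) + c * (2 * y * d))
    (8 * l * (p1 + b * y * p2 * (2 * t * w + t ^+ 2 * w')) + c * (y ^+ 2 * d')))
  (vec3 (- f * y) (f * x + 8 * l * t) (8 * l * (- y + b * t ^+ 2 * w * y))).
Proof.
have dX i : differentiable (X i) (q, p) by apply: differentiable_coord'; exact: differentiable_pos.
have dP i : differentiable (P i) (q, p) by apply: differentiable_coord'; exact: differentiable_cov.
exact: (has_gradient_grad6 Oq (grad6_quartic (dX 0) (dX 1) (dX 2) (dP 0) (dP 1) (dP 2) a2 t1)).
Qed.

Lemma model_poisson : poisson (in_coord psi F) (in_coord psi H) (q, p) = 0.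
Proof.
rewrite (poisson_sphere ic Oq gradient_integral gradient_energy) !dot3 !vec3E.
have s0 := sq_gt0 a2 t1; have s2 := sqr_sq a2 t1.
have s_neq0 : s != 0 by rewrite gt_eqF.
have w_neq0 : 1 + s != 0 by rewrite gt_eqF // addr_gt0.
have d_neq0 : a + (2 - a) * t ^+ 2 + 2 * s != 0 by rewrite gt_eqF // den_gt0.
have tan : x * p0 + y * p1 + t * p2 = 0.
  by have := covector_tangent ic Oq p; rewrite /tangent dot3.
have Sx := S2E onS; rewrite -/x -/y -/t in Sx.
(* With [m] the cross product of position and covector, the cross product of [m] with the position
   is the covector again, by tangency and unit length. This is the form that [quartic_bracket]
   expects. *)
have E0 : (t * p0 - x * p2) * t - (x * p1 - y * p0) * y = p0.
  transitivity (p0 * (x ^+ 2 + y ^+ 2 + t ^+ 2) - x * (x * p0 + y * p1 + t * p2)); first by ring.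
  by rewrite tan Sx; ring.
have E1 : (x * p1 - y * p0) * x - (y * p2 - t * p1) * t = p1.
  transitivity (p1 * (x ^+ 2 + y ^+ 2 + t ^+ 2) - y * (x * p0 + y * p1 + t * p2)); first by ring.
  by rewrite tan Sx; ring.
have E2 : (y * p2 - t * p1) * y - (t * p0 - x * p2) * x = p2.
  transitivity (p2 * (x ^+ 2 + y ^+ 2 + t ^+ 2) - t * (x * p0 + y * p1 + t * p2)); first by ring.
  by rewrite tan Sx; ring.
have := quartic_bracket (y * p2 - t * p1) (t * p0 - x * p2) (x * p1 - y * p0) Sx s2 s_neq0 w_neq0 d_neq0.
by rewrite E0 E1 E2.
Qed.

End AtPoint.

End InChart.

(* The mixed difference of order 3 in [L] and 1 in [Z] kills every other monomial. *)
Lemma mixed_difference (L Z h c1 c2 c3 : R) : h != 0 ->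
  exists i j : nat, [/\ (i < 4)%N, (j < 2)%N &
    let l := L + i%:R * h in let z := Z + j%:R * h in
    l ^+ 3 * z + (c1 * l * z + c2 * z ^+ 2 + c3 * l ^+ 2) != 0].
Proof.
move=> h0; apply: contrapT => /forallNP N.
pose G (i j : nat) := (L + i%:R * h) ^+ 3 * (Z + j%:R * h) + (c1 * (L + i%:R * h) * (Z + j%:R * h)
   + c2 * (Z + j%:R * h) ^+ 2 + c3 * (L + i%:R * h) ^+ 2).
have G0 i j : (i < 4)%N -> (j < 2)%N -> G i j = 0.
  move=> i4 j2; apply/eqP; apply: contrapT => /negP Gn; apply: (N i); exists j; split=> //.
have : 6 * h ^+ 4 = G 3 1 - 3 * G 2 1 + 3 * G 1 1 - G 0 1 - (G 3 0 - 3 * G 2 0 + 3 * G 1 0 - G 0 0).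
  by rewrite /G; ring.
rewrite !G0 // => /eqP; rewrite !mulr0 !subr0 !addr0 ?subr0 mulf_eq0 pnatr_eq0 /= expf_eq0 /=.
by rewrite (negbTE h0).
Qed.

Section Independence.
Variables (O : set rV2) (psi : rV2 -> rV3).
Hypothesis ic : immersed_chart O psi.

Lemma tangent_cross (x xi : rV3) : S2 x -> tangent x xi -> exists m1 m2 m3 : R,
  [/\ xi 0 0 = m2 * x 0 2 - m3 * x 0 1, xi 0 1 = m3 * x 0 0 - m1 * x 0 2
    & xi 0 2 = m1 * x 0 1 - m2 * x 0 0].
Proof.
move=> /S2E Sx; rewrite /tangent dot3 => tan.
exists (x 0 1 * xi 0 2 - x 0 2 * xi 0 1), (x 0 2 * xi 0 0 - x 0 0 * xi 0 2),
  (x 0 0 * xi 0 1 - x 0 1 * xi 0 0).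
have key i : xi 0 i = xi 0 i * (x 0 0 ^+ 2 + x 0 1 ^+ 2 + x 0 2 ^+ 2)
    - x 0 i * (x 0 0 * xi 0 0 + x 0 1 * xi 0 1 + x 0 2 * xi 0 2).
  by rewrite tan Sx; ring.
by split; rewrite {1}key; ring.
Qed.

(** Derivatives in the momenta suffice. Paired with the rotational and the meridional direction, the
    fibre gradients of [F] and [H] have determinant [2 s^2 r2] times the expression assumed
    nonzero. *)
Lemma model_indep (q p : rV2) : O q -> psi q 0 0 ^+ 2 + psi q 0 1 ^+ 2 != 0 ->
  let x := psi q in let xi := covector psi q p in
  let r2 := x 0 0 ^+ 2 + x 0 1 ^+ 2 in let l := x 0 0 * xi 0 1 - x 0 1 * xi 0 0 in
  l ^+ 3 * xi 0 2 + (4 * x 0 2 * x 0 0 / r2 * l * xi 0 2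
    + - 2 * sq a (x 0 2) * x 0 1 / r2 * xi 0 2 ^+ 2 + 2 * x 0 1 / r2 * l ^+ 2) != 0 ->
  indep_at (in_coord psi F) (in_coord psi H) (q, p).
Proof.
move=> Oq r0 X xi r2 l G m n mn.
have onS : S2 (psi q) by have [_ _ onS _] := ic; exact: onS.
have t1 := S2_height onS; have s0 := sq_gt0 a2 t1; have s2 := sqr_sq a2 t1.
have s_neq0 : sq a (psi q 0 2) != 0 by rewrite gt_eqF.
have w_neq0 : 1 + sq a (psi q 0 2) != 0 by rewrite gt_eqF // addr_gt0.
have gF := gradient_integral ic p Oq; have gH := gradient_energy ic p Oq.
move: gF gH; set Fx := vec3 _ _ _; set Fxi := vec3 _ _ _; set Hx := vec3 _ _ _.
set Hxi := vec3 _ _ _ => gF gH.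
have mnE (eta : rV3) : tangent (psi q) eta -> m * dot Fxi eta + n * dot Hxi eta = 0.
  move=> teta; rewrite (covector_unique ic Oq teta) !covector_sum !mulr_sumr -big_split /=.
  apply: big1 => i _; have [_] := mn i.
  rewrite (has_gradient_Dp ic Oq i gF) (has_gradient_Dp ic Oq i gH) => E.
  by rewrite mulrCA [n * _]mulrCA -mulrDr E mulr0.
have Sx := S2E onS.
have := mnE (vec3 (- psi q 0 1) (psi q 0 0) 0).
have := mnE (vec3 (- psi q 0 0 * psi q 0 2) (- psi q 0 1 * psi q 0 2)
   (psi q 0 0 ^+ 2 + psi q 0 1 ^+ 2)).
rewrite /tangent !dot3 !vec3E => EZ EL.
have {}EZ := EZ ltac:(by ring); have {}EL := EL ltac:(by ring).
move: G EZ EL; rewrite /l /r2 /X -/xi.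
have [m1 [m2 [m3 [-> -> ->]]]] := tangent_cross onS (covector_tangent ic Oq p).
move: r0 Sx s2 s_neq0 w_neq0.
move: (psi q 0 0) (psi q 0 1) (psi q 0 2) => x y t; move: (sq a t) => s.
move=> r0 Sx s2 s_neq0 w_neq0.
set G := (G in G != 0) => G0 EZ EL.
have D0 : 2 * s ^+ 2 * (x ^+ 2 + y ^+ 2) * G != 0.
  by rewrite !mulf_neq0 ?expf_neq0 ?pnatr_eq0.
pose p0 := m2 * t - m3 * y; pose p1 := m3 * x - m1 * t; pose p2 := m1 * y - m2 * x.
pose L := x * p1 - y * p0.
(* Cramer's rule: the first combination of [EL] and [EZ] eliminates [n], the second one eliminates
   [m]. *)
split; apply: (mulIf D0); rewrite mul0r.
  match type of EZ with ?Z = _ => match type of EL with ?E = _ =>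
    transitivity ((2^-1 * s ^+ 2 * p2) * E - (2^-1 * s * L) * Z); last by rewrite EZ EL !mulr0 subrr
  end end.
  by rewrite /G /L /p0 /p1 /p2; field: Sx s2; rewrite r0 w_neq0.
match type of EZ with ?Z = _ => match type of EL with ?E = _ =>
  transitivity ((4 * L ^+ 3 * (x ^+ 2 + y ^+ 2) + 16 * L * t * x - 8 * s * y * p2) * Z
    + (8 * L * y * s) * E); last by rewrite EZ EL !mulr0 addr0
end end.
by rewrite /G /L /p0 /p1 /p2; field: Sx s2; rewrite r0 w_neq0.
Qed.

(** Otherwise the first two components of [psi] vanish near [q]. Its derivatives are then parallel
    to the axis and tangent at a pole, hence zero, against the immersion property. *)
Lemma chart_off_poles (q : rV2) (B : set rV2) : O q -> nbhs q B ->
  exists q', [/\ O q', B q' & psi q' 0 0 ^+ 2 + psi q' 0 1 ^+ 2 != 0].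
Proof.
move=> Oq Bq; apply: contrapT => /forallNP N.
have [oO C onS inj] := ic; have dpsi := chart_differentiable ic Oq.
have P0 : \forall y \near q, psi y 0 0 = 0 /\ psi y 0 1 = 0.
  apply: filterS (filterI (open_nbhs_nbhs (conj oO Oq)) Bq) => y [Oy By].
  have : psi y 0 0 ^+ 2 + psi y 0 1 ^+ 2 = 0.
    by apply: contrapT => n0; apply: (N y); split=> //; exact/eqP.
  by move/eqP; rewrite paddr_eq0 ?sqr_ge0 // !sqrf_eq0 => /andP[/eqP-> /eqP->].
have D0 v : ('D_v psi q) 0 0 = 0 /\ ('D_v psi q) 0 1 = 0.
  have d : derivable psi q v by exact: diff_derivable.
  split; rewrite derive_coord // (near_eq_derive (g := cst (0 : R))) ?derive_cst //.
    by apply: filterS P0 => y [].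
  by apply: filterS P0 => y [].
have v0 v : 'D_v psi q = 0.
  have [d0 d1] := D0 v; have [x0 x1] := nbhs_singleton P0.
  have := chart_tangent ic Oq v; rewrite /tangent jacobianE // dot3 d0 d1 !mulr0 !add0r => /eqP.
  have := S2E (onS q Oq); rewrite x0 x1 expr0n /= subr0 => /esym/eqP.
  rewrite subr_eq0 => /eqP x2; rewrite mulf_eq0 => /orP[/eqP z0|/eqP d2].
    by move: x2; rewrite z0 expr0n /= => /eqP; rewrite oner_eq0.
  by apply: row3P; rewrite ?d0 ?d1 ?d2 mxE.
have := inj q (e 0) Oq; rewrite jacobianE // v0 => /(_ erefl) /rowP /(_ 0).
by rewrite !mxE eqxx => /eqP; rewrite oner_eq0.
Qed.

Lemma covectorD (q p p' : rV2) : covector psi q (p + p') = covector psi q p + covector psi q p'.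
Proof. by rewrite /covector !mulmxDl. Qed.

Lemma covectorZ (q p : rV2) (c : R) : covector psi q (c *: p) = c *: covector psi q p.
Proof. by rewrite /covector -!scalemxAl. Qed.

Lemma model_indep_dense : O `*` setT `<=` closure [set z | indep_at (in_coord psi F) (in_coord psi H) z].
Proof.
move=> [q p] [/= Oq _] B /nbhs_ballP[d /= d0 dB].
have [q' [Oq' qq' r0]] := chart_off_poles Oq (nbhsx_ballx q d d0).
have onS : S2 (psi q') by have [_ _ onS _] := ic; exact: onS.
set x := psi q' in r0 onS; set r2 := x 0 0 ^+ 2 + x 0 1 ^+ 2 in r0.
(* A shift of the momentum by [w1] raises [L] by 1 and keeps [xi 0 2]; a shift by [w2] raises
   [xi 0 2] by 1 and keeps [L]. The polynomial of [mixed_difference] is thus sampled on a grid. *)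
pose w1 := vec3 (- x 0 1 / r2) (x 0 0 / r2) 0 *m (jacobian psi q')^T.
pose w2 := vec3 (- x 0 0 * x 0 2 / r2) (- x 0 1 * x 0 2 / r2) 1 *m (jacobian psi q')^T.
have w1E : covector psi q' w1 = vec3 (- x 0 1 / r2) (x 0 0 / r2) 0.
  by rewrite -(covector_unique ic Oq') // /tangent dot3 !vec3E; ring.
have w2E : covector psi q' w2 = vec3 (- x 0 0 * x 0 2 / r2) (- x 0 1 * x 0 2 / r2) 1.
  rewrite -(covector_unique ic Oq') // /tangent dot3 !vec3E -/x.
  transitivity (x 0 2 * (1 - (x 0 0 ^+ 2 + x 0 1 ^+ 2) / r2)); first by ring.
  by rewrite divff // subrr mulr0.
(* At most three steps along [w1] and one along [w2] are taken, so a step size with [h * M = d / 2]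
   keeps the momentum in the ball; the summand 1 makes [M] positive. *)
pose M := 3 * `|w1| + `|w2| + 1.
have M0 : 0 < M by rewrite ltr_wpDl // addr_ge0 ?mulr_ge0.
pose h := d / (2 * M).
have h0 : 0 < h by rewrite divr_gt0 // mulr_gt0.
have h_neq0 : h != 0 by rewrite gt_eqF.
have E3 : h * M = d / 2 by rewrite /h; field; rewrite gt_eqF.
clearbody h.
set xi := covector psi q' p.
pose c1 := 4 * x 0 2 * x 0 0 / r2; pose c2 := - 2 * sq a (x 0 2) * x 0 1 / r2; pose c3 := 2 * x 0 1 / r2.
have [i [j [i4 j2 G]]] := mixed_difference (x 0 0 * xi 0 1 - x 0 1 * xi 0 0) (xi 0 2) c1 c2 c3 h_neq0.
pose p' := p + (i%:R * h) *: w1 + (j%:R * h) *: w2.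
exists (q', p'); split; last first.
  apply: dB; split=> //=; rewrite -ball_normE /ball_ /= /p' -addrA opprD addNKr normrN.
  rewrite (le_lt_trans (ler_normD _ _)) // !normrZ !ger0_norm ?mulr_ge0 ?(ltW h0) //.
  have i3 : i%:R <= 3 :> R by rewrite ler_nat.
  have j1 : j%:R <= 1 :> R by rewrite (ler_nat _ _ 1).
  have E1 : i%:R * h * `|w1| <= 3 * h * `|w1| by rewrite ler_wpM2r // ler_wpM2r // ltW.
  have E2 : j%:R * h * `|w2| <= 1 * h * `|w2| by rewrite ler_wpM2r // ler_wpM2r // ltW.
  have d2 : d / 2 < d by rewrite ltr_pdivrMr // ltr_pMr // ltr1n.
  have E4 : 3 * h * `|w1| + 1 * h * `|w2| + h = d / 2 by rewrite -E3 /M; ring.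
  by rewrite (le_lt_trans (lerD E1 E2)) // (lt_trans _ d2) // -E4 ltrDl.
have pE : covector psi q' p' = xi + (i%:R * h) *: vec3 (- x 0 1 / r2) (x 0 0 / r2) 0
    + (j%:R * h) *: vec3 (- x 0 0 * x 0 2 / r2) (- x 0 1 * x 0 2 / r2) 1.
  by rewrite !covectorD !covectorZ w1E w2E.
have K := model_indep (p := p') Oq' r0; apply: K; rewrite /= -/x -/r2 pE.
have comb (u v w : rV3) (c d' : R) l : (u + c *: v + d' *: w) 0 l = u 0 l + c * v 0 l + d' * w 0 l.
  by rewrite !mxE.
rewrite !comb !vec3E.
have -> : x 0 0 * (xi 0 1 + i%:R * h * (x 0 0 / r2) + j%:R * h * (- x 0 1 * x 0 2 / r2))
  - x 0 1 * (xi 0 0 + i%:R * h * (- x 0 1 / r2) + j%:R * h * (- x 0 0 * x 0 2 / r2))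
  = x 0 0 * xi 0 1 - x 0 1 * xi 0 0 + i%:R * h.
  transitivity (x 0 0 * xi 0 1 - x 0 1 * xi 0 0 + i%:R * h * ((x 0 0 ^+ 2 + x 0 1 ^+ 2) / r2)).
    by ring.
  by rewrite divff // mulr1.
by rewrite mulr0 addr0 mulr1.
Qed.

End Independence.

(** [l i] and [r i] are the values of the linear forms [L] and [T] on the covectors of the unit
    momenta; [c] collects the coefficients of the expanded integral. *)
Lemma model_integral_polynomial (psi : rV2 -> rV3) :
  exists c : nat -> nat -> rV2 -> R, forall q p, in_coord psi F (q, p) =
    \sum_(j < 5) \sum_(k < 5 | (j + k <= 4)%N) c j k q * p 0 0 ^+ j * p 0 1 ^+ k.
Proof.
pose xi i q := covector psi q (e i).
pose l i q := psi q 0 0 * xi i q 0 1 - psi q 0 1 * xi i q 0 0.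
pose r i q := psi q 0 2 * xi i q 0 1 - psi q 0 1 * xi i q 0 2
  + (2 - a) * psi q 0 2 ^+ 2 / (1 + sq a (psi q 0 2)) * psi q 0 1 * xi i q 0 2.
pose c (j k : nat) q : R := match j, k with
  | 4, 0 => l 0 q ^+ 4 | 3, 1 => 4 * l 0 q ^+ 3 * l 1 q | 2, 2 => 6 * l 0 q ^+ 2 * l 1 q ^+ 2
  | 1, 3 => 4 * l 0 q * l 1 q ^+ 3 | 0, 4 => l 1 q ^+ 4
  | 2, 0 => 8 * l 0 q * r 0 q | 1, 1 => 8 * (l 0 q * r 1 q + l 1 q * r 0 q)
  | 0, 2 => 8 * l 1 q * r 1 q
  | 0, 0 => 4 * (a ^+ 2 - 4) * (psi q 0 1 ^+ 2 / den a (psi q 0 2)) | _, _ => 0 end.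
exists c => q p.
have pE : covector psi q p = p 0 0 *: xi 0 q + p 0 1 *: xi 1 q.
  rewrite -!covectorZ -covectorD; congr covector.
  by rewrite {1}(row_sum_delta p) !big_ord_recl big_ord0 addr0; congr (_ + p 0 _ *: e _); apply/val_inj.
have pEi i : covector psi q p 0 i = p 0 0 * xi 0 q 0 i + p 0 1 * xi 1 q 0 i by rewrite pE !mxE.
under eq_bigr => j _ do rewrite big_mkcond !big_ord_recl big_ord0 /=.
rewrite !big_ord_recl big_ord0 /= /c /= /in_coord /model_integral /= !pEi /l /r.
by ring.
Qed.

Lemma model_smooth : smooth_on (TstarS2 (R := R)) F.
Proof.
apply: (Ck_smooth_on (@open_fst R rV3 rV3 _ (@open_model_domain R a))) => [z [Sz _]|k].
  exact: S2_model_domain.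
exact: Ck_model_integral.
Qed.

Lemma model_integral_of_degree : integral_of_degree 4 H F.
Proof.
split; first exact: model_smooth.
move=> O psi lc f h; have ic := local_coord_immersed lc.
split; first by move=> q p Oq; exact: (model_poisson ic).
  exact: (model_indep_dense ic).
by have [c cE] := model_integral_polynomial psi; exists c => q p _; exact: cE.
Qed.

End ModelIntegral.

(** * The model in the coordinates of the cylinder *)

Section ModelDefined.
Variables (R : realType) (a : R).
Hypothesis a2 : -2 < a.
Local Notation rV2 := 'rV[R]_2.
Local Notation rV3 := 'rV[R]_3.

(** On the cylinder, this is the central projection to the sphere; it and its inverse rescale along
    rays from the origin. *)
Definition model_chart (x : rV3) : rV3 := (Num.sqrt (1 + x 0 2 ^+ 2))^-1 *: x.
Definition model_chart_inv (x : rV3) : rV3 := (Num.sqrt (x 0 0 ^+ 2 + x 0 1 ^+ 2))^-1 *: x.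

Lemma sqrt1D_gt0 (u : R) : 0 < Num.sqrt (1 + u ^+ 2).
Proof. by rewrite sqrtr_gt0 ltr_wpDr // sqr_ge0. Qed.

Lemma sqr_sqrt1D (u : R) : Num.sqrt (1 + u ^+ 2) ^+ 2 = 1 + u ^+ 2.
Proof. by rewrite sqr_sqrtr // addr_ge0 // sqr_ge0. Qed.

Lemma Ck_model_chart k : Ck k setT model_chart.
Proof.
apply: Ck_scale; [exact: openT| |exact: Ck_id].
apply: Ck_inv; [exact: openT|by move=> x _; rewrite gt_eqF // sqrt1D_gt0|].
apply: Ck_sqrt; [exact: openT|by move=> x _; rewrite ltr_wpDr // sqr_ge0|].
apply: Ck_add; [exact: openT|exact: Ck_cst|apply: Ck_exp; [exact: openT|]].
by apply: Ck_coord; [exact: openT|exact: Ck_id].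
Qed.

Definition off_axis : set rV3 := [set x | 0 < x 0 0 ^+ 2 + x 0 1 ^+ 2].

Lemma open_off_axis : open off_axis.
Proof.
apply: (@open_comp _ _ (fun x : rV3 => x 0 0 ^+ 2 + x 0 1 ^+ 2) [set y | 0 < y]); last exact: open_gt.
move=> x _; apply: (Ck_continuous (k := 0) (O := setT)) => //.
by apply: Ck_add; [exact: openT| |]; apply: Ck_exp; try exact: openT;
  apply: Ck_coord; [exact: openT|exact: Ck_id|exact: openT|exact: Ck_id].
Qed.

Lemma Ck_model_chart_inv k : Ck k off_axis model_chart_inv.
Proof.
have oA := open_off_axis.
have cx i : Ck k off_axis (fun x : rV3 => x 0 i) by apply: Ck_coord => //; exact: Ck_id.
apply: Ck_scale => //; last exact: Ck_id.
apply: Ck_inv => //; first by move=> x Ax; rewrite gt_eqF // sqrtr_gt0.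
by apply: Ck_sqrt => //; apply: Ck_add => //; apply: Ck_exp.
Qed.

Local Notation north := (vec3 0 0 1 : rV3).
Local Notation south := (vec3 0 0 (-1) : rV3).

Lemma off_poles (x : rV3) : S2 x -> ~ [set north; south] x -> off_axis x.
Proof.
move=> /S2E Sx; rewrite /off_axis /=.
have [//|] := ltP 0 (x 0 0 ^+ 2 + x 0 1 ^+ 2).
rewrite le_eqVlt ltNge addr_ge0 ?sqr_ge0 // orbF paddr_eq0 ?sqr_ge0 // !sqrf_eq0.
move=> /andP[/eqP x0 /eqP x1]; case; move: Sx; rewrite x0 x1 expr0n /= subr0 => /esym/eqP.
rewrite subr_eq0 eq_sym sqrf_eq1 => /orP[/eqP x2|/eqP x2]; [left|right].
  by apply: row3P; rewrite !vec3E.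
by apply: row3P; rewrite !vec3E.
Qed.

Lemma model_chart_S2 x : cylinder x -> S2 (model_chart x) /\ ~ [set north; south] (model_chart x).
Proof.
rewrite /cylinder /= => cx; have s0 := sqrt1D_gt0 (x 0 2); have s2 := sqr_sqrt1D (x 0 2).
set s := Num.sqrt _ in s0 s2 *.
have s_neq0 : s != 0 by rewrite gt_eqF.
have E : model_chart x = s^-1 *: x by [].
split; first by rewrite /S2 /= E dotZl dotZr dot3 -!expr2 cx -s2; field.
have [x0 x1] : ((s^-1 *: x) 0 0 = s^-1 * x 0 0) /\ ((s^-1 *: x) 0 1 = s^-1 * x 0 1).
  by rewrite !mxE.
move=> H; have [y0 y1] : (s^-1 *: x) 0 0 = 0 /\ (s^-1 *: x) 0 1 = 0.
  by rewrite -E; case: H => ->; rewrite !vec3E.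
have {x0}x0 : x 0 0 = 0 by rewrite y0 in x0; apply/eqP; move/esym/eqP: x0; rewrite mulf_eq0 invr_eq0 (negbTE s_neq0).
have {x1}x1 : x 0 1 = 0 by rewrite y1 in x1; apply/eqP; move/esym/eqP: x1; rewrite mulf_eq0 invr_eq0 (negbTE s_neq0).
by move: cx; rewrite x0 x1 expr0n addr0 => /esym/eqP; rewrite oner_eq0.
Qed.

Lemma model_chartK x : cylinder x -> model_chart_inv (model_chart x) = x.
Proof.
rewrite /cylinder /= => cx; rewrite /model_chart_inv /model_chart.
have s0 := sqrt1D_gt0 (x 0 2); set s := Num.sqrt (1 + _) in s0 *.
have -> : (s^-1 *: x) 0 0 ^+ 2 + (s^-1 *: x) 0 1 ^+ 2 = s^-1 ^+ 2.
  by rewrite !mxE !exprMn -mulrDr cx mulr1.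
by rewrite sqrtr_sqr ger0_norm ?invr_ge0 ?ltW // invrK scalerA divff ?scale1r // gt_eqF.
Qed.

Lemma model_chart_invK x : S2 x -> off_axis x -> model_chart (model_chart_inv x) = x.
Proof.
move=> /S2E Sx ax; rewrite /model_chart_inv /model_chart.
have s0 : 0 < Num.sqrt (x 0 0 ^+ 2 + x 0 1 ^+ 2) by rewrite sqrtr_gt0.
have s2 : Num.sqrt (x 0 0 ^+ 2 + x 0 1 ^+ 2) ^+ 2 = x 0 0 ^+ 2 + x 0 1 ^+ 2.
  by rewrite sqr_sqrtr // ltW.
set s := Num.sqrt (x 0 0 ^+ 2 + _) in s0 s2 *.
have s_neq0 : s != 0 by rewrite gt_eqF.
have -> : 1 + (s^-1 *: x) 0 2 ^+ 2 = s^-1 ^+ 2.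
  rewrite mxE; transitivity ((s ^+ 2 + x 0 2 ^+ 2) / s ^+ 2); first by field.
  have -> : s ^+ 2 + x 0 2 ^+ 2 = 1 by rewrite s2 Sx; ring.
  by rewrite div1r exprVn.
by rewrite sqrtr_sqr ger0_norm ?invr_ge0 ?ltW // invrK scalerA divff ?scale1r // gt_eqF.
Qed.

Lemma model_chart_inv_cylinder x : off_axis x -> cylinder (model_chart_inv x).
Proof.
move=> ax; rewrite /cylinder /= /model_chart_inv.
have s0 : 0 < Num.sqrt (x 0 0 ^+ 2 + x 0 1 ^+ 2) by rewrite sqrtr_gt0.
have s2 : Num.sqrt (x 0 0 ^+ 2 + x 0 1 ^+ 2) ^+ 2 = x 0 0 ^+ 2 + x 0 1 ^+ 2.
  by rewrite sqr_sqrtr // ltW.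
set s := Num.sqrt (x 0 0 ^+ 2 + _) in s0 s2 *.
by rewrite !mxE !exprMn -mulrDr -s2 exprVn mulVf // expf_neq0 // gt_eqF.
Qed.

Lemma model_chart_diffeo :
  diffeo (cylinder (R := R)) (S2 (R := R) `\` [set north; south]) model_chart.
Proof.
split.
- by apply: (Ck_smooth_on openT) => // k; exact: Ck_model_chart.
- split.
  + by move=> x cx; exact: model_chart_S2.
  + move=> x y /set_mem cx /set_mem cy E.
    by rewrite -(model_chartK cx) E model_chartK.
  + move=> x [Sx Nx]; have ax := off_poles Sx Nx.
    by exists (model_chart_inv x); [exact: model_chart_inv_cylinder|exact: model_chart_invK].
- exists model_chart_inv; split; last exact: model_chartK.
  apply: (Ck_smooth_on open_off_axis) => [x [Sx Nx]|k]; first exact: off_poles.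
  exact: Ck_model_chart_inv.
Qed.

Lemma cvg_vec3 (T : Type) (Fl : set_system T) (FF : Filter Fl) (f g h : T -> R) (x y z : R) :
  f @ Fl --> x -> g @ Fl --> y -> h @ Fl --> z ->
  (fun t => vec3 (f t) (g t) (h t)) @ Fl --> vec3 x y z.
Proof.
move=> cf cg ch.
have D (u v w : R) : vec3 u v w = u *: vec3 1 0 0 + v *: vec3 0 1 0 + w *: vec3 0 0 1.
  by apply: row3P; rewrite !mxE /=; ring.
have -> : (fun t => vec3 (f t) (g t) (h t)) = (fun t => f t *: vec3 1 0 0 + g t *: vec3 0 1 0 + h t *: vec3 0 0 1).
  by apply/funext => t; exact: D.
rewrite (D x y z).
by apply: cvgD; [apply: cvgD|]; apply: cvgZ => //; exact: cvg_cst.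
Qed.

Lemma cvg_invsqrt1D (Fl : set_system R) (FF : Filter Fl) :
  (forall M, \forall u \near Fl, M < `|u|) -> (Num.sqrt (1 + u ^+ 2))^-1 @[u --> Fl] --> (0 : R).
Proof.
move=> HF; apply/cvgrPdist_lt => d d0; near=> u.
rewrite sub0r normrN ger0_norm ?invr_ge0 ?sqrtr_ge0 // -[ltRHS]invrK.
rewrite ltf_pV2 ?posrE ?invr_gt0 ?sqrt1D_gt0 //.
have u0 : d^-1 < `|u| by near: u; exact: HF.
rewrite (lt_trans u0) // -sqrtr_sqr ltr_sqrt ?ltrDr // ltr_wpDr // sqr_ge0.
Unshelve. all: by end_near. Qed.

Lemma cvg_divsqrt1D (Fl : set_system R) (FF : Filter Fl) :
  (forall M, \forall u \near Fl, M < u) -> u / Num.sqrt (1 + u ^+ 2) @[u --> Fl] --> (1 : R).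
Proof.
move=> HF; have HF' M : \forall u \near Fl, M < `|u|.
  by apply: filterS (HF M) => u /lt_le_trans; apply; exact: ler_norm.
have c0 := cvg_invsqrt1D FF HF'.
(* For [u > 0] the quotient [u / sqrt (1 + u^2)] equals [sqrt (1 - 1 / (1 + u^2))]. *)
have c1 : Num.sqrt (1 - (Num.sqrt (1 + u ^+ 2))^-1 ^+ 2) @[u --> Fl] --> (1 : R).
  have E1 : Num.sqrt (1 - 0 ^+ 2) = 1 :> R by rewrite expr0n subr0 sqrtr1.
  rewrite -[X in _ --> X]E1; apply: continuous_cvg; first exact: sqrt_continuous.
  apply: cvgB; first exact: cvg_cst.
  exact: (cvgM c0 c0).
apply: cvg_trans c1; apply: near_eq_cvg; apply: filterS (HF 0) => u u0.
have s0 := sqrt1D_gt0 u; have s2 := sqr_sqrt1D u; set s := Num.sqrt (1 + _) in s0 s2 *.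
have -> : 1 - s^-1 ^+ 2 = (u / s) ^+ 2.
  transitivity ((s ^+ 2 - 1) / s ^+ 2); first by field; rewrite gt_eqF.
  by rewrite s2 expr_div_n s2; congr (_ / _); ring.
by rewrite sqrtr_sqr ger0_norm // divr_ge0 // ltW.
Qed.

Lemma model_chart_cvg (phi : R) :
  model_chart (vec3 (cos phi) (sin phi) u) @[u --> +oo] --> north /\
  model_chart (vec3 (cos phi) (sin phi) u) @[u --> -oo] --> south.
Proof.
have E u : model_chart (vec3 (cos phi) (sin phi) u) =
    vec3 ((Num.sqrt (1 + u ^+ 2))^-1 * cos phi) ((Num.sqrt (1 + u ^+ 2))^-1 * sin phi)
      (u / Num.sqrt (1 + u ^+ 2)).
  by rewrite /model_chart vec3E; apply: row3P; rewrite !mxE //= mulrC.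
have -> : (fun u => model_chart (vec3 (cos phi) (sin phi) u)) = (fun u =>
    vec3 ((Num.sqrt (1 + u ^+ 2))^-1 * cos phi) ((Num.sqrt (1 + u ^+ 2))^-1 * sin phi)
      (u / Num.sqrt (1 + u ^+ 2))) by apply/funext.
have big (Fl : set_system R) (FF : Filter Fl) c : (forall M, \forall u \near Fl, M < `|u|) ->
    (Num.sqrt (1 + u ^+ 2))^-1 * c @[u --> Fl] --> (0 : R).
  move=> HF; rewrite -(mul0r c).
  by apply: cvgM; [exact: cvg_invsqrt1D|exact: cvg_cst].
have pinf M : \forall u \near +oo, M < u :> R by apply: nbhs_pinfty_gt; rewrite num_real.
have pinf' M : \forall u \near +oo, M < `|u| :> R.
  by apply: filterS (pinf M) => u /lt_le_trans; apply; exact: ler_norm.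
have ninf M : \forall u \near -oo, u < M :> R by apply: nbhs_ninfty_lt; rewrite num_real.
have ninf' M : \forall u \near -oo, M < `|u| :> R.
  by apply: filterS (ninf (- M)) => u; rewrite ltrNr -normrN => /lt_le_trans; apply; exact: ler_norm.
split; apply: cvg_vec3; try exact: big; first exact: cvg_divsqrt1D.
(* The limit at [-oo] is the one at [+oo] after the reflection [u -> - u]. *)
have NF : Filter (-%R @ -oo%R : set_system R) by exact: fmap_filter.
have c : u / Num.sqrt (1 + u ^+ 2) @[u --> (-%R @ -oo%R)] --> (1 : R).
  apply: cvg_divsqrt1D => M.
  by apply: filterS (ninf (- M)) => u /=; rewrite ltrNr.
have -> : (fun t : R => t / Num.sqrt (1 + t ^+ 2)) =
    (fun u => - (u / Num.sqrt (1 + u ^+ 2))) \o -%R.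
  by apply/funext => u; rewrite /= sqrrN mulNr opprK.
exact: cvgN c.
Qed.

Lemma cyl_cylinder (q : rV2) : cylinder (cyl q).
Proof. by rewrite /cylinder /= /cyl !vec3E cos2Dsin2. Qed.

(** The radius of the parallel onto which the circle at height [u] is projected; its height on the
    sphere is [u * sigma u]. *)
Definition sigma (u : R) := (Num.sqrt (1 + u ^+ 2))^-1.

Lemma model_cylE (q : rV2) : model_chart (cyl q) =
  vec3 (cos (q 0 0) * sigma (q 0 1)) (sin (q 0 0) * sigma (q 0 1)) (q 0 1 * sigma (q 0 1)).
Proof. by rewrite /model_chart /cyl vec3E; apply: row3P; rewrite !mxE //= mulrC. Qed.

Lemma Ck_cyl k : Ck k setT (@cyl R).
Proof.
have cq i : Ck k setT (fun q : rV2 => q 0 i) by apply: Ck_coord; [exact: openT|exact: Ck_id].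
have oT : open [set: rV2] by exact: openT.
apply: Ck_matrix => // i j; rewrite [i]ord1; case: (ord3 j) => ->.
- by apply: (@Ck_eq _ _ _ _ _ (fun q : rV2 => cos (q 0 0))) => // [q _|]; [rewrite vec3E|exact: Ck_cos].
- by apply: (@Ck_eq _ _ _ _ _ (fun q : rV2 => sin (q 0 0))) => // [q _|]; [rewrite vec3E|exact: Ck_sin].
- by apply: (@Ck_eq _ _ _ _ _ (fun q : rV2 => q 0 1)) => // q _; rewrite vec3E.
Qed.

Lemma sigma_sqr u : sigma u ^+ 2 * (1 + u ^+ 2) = 1.
Proof. by rewrite /sigma exprVn sqr_sqrt1D mulVf // gt_eqF // ltr_wpDr // sqr_ge0. Qed.

Lemma sq_sigma u : 0 < A a u -> sq a (u * sigma u) = Num.sqrt (A a u) * sigma u ^+ 2.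
Proof.
move=> A0; have s2 := sigma_sqr u.
have -> : sq a (u * sigma u) = Num.sqrt (A a u * (sigma u ^+ 2) ^+ 2).
  congr Num.sqrt; rewrite /A.
  have E : sigma u ^+ 2 = 1 - sigma u ^+ 2 * u ^+ 2 by rewrite -{1}s2; ring.
  transitivity ((sigma u ^+ 2 * (1 + u ^+ 2)) ^+ 2 - (2 - a) * (u * sigma u) ^+ 2
     * (sigma u ^+ 2 * (1 + u ^+ 2) - (u * sigma u) ^+ 2)).
    by rewrite s2 expr1n.
  by ring.
by rewrite sqrtrM ?ltW // sqrtr_sqr ger0_norm // sqr_ge0.
Qed.

Lemma A_gt0 (u : R) : 0 < A a u.
Proof.
rewrite /A -[4%N]/(2 * 2)%N exprM; have := sqr_ge0 u; move: (u ^+ 2) => T T0.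
have -> : 1 + a * T + T ^+ 2 = (T - 1) ^+ 2 + (a + 2) * T by ring.
have [T1|T1] := eqVneq T 0; last first.
  rewrite ltr_wpDl ?sqr_ge0 // mulr_gt0 //; last by rewrite lt_neqAle eq_sym T1.
  by rewrite -ltrBlDr sub0r.
by rewrite T1 mulr0 addr0 sub0r sqrrN expr1n.
Qed.

Lemma is_derive_sigma (u : R) : is_derive u 1 sigma (- u * sigma u ^+ 3).
Proof.
have s_neq0 : Num.sqrt (1 + u ^+ 2) != 0 by rewrite gt_eqF // sqrt1D_gt0.
pose z0 := fun _ : R => 0 : R.
have gi : grad6 (@id R) z0 z0 z0 z0 z0 u (@id R) 1 0 0 0 0 0 by split=> [|w]; [exact: ex_diff|ring].
have G2 := @grad6_comp1 R R _ _ _ _ _ _ _ (fun y : R => 1 + y ^+ 2) Num.sqrt _ _ _ _ _ _ _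
  (is_derive1_sqrt (ltr_wpDr (sqr_ge0 u) ltr01)) (grad6_add (grad6_cst _ _ _ _ _ _ _ 1) (grad6_exp 1 gi)).
have [d dE] := @grad6_comp1 R R _ _ _ _ _ _ _ (fun y : R => Num.sqrt (1 + y ^+ 2)) GRing.inv _ _ _ _ _ _ _
  (is_derive_inv s_neq0) G2.
split; first exact: diff_derivable.
apply: (etrans (dE 1)); rewrite derive_id /sigma /=; field; exact: s_neq0.
Qed.

Lemma derive_model_cyl (q v : rV2) : let phi := q 0 0 in let u := q 0 1 in let s := sigma u in
  'D_v (model_chart \o cyl (R := R)) q =
  vec3 (- sin phi * s * v 0 0 - cos phi * u * s ^+ 3 * v 0 1)
    (cos phi * s * v 0 0 - sin phi * u * s ^+ 3 * v 0 1) (s ^+ 3 * v 0 1).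
Proof.
move=> phi u s.
have d : differentiable (model_chart \o cyl (R := R)) q.
  apply: differentiable_comp; first by have [+ _] := (CkS _ _ _).1 (Ck_cyl 1); apply.
  by have [+ _] := (CkS _ _ _).1 (Ck_model_chart 1); apply.
have dv : derivable (model_chart \o cyl (R := R)) q v by exact: diff_derivable.
have dq i : differentiable (fun y : rV2 => y 0 i) q by exact: differentiable_coord.
have Dq i : 'D_v (fun y : rV2 => y 0 i) q = v 0 i.
  by rewrite -derive_coord ?derive_id //; exact: derivable_id.
pose z0 := fun _ : rV2 => 0 : R; have dz : differentiable z0 q by exact: differentiable_cst.
pose X i := fun y : rV2 => y 0 i : R.
have gX0 := grad6_X0 (X 1) z0 z0 z0 z0 (dq 0).
have gX1 : grad6 (X 0) (X 1) z0 z0 z0 z0 q (X 1) 0 1 0 0 0 0.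
  by split=> [|w]; [exact: dq|ring].
have sE : s ^+ 2 * (1 + u ^+ 2) = 1 by exact: sigma_sqr.
have gs := grad6_comp1 (is_derive_sigma (X 1 q)) gX1.
have gcos := grad6_comp1 (is_derive_cos (X 0 q)) gX0.
have gsin := grad6_comp1 (is_derive_sin (X 0 q)) gX0.
have [_ e0] := grad6_mul gcos gs; have [_ e1] := grad6_mul gsin gs; have [_ e2] := grad6_mul gX1 gs.
have vE0 (x y z : rV2 -> R) : (fun q => vec3 (x q) (y q) (z q) 0 0) = x by apply/funext => ?; rewrite vec3E.
have vE1 (x y z : rV2 -> R) : (fun q => vec3 (x q) (y q) (z q) 0 1) = y by apply/funext => ?; rewrite vec3E.
have vE2 (x y z : rV2 -> R) : (fun q => vec3 (x q) (y q) (z q) 0 2) = z by apply/funext => ?; rewrite vec3E.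
have funE : model_chart \o cyl (R := R) = (fun y : rV2 =>
    vec3 (cos (y 0 0) * sigma (y 0 1)) (sin (y 0 0) * sigma (y 0 1)) (y 0 1 * sigma (y 0 1))).
  by apply/funext => y; exact: model_cylE.
have coordE i := derive_coord 0 i dv.
apply: row3P; apply: (etrans (coordE _)); rewrite funE ?vE0 ?vE1 ?vE2 vec3E.
- apply: (etrans (e0 v)); rewrite !Dq /= /X -/phi -/u -/s; ring.
- apply: (etrans (e1 v)); rewrite !Dq /= /X -/phi -/u -/s; ring.
- apply: (etrans (e2 v)); rewrite !Dq /= /X -/phi -/u -/s.
  transitivity (s * (s ^+ 2 * (1 + u ^+ 2)) * v 0 1 - u ^+ 2 * s ^+ 3 * v 0 1); last by ring.
  by rewrite sE; ring.
Qed.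

Lemma model_quad_form (q v : rV2) :
  2^-1 * form (metric_in_coord (model_chart \o cyl (R := R)) (model_metric a) q) v v
    = quad_form a (q 0 1) v.
Proof.
have d : differentiable (model_chart \o cyl (R := R)) q.
  apply: differentiable_comp; first by have [+ _] := (CkS _ _ _).1 (Ck_cyl 1); apply.
  by have [+ _] := (CkS _ _ _).1 (Ck_model_chart 1); apply.
rewrite /metric_in_coord form_mul jacobianE // derive_model_cyl model_formE dot3 !vec3E.
rewrite /= model_cylE vec3E (sq_sigma (A_gt0 _)) /quad_form.
have S0 : 0 < Num.sqrt (A a (q 0 1)) by rewrite sqrtr_gt0 A_gt0.
have S2' : Num.sqrt (A a (q 0 1)) ^+ 2 = 1 + a * q 0 1 ^+ 2 + q 0 1 ^+ 4.
  by rewrite sqr_sqrtr // ltW // A_gt0.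
have sE := sigma_sqr (q 0 1); have cs := cos2Dsin2 (q 0 0).
have s_gt0 : 0 < sigma (q 0 1) by rewrite invr_gt0 sqrt1D_gt0.
move: (q 0 1) (v 0 0) (v 0 1) (Num.sqrt (A a _)) (cos _) (sin _) (sigma _) S0 S2' sE cs s_gt0.
move=> u v0 v1 S C N s S0 S2' sE cs s0.
have S_neq0 : S != 0 by rewrite gt_eqF.
have s_neq0 : s != 0 by rewrite gt_eqF.
have w_neq0 : 1 + S * s ^+ 2 != 0 by rewrite gt_eqF // addr_gt0 // mulr_gt0 // exprn_gt0.
(* The defining relation of [sq a t] at [t = u * s], where [1 - t ^+ 2 = s ^+ 2]. *)
have key : S ^+ 2 * s ^+ 4 + (2 - a) * u ^+ 2 * s ^+ 4 = 1.
  transitivity ((s ^+ 2 * (1 + u ^+ 2)) ^+ 2); last by rewrite sE expr1n.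
  by rewrite S2'; ring.
transitivity (S^-1 * v0 ^+ 2 * (C ^+ 2 + N ^+ 2) + v1 ^+ 2 * (s ^+ 2 / S * (s ^+ 2 * (u ^+ 2 * (C ^+ 2 + N ^+ 2) + 1))
   + (2 - a) * u ^+ 2 * s ^+ 4 / (S ^+ 2 * (1 + S * s ^+ 2)))).
  by field; rewrite S_neq0 s_neq0 w_neq0.
have -> : s ^+ 2 * (u ^+ 2 * (C ^+ 2 + N ^+ 2) + 1) = 1 by rewrite cs mulr1 addrC sE.
rewrite cs !mulr1.
have -> : (2 - a) * u ^+ 2 * s ^+ 4 = 1 - S ^+ 2 * s ^+ 4.
  by apply/eqP; rewrite eq_sym subr_eq addrC key.
by field; rewrite S_neq0 w_neq0.
Qed.

Lemma model_potential_chart (q : rV2) :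
  model_potential a ((model_chart \o cyl (R := R)) q) = potential a (q 0 0) (q 0 1).
Proof.
have [Sx _] := model_chart_S2 (cyl_cylinder q).
have d0 := den_gt0 a2 (S2_height Sx).
rewrite /= /model_potential /potential; move: d0; rewrite model_cylE !vec3E /den (sq_sigma (A_gt0 _)).
have S2' : Num.sqrt (A a (q 0 1)) ^+ 2 = 1 + a * q 0 1 ^+ 2 + q 0 1 ^+ 4.
  by rewrite sqr_sqrtr // ltW // A_gt0.
have sE := sigma_sqr (q 0 1).
have s_gt0 : 0 < sigma (q 0 1) by rewrite invr_gt0 sqrt1D_gt0.
move: (q 0 1) (Num.sqrt (A a _)) (cos _) (sigma _) S2' sE s_gt0 => u S C s S2' sE s0 d0.
have E : a + (2 - a) * (u * s) ^+ 2 + 2 * (S * s ^+ 2) = s ^+ 2 * (a + 2 * u ^+ 2 + 2 * S).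
  transitivity (a * (s ^+ 2 * (1 + u ^+ 2)) + (2 - a) * (u * s) ^+ 2 + 2 * (S * s ^+ 2)).
    by rewrite sE mulr1.
  by ring.
rewrite E in d0 *; have s_neq0 : s != 0 by rewrite gt_eqF.
have D0 : a + 2 * u ^+ 2 + 2 * S != 0.
  by apply/eqP => D0; move: d0; rewrite D0 mulr0 ltxx.
by field: S2'; rewrite D0 s_neq0.
Qed.

Lemma model_defined_by : defined_by a (model_metric a) (model_potential a).
Proof.
split; first exact: model_riemannian.
split.
  apply: (Ck_smooth_on (@open_model_domain R a) (S2_model_domain a2)) => k.
  exact: Ck_model_potential.
exists model_chart, north, south; split; last split; last split; last split.
- split; rewrite /S2 /= ?dot3 ?vec3E; [ring|ring|].
  move=> /(congr1 (fun x : rV3 => x 0 2)); rewrite !vec3E => H.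
  by have : (0 : R) < 0; [rewrite -{2}(subrr 1) {2}H; lra|rewrite ltxx].
- exact: model_chart_diffeo.
- exact: model_chart_cvg.
- exact: model_quad_form.
- exact: model_potential_chart.
Qed.

End ModelDefined.

(** * The coordinates (phi, u) *)

Section CylinderChart.
Variable R : realType.
Local Notation rV2 := 'rV[R]_2.
Local Notation rV3 := 'rV[R]_3.

Definition vec2 (x y : R) : rV2 := \row_(i < 2) [:: x; y]`_i.

Lemma vec2E (x y : R) : ((vec2 x y 0 0 = x) * (vec2 x y 0 1 = y))%type.
Proof. by rewrite !mxE. Qed.

Lemma ord2 (i : 'I_2) : i = 0 \/ i = 1.
Proof. by case: i => [[|[|//]] ?]; [left|right]; apply/val_inj. Qed.

Lemma row2P (u v : rV2) : u 0 0 = v 0 0 -> u 0 1 = v 0 1 -> u = v.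
Proof. by move=> h0 h1; apply/rowP => i; case: (ord2 i) => ->. Qed.

Lemma vec2_eta (q : rV2) : vec2 (q 0 0) (q 0 1) = q.
Proof. by apply: row2P; rewrite vec2E. Qed.

Lemma sum2 (F : 'I_2 -> R) : \sum_i F i = F 0 + F 1.
Proof. by rewrite !big_ord_recl big_ord0 addr0; congr (_ + F _); apply/val_inj. Qed.

Lemma dot2 (u v : rV2) : dot u v = u 0 0 * v 0 0 + u 0 1 * v 0 1.
Proof. by rewrite dotE sum2. Qed.

Lemma form2 (B : 'M[R]_2) (v : rV2) :
  form B v v = v 0 0 ^+ 2 * B 0 0 + v 0 0 * v 0 1 * (B 0 1 + B 1 0) + v 0 1 ^+ 2 * B 1 1.
Proof. by rewrite formE dot2 !mxE !sum2; ring. Qed.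

Lemma invmx2_diag (M : 'M[R]_2) : M \in unitmx -> M 0 1 = 0 -> M 1 0 = 0 ->
  [/\ invmx M 0 0 = (M 0 0)^-1, invmx M 0 1 = 0, invmx M 1 0 = 0 & invmx M 1 1 = (M 1 1)^-1].
Proof.
move=> uM M01 M10; have inv := mulmxV uM.
have E i j : \sum_k M i k * invmx M k j = (i == j)%:R.
  by have := congr1 (fun N : 'M[R]_2 => N i j) inv; rewrite !mxE.
move: (E 0 0) (E 0 1) (E 1 0) (E 1 1); rewrite !sum2 M01 M10 !mul0r !addr0 !add0r /=.
move=> E00 E01 E10 E11.
have n0 : M 0 0 != 0 by apply/eqP => z; move/eqP: E00; rewrite z mul0r eq_sym oner_eq0.
have n1 : M 1 1 != 0 by apply/eqP => z; move/eqP: E11; rewrite z mul0r eq_sym oner_eq0.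
split.
- by apply: (mulfI n0); rewrite E00 divff.
- by apply: (mulfI n0); rewrite E01 mulr0.
- by apply: (mulfI n1); rewrite E10 mulr0.
- by apply: (mulfI n1); rewrite E11 divff.
Qed.

Lemma cyl_onto (x : rV3) : cylinder x -> exists phi, x = cyl (vec2 phi (x 0 2)).
Proof.
rewrite /cylinder /= => cx.
have x1 : -1 <= x 0 0 <= 1.
  by rewrite -ler_norml -(ler_pXn2r (n := 2)) ?nnegrE // expr1n real_normK ?num_real // -cx lerDl sqr_ge0.
have E : Num.sqrt (1 - x 0 0 ^+ 2) = `|x 0 1|.
  by rewrite -sqrtr_sqr -cx; congr Num.sqrt; ring.
have c := acosK; have s := sin_acos x1.
have x1' : x 0 0 \in `[-1, 1] by rewrite in_itv.
have [x10|x10] := leP 0 (x 0 1).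
  exists (acos (x 0 0)); apply: row3P; rewrite /cyl !vec3E !vec2E ?c ?s ?E //.
  by rewrite ger0_norm.
exists (- acos (x 0 0)); apply: row3P; rewrite /cyl !vec3E !vec2E ?cosN ?sinN ?c ?s ?E //.
by rewrite ltr0_norm // opprK.
Qed.

Definition cyl_inv (x : rV3) : rV2 := vec2 (atan (x 0 1 / x 0 0)) (x 0 2).

(** The half of the cylinder on which [atan] recovers the angle. Excluding quadratic integrals and
    comparing two metrics are local matters, for which this one chart suffices. *)
Definition strip : set rV2 := [set q | - (pi / 2) < q 0 0 < pi / 2].

Lemma open_coord_gt n (i : 'I_n) (c : R) : open [set q : 'rV[R]_n | c < q 0 i].
Proof.
apply: (@open_comp _ _ (fun q : 'rV[R]_n => q 0 i) [set y | c < y]); last exact: open_gt.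
by move=> q _; exact: coord_continuous.
Qed.

Lemma open_coord_lt n (i : 'I_n) (c : R) : open [set q : 'rV[R]_n | q 0 i < c].
Proof.
apply: (@open_comp _ _ (fun q : 'rV[R]_n => q 0 i) [set y | y < c]); last exact: open_lt.
by move=> q _; exact: coord_continuous.
Qed.

Lemma open_strip : open strip.
Proof.
have -> : strip = [set q | - (pi / 2) < q 0 0] `&` [set q | q 0 0 < pi / 2].
  apply/seteqP; split=> q; rewrite /strip /=; first by move=> /andP.
  by move=> [h1 h2]; apply/andP.
by apply: openI; [exact: open_coord_gt|exact: open_coord_lt].
Qed.

Lemma cos_strip_gt0 (q : rV2) : strip q -> 0 < cos (q 0 0).
Proof. exact: cos_gt0_pihalf. Qed.

Lemma cylK (q : rV2) : strip q -> cyl_inv (cyl q) = q.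
Proof.
move=> sq; have c0 := cos_strip_gt0 sq.
by apply: row2P; rewrite /cyl_inv /cyl vec2E !vec3E // -[_ / _]/(tan _) tanK // in_itv.
Qed.

Lemma cyl_invK (x : rV3) : cylinder x -> 0 < x 0 0 -> cyl (cyl_inv x) = x.
Proof.
rewrite /cylinder /= => cx x0; have x0' : x 0 0 != 0 by rewrite gt_eqF.
have c : cos (atan (x 0 1 / x 0 0)) = x 0 0.
  rewrite cos_atan; have -> : 1 + (x 0 1 / x 0 0) ^+ 2 = (x 0 0)^-1 ^+ 2.
    by transitivity ((x 0 0 ^+ 2 + x 0 1 ^+ 2) / x 0 0 ^+ 2); [field|rewrite cx div1r exprVn].
  by rewrite sqrtr_sqr ger0_norm ?invrK // invr_ge0 ltW.
apply: row3P; rewrite /cyl /cyl_inv !vec3E !vec2E //.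
have := atanK (x 0 1 / x 0 0); rewrite /tan c => /(congr1 ( *%R^~ (x 0 0))).
by rewrite !divfK.
Qed.

Lemma cyl_inv_strip (x : rV3) : strip (cyl_inv x).
Proof. by rewrite /strip /= /cyl_inv vec2E atan_gtNpi2 atan_ltpi2. Qed.

Lemma Ck_cyl_inv k : Ck k [set x : rV3 | 0 < x 0 0] cyl_inv.
Proof.
have o : open [set x : rV3 | 0 < x 0 0] by exact: open_coord_gt.
have cx i : Ck k [set x : rV3 | 0 < x 0 0] (fun x : rV3 => x 0 i) by apply: Ck_coord => //; exact: Ck_id.
apply: Ck_matrix => // i j; rewrite [i]ord1; case: (ord2 j) => ->.
  apply: (@Ck_eq _ _ _ _ _ (fun x : rV3 => atan (x 0 1 / x 0 0))) => //.
    by move=> x _; rewrite vec2E.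
  apply: Ck_atan => //; apply: Ck_mul => //; apply: Ck_inv => // x /= x0.
  by rewrite gt_eqF.
by apply: (@Ck_eq _ _ _ _ _ (fun x : rV3 => x 0 2)) => // x _; rewrite vec2E.
Qed.

End CylinderChart.

(** * An arbitrary realisation in the coordinates (phi, u) *)

Section DefinedBy.
Variables (R : realType) (a : R) (g : 'rV[R]_3 -> 'M[R]_3) (U : 'rV[R]_3 -> R).
Local Notation rV2 := 'rV[R]_2.
Local Notation rV3 := 'rV[R]_3.
Local Notation e := (fun i : 'I_2 => delta_mx 0 i : rV2).
Variables (Psi : rV3 -> rV3) (N S : rV3).
Hypotheses (a2 : -2 < a) (rg : riemannian g).
Hypothesis dPsi : diffeo (cylinder (R := R)) (S2 (R := R) `\` [set N; S]) Psi.
Let psi := Psi \o cyl (R := R).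
Hypothesis gE : forall q v : rV2, 2^-1 * form (metric_in_coord psi g q) v v = quad_form a (q 0 1) v.
Hypothesis UE : forall q : rV2, U (psi q) = potential a (q 0 0) (q 0 1).

Let sA (u : R) := Num.sqrt (A a u).

Lemma sA_gt0 u : 0 < sA u. Proof. by rewrite sqrtr_gt0 A_gt0. Qed.

Lemma sqr_sA u : sA u ^+ 2 = A a u. Proof. by rewrite sqr_sqrtr // ltW // A_gt0. Qed.

Lemma defined_smooth : smooth_on setT psi.
Proof.
have [sPsi _ _] := dPsi.
apply: (smooth_on_comp (finite_basis_row R 3) _ _ sPsi).
  by move=> _ [q _ <-]; exact: cyl_cylinder.
by apply: (Ck_smooth_on openT) => // k; exact: Ck_cyl.
Qed.

Lemma defined_range q : S2 (psi q) /\ ~ [set N; S] (psi q).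
Proof. by have [_ [fP _ _] _] := dPsi; exact: (fP _ (cyl_cylinder q)). Qed.

(** A vector annihilated by the differential of [psi] would have length zero, but [quad_form] is
    positive definite. *)
Lemma defined_chart : immersed_chart setT psi.
Proof.
split; first exact: openT.
- by move=> k; apply: smooth_on_open; [exact: openT|exact: defined_smooth].
- by move=> q _; have [] := defined_range q.
move=> q v _ v0; have := gE q v; rewrite /metric_in_coord form_mul v0 formE mul0mx dot0l mulr0.
have S0 := sA_gt0 (q 0 1); rewrite /quad_form -/(sA _) => /esym/eqP.
have q1 : 0 <= (sA (q 0 1))^-1 * v 0 1 ^+ 2 by rewrite mulr_ge0 ?sqr_ge0 // invr_ge0 ltW.
rewrite mulf_eq0 invr_eq0 (gt_eqF S0) /= paddr_eq0 ?sqr_ge0 //.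
rewrite sqrf_eq0 => /andP[/eqP v0']; rewrite mulf_eq0 invr_eq0 (gt_eqF S0) /= sqrf_eq0 => /eqP v1.
by apply: row2P; rewrite ?v0' ?v1 mxE.
Qed.

Lemma defined_metricE q : let G := metric_in_coord psi g q in
  [/\ G 0 0 = 2 / sA (q 0 1), G 0 1 = 0, G 1 0 = 0 & G 1 1 = 2 / A a (q 0 1)].
Proof.
move=> G; have GT : G^T = G by exact: (metric_in_coord_sym rg defined_chart).
have G10 : G 1 0 = G 0 1 by rewrite -{1}GT mxE.
have formG (v : rV2) : form G v v = v 0 0 ^+ 2 * G 0 0 + 2 * v 0 0 * v 0 1 * G 0 1 + v 0 1 ^+ 2 * G 1 1.
  by rewrite form2 G10; ring.
have H x y := gE q (vec2 x y).
have S0 : sA (q 0 1) != 0 by rewrite gt_eqF // sA_gt0.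
move: (H 1 0) (H 0 1) (H 1 1); rewrite -/G !formG /quad_form !vec2E -/(sA _).
rewrite -(sqr_sA (q 0 1)); move: (sA _) S0 (G 0 0) (G 0 1) (G 1 0) (G 1 1) G10.
move=> s s0 g00 g01 g10 g11 -> E0 E1 E2.
have {}E0 : g00 = 2 / s.
  by transitivity (2 * (2^-1 * (1 ^+ 2 * g00 + 2 * 1 * 0 * g01 + 0 ^+ 2 * g11))); [field|rewrite E0; field].
have {}E1 : g11 = 2 / s ^+ 2.
  by transitivity (2 * (2^-1 * (0 ^+ 2 * g00 + 2 * 0 * 1 * g01 + 1 ^+ 2 * g11))); [field|rewrite E1; field].
have {}E2 : g01 = 0.
  transitivity (2^-1 * (1 ^+ 2 * g00 + 2 * 1 * 1 * g01 + 1 ^+ 2 * g11) - 2^-1 * (g00 + g11)); first by field.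
  by rewrite E2 E0 E1; field.
by split.
Qed.

Lemma defined_kinetic q xi : tangent (psi q) xi ->
  let p := xi *m (jacobian psi q)^T in
  kinetic g (psi q, xi) = 4^-1 * (sA (q 0 1) * p 0 0 ^+ 2 + A a (q 0 1) * p 0 1 ^+ 2).
Proof.
move=> t p; rewrite (kinetic_chart rg defined_chart I t) -/p.
have [G00 G01 G10 G11] := defined_metricE q; set G := metric_in_coord _ _ _ in G00 G01 G10 G11 *.
have uG : G \in unitmx by exact: (metric_in_coord_unit rg defined_chart).
have S0 : sA (q 0 1) != 0 by rewrite gt_eqF // sA_gt0.
have [I00 I01 I10 I11] := invmx2_diag uG G01 G10.
rewrite form2 I00 I01 I10 I11 G00 G11 -(sqr_sA (q 0 1)).
by field; rewrite S0.
Qed.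

Lemma defined_hamiltonian (z : rV2 * rV2) : in_coord psi (hamiltonian g U) z =
  4^-1 * (sA (z.1 0 1) * z.2 0 0 ^+ 2 + A a (z.1 0 1) * z.2 0 1 ^+ 2)
  + potential a (z.1 0 0) (z.1 0 1).
Proof.
rewrite /in_coord /hamiltonian /= UE defined_kinetic; last exact: (covector_tangent defined_chart).
by rewrite (covector_comp defined_chart).
Qed.

(** The issue is relative openness of the image. The image consists of the points off the poles at
    which [Ginv] has positive first coordinate. [Ginv] is smooth only on the punctured sphere, so
    this condition is spread to an ambient open set around each image point, and the union of these
    sets is taken. *)
Lemma defined_local_coord : local_coord (strip (R := R)) psi.
Proof.
have [sPsi [fP injP surjP] [Ginv [sG GK]]] := dPsi.
have Gpsi q : Ginv (psi q) = cyl q by rewrite GK //; exact: cyl_cylinder.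
have imS : psi @` strip (R := R) `<=` S2 (R := R) `\` [set N; S].
  by move=> _ [q _ <-]; exact: defined_range.
split; first exact: open_strip.
  split.
  - exact: smooth_on_sub defined_smooth.
  - split; first by move=> q sq; exists q.
    + move=> q q' /set_mem sq /set_mem sq' E.
      by rewrite -(cylK sq) -Gpsi E Gpsi cylK.
    + by move=> _ [q sq <-]; exists q.
  - exists (cyl_inv (R := R) \o Ginv); split; last by move=> q sq; rewrite /= Gpsi cylK.
    apply: (smooth_on_comp (finite_basis_row R 3) (Y := [set x : rV3 | 0 < x 0 0])).
    + by move=> _ [_ [q sq <-] <-]; rewrite Gpsi /= /cyl vec3E; exact: cos_strip_gt0.
    + exact: smooth_on_sub sG.
    + apply: (Ck_smooth_on (@open_coord_gt R 3 0 0)) => // k; exact: Ck_cyl_inv.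
have pick y : exists B : set rV3, (psi @` strip (R := R)) y -> [/\ open B, B y &
    forall y', (S2 (R := R) `\` [set N; S]) y' -> B y' -> 0 < Ginv y' 0 0].
  have [im|nim] := pselect ((psi @` strip (R := R)) y); last by exists setT.
  have nb : nbhs (Ginv y) [set x : rV3 | 0 < x 0 0].
    apply: open_nbhs_nbhs; split; first exact: (@open_coord_gt R 3 0 0).
    by move: im => [q sq <-]; rewrite Gpsi /= /cyl vec3E; exact: cos_strip_gt0.
  have [B [oB By BP]] := smooth_on_preimage sG (imS _ im) nb.
  by exists B => _; split.
have [B BP] := choice pick.
exists (\bigcup_(y in psi @` strip (R := R)) (B y `&` ~` [set N; S])).
have clNS : closed [set N; S].
  by apply: closedU; apply: accessible_closed_set1; exact: hausdorff_accessible.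
split.
  apply: bigcup_open => y im; apply: openI; first by have [] := BP y im.
  exact: closed_openC.
apply/seteqP; split=> y.
  move=> im; have [Sy Ny] := imS _ im; split=> //; exists y => //; split=> //.
  by have [] := BP y im.
move=> [Sy [y0 im0 [By Ny]]]; have [_ _ /(_ y (conj Sy Ny) By)] := BP y0 im0.
have [x cx <-] := surjP y (conj Sy Ny); rewrite GK // => x0.
by exists (cyl_inv x); [exact: cyl_inv_strip|rewrite /psi /= cyl_invK].
Qed.

End DefinedBy.

(** * Killing equations *)

Section OneVariable.
Variable R : realType.
Implicit Types (f g : R -> R) (x y : R).

Lemma is_derive_unique f x (d d' : R) : is_derive x 1 f d -> is_derive x 1 f d' -> d = d'.
Proof. by move=> [_ <-] [_ <-]. Qed.

Lemma is_derive_add1 f g x (df dg : R) : is_derive x 1 f df -> is_derive x 1 g dg ->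
  is_derive x 1 (fun t => f t + g t) (df + dg).
Proof. by move=> ? ?; exact: is_deriveD. Qed.

Lemma is_derive_sub1 f g x (df dg : R) : is_derive x 1 f df -> is_derive x 1 g dg ->
  is_derive x 1 (fun t => f t - g t) (df - dg).
Proof. by move=> ? ?; exact: is_deriveB. Qed.

Lemma is_derive_mul1 f g x (df dg : R) : is_derive x 1 f df -> is_derive x 1 g dg ->
  is_derive x 1 (fun t => f t * g t) (f x * dg + g x * df).
Proof. by move=> ? ?; exact: is_deriveM. Qed.

Lemma is_derive_Zl1 (c : R) f x (df : R) : is_derive x 1 f df ->
  is_derive x 1 (fun t => c * f t) (c * df).
Proof. by move=> ?; exact: is_deriveZ. Qed.

Lemma is_derive_div1 f g x (df dg : R) : g x != 0 -> is_derive x 1 f df -> is_derive x 1 g dg ->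
  is_derive x 1 (fun t => f t / g t) ((df * g x - f x * dg) / g x ^+ 2).
Proof.
move=> g0 Df Dg; have Dv := is_derive_mul1 Df (is_deriveV g0 Dg).
by apply: is_derive_eq Dv _; rewrite -[_ *: dg]/(_ * dg); field.
Qed.

Lemma cst_on_itv f (a b : R) : (forall x, a < x < b -> is_derive x 1 f 0) ->
  forall x y, a < x < b -> a < y < b -> f x = f y.
Proof.
move=> df; suff H x y : x < y -> a < x < b -> a < y < b -> f x = f y.
  by move=> x y xab yab; have [/H->|/H->|->] := ltgtP x y.
move=> xy /andP[ax xb] /andP[ay yb].
have sub z : x <= z <= y -> a < z < b.
  by move=> /andP[xz zy]; rewrite (lt_le_trans ax) //= (le_lt_trans zy).
have [||c _] := @MVT R f (fun=> 0) x y xy.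
- by move=> z; rewrite in_itv /= => /andP[/ltW xz /ltW zy]; apply: df; apply: sub; rewrite xz.
- apply: derivable_within_continuous => z; rewrite in_itv /= => zxy.
  by have [] := df z (sub z zxy).
- by rewrite mul0r => /subr0_eq.
Qed.

(** On an explicit list [horner_rec] simplifies by computation, and single coefficients are read off
    with [nth]. A nonzero polynomial has fewer roots than its size [n], and [pt] provides [n]
    distinct points of the interval. *)
Lemma horner_rec_itv (s : seq R) (a b : R) : a < b ->
  (forall x, a < x < b -> horner_rec s x = 0) -> forall i, s`_i = 0.
Proof.
move=> ab H i; suff P0 : Poly s = 0 by have := coef_Poly s i; rewrite P0 coef0.
apply/eqP; apply: contraT => P0; set p := Poly s in P0.
pose n := size p; pose pt (j : nat) := a + (b - a) * (j.+1%:R / n.+1%:R).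
have n0 : (0 : R) < n.+1%:R by rewrite ltr0n.
have inj : injective pt.
  move=> j k /addrI /mulfI; rewrite subr_eq0 gt_eqF // => /(_ isT) /mulIf.
  rewrite invr_eq0 gt_eqF // => /(_ isT) /eqP; rewrite eqr_nat => /eqP; by case.
have := @max_poly_roots _ p [seq pt j | j <- iota 0 n] P0.
rewrite map_inj_uniq // iota_uniq size_map size_iota ltnn => H'.
have /H' : all (root p) [seq pt j | j <- iota 0 n].
  apply/allP => _ /mapP[j +] ->; rewrite mem_iota add0n => /andP[_ jn].
  have t0 : (0 : R) < j.+1%:R / n.+1%:R by rewrite divr_gt0 // ltr0n.
  have t1 : (j.+1%:R / n.+1%:R : R) < 1 by rewrite ltr_pdivrMr // mul1r ltr_nat ltnS.
  rewrite /root horner_Poly H // ltrDl mulr_gt0 ?subr_gt0 //=.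
  by rewrite -ltrBrDl gtr_pMr ?subr_gt0.
by move=> /(_ isT).
Qed.

End OneVariable.

Section LocalIntegrals.
Variables (R : realType) (a : R).
Hypotheses (a2 : -2 < a) (a_neq2 : a <> 2).

Definition rtA (u : R) : R := Num.sqrt (A a u).
Definition rtA' (u : R) : R := (a * u + 2 * u ^+ 3) / rtA u.

Lemma rtA_gt0 u : 0 < rtA u. Proof. by rewrite sqrtr_gt0 A_gt0. Qed.

Lemma rtA_neq0 u : rtA u != 0. Proof. by rewrite gt_eqF // rtA_gt0. Qed.

Lemma sqr_rtA u : rtA u ^+ 2 = A a u. Proof. by rewrite sqr_sqrtr // ltW // A_gt0. Qed.

Lemma is_derive_A (u : R) : is_derive u 1 (A a) (2 * rtA u * rtA' u).
Proof.
have h1 : is_derive u 1 (@id R) 1 by exact: is_derive_id.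
have p2 := is_derive_mul1 h1 h1; have p4 := is_derive_mul1 p2 p2.
have D := is_derive_add1 (is_derive_add1 (is_derive_cst (1 : R) u 1) (is_derive_Zl1 a p2)) p4.
rewrite (_ : A a = (fun t => 1 + a * (t * t) + t * t * (t * t))).
  apply: is_derive_eq D _; rewrite /= /rtA'; field; exact: rtA_neq0.
by apply/funext => t; rewrite /A; ring.
Qed.

Lemma is_derive_rtA (u : R) : is_derive u 1 rtA (rtA' u).
Proof.
have D := @is_derive1_comp R Num.sqrt (A a) u _ _ (is_derive1_sqrt (A_gt0 a2 u)) (is_derive_A u).
by apply: is_derive_eq D _; rewrite -/(rtA u); field; exact: rtA_neq0.
Qed.

Lemma rtAN u : rtA (- u) = rtA u.
Proof.
have E : A a (- u) = A a u by rewrite /A; ring.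
by rewrite /rtA E.
Qed.

Lemma rtA'N u : rtA' (- u) = - rtA' u.
Proof. by rewrite /rtA' rtAN; field; exact: rtA_neq0. Qed.

Lemma sqr_neq4 : a ^+ 2 <> 4.
Proof.
move=> h; have : (a - 2) * (a + 2) = 0 by transitivity (a ^+ 2 - 4); [ring|rewrite h subrr].
move=> /eqP; rewrite mulf_eq0 subr_eq0 => /orP[/eqP//|].
by rewrite gt_eqF // -ltrBlDr sub0r.
Qed.

(* If [sqrt A] had an affine derivative it would be a quadratic polynomial,
   so that [A] would be a perfect square. *)
Lemma rtA'_not_affine (u1 u2 k l : R) : u1 < u2 ->
  ~ (forall u, u1 < u < u2 -> rtA' u = k * u + l).
Proof.
move=> u12 H.
(* The coefficients of [(a u + 2 u^3)^2 - (k u + l)^2 A], constant term first. Those of degree 0, 6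
   and 2 give [l = 0], [k^2 = 4] and [a^2 = 4]. *)
pose s : seq R := [:: - l ^+ 2; - 2 * k * l; a ^+ 2 - k ^+ 2 - a * l ^+ 2; - 2 * a * k * l;
  4 * a - a * k ^+ 2 - l ^+ 2; - 2 * k * l; 4 - k ^+ 2].
have Z : forall i, s`_i = 0.
  apply: (horner_rec_itv u12) => u uu; rewrite /s /=.
  have E : a * u + 2 * u ^+ 3 = (k * u + l) * rtA u.
    by rewrite -H // /rtA'; field; exact: rtA_neq0.
  transitivity ((a * u + 2 * u ^+ 3) ^+ 2 - (k * u + l) ^+ 2 * A a u); first by rewrite /A; ring.
  by rewrite E exprMn sqr_rtA subrr.
have := Z 0; have := Z 2; have := Z 6; rewrite /s /= => z6 z2 z0.
apply: sqr_neq4; have l0 : l ^+ 2 = 0 by apply/eqP; rewrite -oppr_eq0 z0.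
by move: z2; rewrite l0 mulr0 subr0; lra.
Qed.

(** The even part of the Killing tensor equations would force this relation. Multiplied by [rtA] and
    squared, it becomes a polynomial identity whose coefficients of degree 2 and 8 give [k = a] and
    [k^2 = 4]. *)
Lemma rtA_even_relation (k : R) :
  ~ (forall u, 0 < u < 1 -> 2^-1 * u * rtA' u + rtA u - 1 = k * u ^+ 2).
Proof.
move=> H.
pose s : seq R := [:: 0; 0; 2 * k - 2 * a; 0; k ^+ 2 + 2 * a * k + 1 - 4 - (9 / 4) * a ^+ 2; 0;
  a * k ^+ 2 + 2 * k - 6 * a; 0; k ^+ 2 - 4].
have Z : forall i, s`_i = 0.
  apply: (horner_rec_itv ltr01) => u uu; rewrite /s /=.
  have E : rtA u * (1 + k * u ^+ 2) = 1 + 3 / 2 * a * u ^+ 2 + 2 * u ^+ 4.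
    rewrite -(H u uu); transitivity (2^-1 * u * (rtA' u * rtA u) + rtA u ^+ 2); first by ring.
    by rewrite sqr_rtA /rtA' divfK ?rtA_neq0 // /A; field.
  transitivity ((rtA u * (1 + k * u ^+ 2)) ^+ 2 - (1 + 3 / 2 * a * u ^+ 2 + 2 * u ^+ 4) ^+ 2).
    by rewrite exprMn sqr_rtA /A; field.
  by rewrite E subrr.
have := Z 2; have := Z 8; rewrite /s /= => z8 z2.
have ak : a = k by lra.
by apply: sqr_neq4; rewrite ak; lra.
Qed.

(** Existence of the partial derivatives is all that is asked, without continuity: the Killing
    equations are solved by arguments in one variable. *)
Definition partials (x1 x2 y1 y2 : R) (c cx cy : R -> R -> R) :=
  forall x y, x1 < x < x2 -> y1 < y < y2 ->
    is_derive x 1 (c^~ y) (cx x y) /\ is_derive y 1 (c x) (cy x y).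

Lemma partials_cst x1 x2 y1 y2 (c cx cy : R -> R -> R) : partials x1 x2 y1 y2 c cx cy ->
  (forall x y, x1 < x < x2 -> y1 < y < y2 -> cx x y = 0 /\ cy x y = 0) ->
  forall x y x' y', x1 < x < x2 -> y1 < y < y2 -> x1 < x' < x2 -> y1 < y' < y2 -> c x y = c x' y'.
Proof.
move=> pc c0 x y x' y' hx hy hx' hy'; transitivity (c x' y).
  apply: (@cst_on_itv R (c^~ y) x1 x2) => // z hz.
  by have [d _] := pc z y hz hy; have [<- _] := c0 z y hz hy.
apply: (@cst_on_itv R (c x') y1 y2) => // z hz.
by have [_ d] := pc x' z hx' hz; have [_ <-] := c0 x' z hx' hz.
Qed.

Lemma near_itv (x1 x2 x : R) (P : R -> Prop) : x1 < x < x2 -> (forall y, x1 < y < x2 -> P y) ->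
  \forall y \near x, P y.
Proof.
move=> /andP[h1 h2] H; near=> y; apply: H; apply/andP; split; near: y.
  exact: lt_nbhsr.
exact: lt_nbhsl.
Unshelve. all: by end_near. Qed.

Lemma is_derive_eq_itv (x1 x2 x : R) (f g : R -> R) (d : R) : x1 < x < x2 ->
  (forall y, x1 < y < x2 -> f y = g y) -> is_derive x 1 f d -> is_derive x 1 g d.
Proof. by move=> hx fg; apply: near_eq_is_derive; exact: near_itv hx fg. Qed.

(* The Killing equations of the metric [dphi^2 / rtA + du^2 / rtA^2]. *)
Lemma is_derive_eq0_itv (x1 x2 x : R) (f : R -> R) (d : R) : x1 < x < x2 ->
  (forall y, x1 < y < x2 -> f y = 0) -> is_derive x 1 f d -> d = 0.
Proof.
move=> hx f0 df; apply: (is_derive_unique df).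
by apply: (is_derive_eq_itv hx _ (is_derive_cst (0 : R) x 1)) => y hy; rewrite f0.
Qed.

(** The equations say that [mu p0 + nu p1] commutes with the kinetic energy. The third gives
    [nu = rtA y * N x], the second makes [mu] affine in [y] with slope [- N'], and by the first
    [rtA' * N] is then affine in [y]. Hence [N = 0]. *)
Lemma killing_linear x1 x2 y1 y2 (mu mux muy nu nux nuy : R -> R -> R) :
  partials x1 x2 y1 y2 mu mux muy -> partials x1 x2 y1 y2 nu nux nuy -> y1 < y2 ->
  (forall x y, x1 < x < x2 -> y1 < y < y2 ->
    [/\ 2^-1 * rtA y * mux x y = 4^-1 * rtA' y * nu x y,
        2^-1 * rtA y * nux x y + 2^-1 * A a y * muy x y = 0 &
        2^-1 * A a y * nuy x y = 2^-1 * rtA y * rtA' y * nu x y]) ->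
  (forall x y, x1 < x < x2 -> y1 < y < y2 -> nu x y = 0) /\
  (forall x y x' y', x1 < x < x2 -> y1 < y < y2 -> x1 < x' < x2 -> y1 < y' < y2 ->
     mu x y = mu x' y').
Proof.
move=> pmu pnu y12 K.
pose y0 := (y1 + y2) / 2; pose y3 := (y0 + y2) / 2.
have h0 : y1 < y0 < y2 by rewrite /y0; apply/andP; split; lra.
have h3 : y1 < y3 < y2 by rewrite /y3 /y0; apply/andP; split; lra.
have y30 : y3 - y0 != 0 by rewrite gt_eqF // subr_gt0 /y3 /y0; lra.
pose N x := nu x y0 / rtA y0.
pose N' x := nux x y0 / rtA y0.
have nuE x y : x1 < x < x2 -> y1 < y < y2 -> nu x y = rtA y * N x.
  move=> hx hy; suff -> : N x = nu x y / rtA y by field; exact: rtA_neq0.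
  apply: (@cst_on_itv R (fun y => nu x y / rtA y) y1 y2) => // z hz.
  have [_ d] := pnu x z hx hz; have [_ _ k3] := K x z hx hz.
  apply: is_derive_eq (is_derive_div1 (rtA_neq0 z) d (is_derive_rtA z)) _.
  have -> : nuy x z * rtA z - nu x z * rtA' z = 2 / rtA z * (2^-1 * A a z * nuy x z
     - 2^-1 * rtA z * rtA' z * nu x z) by rewrite -sqr_rtA; field; exact: rtA_neq0.
  by rewrite k3 subrr mulr0 mul0r.
have nuxE x y : x1 < x < x2 -> y1 < y < y2 -> nux x y = rtA y * N' x.
  move=> hx hy; have [d _] := pnu x y hx hy; apply: (is_derive_unique d).
  apply: (@is_derive_eq_itv x1 x2 x (fun t => rtA y * N t) _ _ hx).
    by move=> t ht; rewrite nuE.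
  apply: is_derive_Zl1; have [d0 _] := pnu x y0 hx h0.
  have := is_derive_Zl1 (rtA y0)^-1 d0; rewrite /N /N'.
  rewrite (_ : (fun t => (rtA y0)^-1 * nu t y0) = (fun t => nu t y0 / rtA y0)).
    by move=> d1; apply: is_derive_eq d1 _; rewrite mulrC.
  by apply/funext => t; rewrite mulrC.
have muyE x y : x1 < x < x2 -> y1 < y < y2 -> muy x y = - N' x.
  move=> hx hy; have [_ k2 _] := K x y hx hy; rewrite nuxE // in k2.
  have A0 : A a y != 0 by rewrite -sqr_rtA expf_neq0 // rtA_neq0.
  apply: (mulfI A0); move: k2; rewrite -sqr_rtA => k2.
  have : 2 * (2^-1 * rtA y * (rtA y * N' x) + 2^-1 * rtA y ^+ 2 * muy x y) = 0 by rewrite k2 mulr0.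
  move=> E; by apply/eqP; rewrite -subr_eq0 -E; apply/eqP; field.
have muE x y : x1 < x < x2 -> y1 < y < y2 -> mu x y = mu x y0 - N' x * (y - y0).
  move=> hx hy; suff : mu x y + N' x * (y - y0) = mu x y0 + N' x * (y0 - y0).
    by rewrite subrr mulr0 addr0 => <-; rewrite addrK.
  apply: (@cst_on_itv R (fun y => mu x y + N' x * (y - y0)) y1 y2) => // z hz.
  have [_ d] := pmu x z hx hz; rewrite muyE // in d.
  have d1 := is_derive_sub1 (is_derive_id z (1 : R)) (is_derive_cst y0 z 1).
  by apply: is_derive_eq (is_derive_add1 d (is_derive_Zl1 (N' x) d1)) _; ring.
(* [N'] is a difference quotient of [mu] between the heights [y0] and [y3], hence differentiable
   although no second derivative of [nu] is given. *)
pose N'' x := (mux x y0 - mux x y3) / (y3 - y0).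
have N'd x : x1 < x < x2 -> is_derive x 1 N' (N'' x).
  move=> hx; have [d0 _] := pmu x y0 hx h0; have [d3 _] := pmu x y3 hx h3.
  apply: (@is_derive_eq_itv x1 x2 x (fun t => (y3 - y0)^-1 * (mu t y0 - mu t y3)) _ _ hx).
    by move=> t ht; rewrite (muE t y3) //; field.
  by apply: is_derive_eq (is_derive_Zl1 _ (is_derive_sub1 d0 d3)) _; rewrite mulrC.
have N0 x : x1 < x < x2 -> N x = 0.
  move=> hx; apply: contrapT => /eqP Nx.
  pose k := - 2 * N'' x / N x.
  apply: (@rtA'_not_affine y1 y2 k (rtA' y0 - k * y0) y12) => y hy.
  have muxE : mux x y = mux x y0 - N'' x * (y - y0).
    have [d _] := pmu x y hx hy; apply: (is_derive_unique d).
    apply: (@is_derive_eq_itv x1 x2 x (fun t => mu t y0 - (y - y0) * N' t) _ _ hx).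
      by move=> t ht; rewrite (muE t y) // mulrC.
    have [d0 _] := pmu x y0 hx h0.
    by apply: is_derive_eq (is_derive_sub1 d0 (is_derive_Zl1 _ (N'd x hx))) _; rewrite mulrC.
  have mE z : y1 < z < y2 -> mux x z = 2^-1 * rtA' z * N x.
    move=> hz; have [k1 _ _] := K x z hx hz; rewrite nuE // in k1.
    apply: (mulfI (rtA_neq0 z)); have : 2 * (2^-1 * rtA z * mux x z) = 2 * (4^-1 * rtA' z * (rtA z * N x)).
      by rewrite k1.
    by move=> E; transitivity (2 * (2^-1 * rtA z * mux x z)); [by field|rewrite E; by field].
  rewrite !mE // in muxE; apply: (mulIf Nx); rewrite /k.
  transitivity (2 * (2^-1 * rtA' y * N x)); first by field.
  by rewrite muxE; field.
split=> [x y hx hy|]; first by rewrite nuE // N0 // mulr0.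
apply: (partials_cst pmu) => x y hx hy; split.
  have [k1 _ _] := K x y hx hy; rewrite nuE // N0 // !mulr0 in k1.
  by apply/eqP; move/eqP: k1; rewrite mulf_eq0 mulf_eq0 invr_eq0 pnatr_eq0 (negbTE (rtA_neq0 y)).
rewrite muyE //; have : nux x y0 = 0.
  have [d _] := pnu x y0 hx h0; apply: (is_derive_eq0_itv hx _ d).
  by move=> t ht; rewrite nuE // N0 // mulr0.
by rewrite /N' => ->; rewrite mul0r oppr0.
Qed.

Lemma rtA0 : rtA 0 = 1.
Proof.
have E : A a 0 = 1 by rewrite /A; ring.
by rewrite /rtA E sqrtr1.
Qed.

Lemma rtA'0 : rtA' 0 = 0.
Proof. by rewrite /rtA' rtA0; field. Qed.

(* The equations for a Killing tensor of the metric
   [dphi^2 / rtA + du^2 / rtA^2]. *)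
Lemma killing_quadratic x1 x2 (al alx aly be bex bey ga gax gay : R -> R -> R) :
  partials x1 x2 (-2) 2 al alx aly -> partials x1 x2 (-2) 2 be bex bey ->
  partials x1 x2 (-2) 2 ga gax gay ->
  (forall x y : R, x1 < x < x2 -> -2 < y < 2 ->
    [/\ 2^-1 * rtA y * alx x y = 4^-1 * rtA' y * be x y,
        2^-1 * rtA y * bex x y + 2^-1 * A a y * aly x y = 2^-1 * rtA' y * ga x y,
        2^-1 * rtA y * gax x y + 2^-1 * A a y * bey x y = 2^-1 * rtA y * rtA' y * be x y &
        2^-1 * A a y * gay x y = rtA y * rtA' y * ga x y]) ->
  exists c d : R, forall x y : R, x1 < x < x2 -> -2 < y < 2 ->
    [/\ al x y = c * rtA y + d, be x y = 0 & ga x y = c * A a y].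
Proof.
move=> pal pbe pga K.
have [|x12] := leP x2 x1.
  move=> x21; exists 0, 0 => x y /andP[h1 h2]; have := lt_trans h1 h2.
  by rewrite ltNge x21.
have i0 : -2 < (0 : R) < 2 by apply/andP; split; lra.
have i1 : -2 < (1 : R) < 2 by apply/andP; split; lra.
have im1 : -2 < (-1 : R) < 2 by apply/andP; split; lra.
have Aneq0 y : A a y != 0 by rewrite -sqr_rtA expf_neq0 // rtA_neq0.
have A0 : A a 0 = 1 by rewrite /A; ring.
pose G x := ga x 0; pose G1 x := gax x 0.
have gaE x (y : R) : x1 < x < x2 -> -2 < y < 2 -> ga x y = A a y * G x.
  move=> hx hy; suff -> : G x = ga x y / A a y by field; exact: Aneq0.
  transitivity (ga x 0 / A a 0); first by rewrite A0 divr1.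
  apply: (@cst_on_itv R (fun y => ga x y / A a y) (-2) 2) => // z hz.
  have [_ d] := pga x z hx hz; have [_ _ _ k4] := K x z hx hz.
  apply: is_derive_eq (is_derive_div1 (Aneq0 z) d (is_derive_A z)) _.
  have -> : gay x z * A a z - ga x z * (2 * rtA z * rtA' z) =
    2 * (2^-1 * A a z * gay x z - rtA z * rtA' z * ga x z) by field.
  by rewrite k4 subrr mulr0 mul0r.
have gaxE x (y : R) : x1 < x < x2 -> -2 < y < 2 -> gax x y = A a y * G1 x.
  move=> hx hy; have [d _] := pga x y hx hy; apply: (is_derive_unique d).
  apply: (@is_derive_eq_itv x1 x2 x (fun t => A a y * G t) _ _ hx).
    by move=> t ht; rewrite gaE.
  by apply: is_derive_Zl1; have [d0 _] := pga x 0 hx i0.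
pose B x := be x 0; pose B1 x := bex x 0.
have beE x (y : R) : x1 < x < x2 -> -2 < y < 2 -> be x y = rtA y * (B x - y * G1 x).
  move=> hx hy; suff : be x y / rtA y + G1 x * y = be x 0 / rtA 0 + G1 x * 0.
    rewrite rtA0 divr1 mulr0 addr0 -/(B x) => <-; field; exact: rtA_neq0.
  apply: (@cst_on_itv R (fun y => be x y / rtA y + G1 x * y) (-2) 2) => // z hz.
  have [_ d] := pbe x z hx hz; have [_ _ k3 _] := K x z hx hz; rewrite gaxE // in k3.
  have d1 := is_derive_Zl1 (G1 x) (is_derive_id z (1 : R)).
  apply: is_derive_eq (is_derive_add1 (is_derive_div1 (rtA_neq0 z) d (is_derive_rtA z)) d1) _.
  transitivity ((rtA z ^+ 3)^-1 * 2 * (2^-1 * rtA z * (A a z * G1 x) + 2^-1 * A a z * bey x z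
     - 2^-1 * rtA z * rtA' z * be x z)).
    by rewrite -sqr_rtA; field; exact: rtA_neq0.
  by rewrite k3 subrr mulr0.
(* Again second derivatives are not given: [G1] is a combination of [be] at the heights 0 and 1, and
   below [B1] and [G2] are expressed by [al] at -1, 0 and 1 and by [G]. The range [-2 < y < 2]
   contains these heights. *)
pose G2 x := B1 x - bex x 1 / rtA 1.
have G1d x : x1 < x < x2 -> is_derive x 1 G1 (G2 x).
  move=> hx; have [d0 _] := pbe x 0 hx i0; have [d1 _] := pbe x 1 hx i1.
  apply: (@is_derive_eq_itv x1 x2 x (fun t => be t 0 - (rtA 1)^-1 * be t 1) _ _ hx).
    by move=> t ht; rewrite (beE t 1) // /B; field; exact: rtA_neq0.
  by apply: is_derive_eq (is_derive_sub1 d0 (is_derive_Zl1 _ d1)) _; rewrite /G2 [bex x 1 / _]mulrC.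
have bexE x (y : R) : x1 < x < x2 -> -2 < y < 2 -> bex x y = rtA y * (B1 x - y * G2 x).
  move=> hx hy; have [d _] := pbe x y hx hy; apply: (is_derive_unique d).
  apply: (@is_derive_eq_itv x1 x2 x (fun t => rtA y * (B t - y * G1 t)) _ _ hx).
    by move=> t ht; rewrite beE.
  apply: is_derive_Zl1; apply: is_derive_sub1; last exact: is_derive_Zl1 (G1d x hx).
  by have [d0 _] := pbe x 0 hx i0.
have alyE x (y : R) : x1 < x < x2 -> -2 < y < 2 -> aly x y = G x * rtA' y - B1 x + y * G2 x.
  move=> hx hy; have [_ k2 _ _] := K x y hx hy; rewrite bexE // gaE // in k2.
  apply: (mulfI (Aneq0 y)); apply/eqP; rewrite -subr_eq0; apply/eqP.
  transitivity (2 * (2^-1 * rtA y * (rtA y * (B1 x - y * G2 x)) + 2^-1 * A a y * aly x y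
     - 2^-1 * rtA' y * (A a y * G x))); first by rewrite -sqr_rtA; field.
  by rewrite k2 subrr mulr0.
have alE x (y : R) : x1 < x < x2 -> -2 < y < 2 ->
    al x y = al x 0 + G x * (rtA y - 1) - B1 x * y + 2^-1 * G2 x * (y * y).
  move=> hx hy.
  suff : al x y - G x * rtA y + B1 x * y - 2^-1 * G2 x * (y * y) =
         al x 0 - G x * rtA 0 + B1 x * 0 - 2^-1 * G2 x * (0 * 0).
    rewrite rtA0 !mulr0 !addr0 subr0 mulr1 => E.
    transitivity (al x 0 - G x + G x * rtA y - B1 x * y + 2^-1 * G2 x * (y * y)); last by ring.
    by rewrite -E; ring.
  apply: (@cst_on_itv R (fun y => al x y - G x * rtA y + B1 x * y - 2^-1 * G2 x * (y * y)) (-2) 2)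
    => // z hz.
  have [_ d] := pal x z hx hz; rewrite alyE // in d.
  have i := is_derive_id z (1 : R).
  have d1 := is_derive_sub1 (is_derive_add1 (is_derive_sub1 d (is_derive_Zl1 (G x) (is_derive_rtA z)))
    (is_derive_Zl1 (B1 x) i)) (is_derive_Zl1 (2^-1 * G2 x) (is_derive_mul1 i i)).
  by apply: is_derive_eq d1 _; field.
have alxE x (y : R) : x1 < x < x2 -> -2 < y < 2 -> alx x y = 2^-1 * rtA' y * (B x - y * G1 x).
  move=> hx hy; have [k1 _ _ _] := K x y hx hy; rewrite beE // in k1.
  apply: (mulfI (rtA_neq0 y)); apply/eqP; rewrite -subr_eq0; apply/eqP.
  transitivity (2 * (2^-1 * rtA y * alx x y - 4^-1 * rtA' y * (rtA y * (B x - y * G1 x)))).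
    by field.
  by rewrite k1 subrr mulr0.
have alx0 x : x1 < x < x2 -> alx x 0 = 0 by move=> hx; rewrite alxE // rtA'0 mulr0 mul0r.
pose B2 x := 2^-1 * (alx x (-1) - alx x 1).
have B1d x : x1 < x < x2 -> is_derive x 1 B1 (B2 x).
  move=> hx; have [d0 _] := pal x (-1) hx im1; have [d1 _] := pal x 1 hx i1.
  apply: (@is_derive_eq_itv x1 x2 x (fun t => 2^-1 * (al t (-1) - al t 1)) _ _ hx).
    by move=> t ht; rewrite (alE t 1) // (alE t (-1)) // rtAN; field.
have Gd x : x1 < x < x2 -> is_derive x 1 G (G1 x) by move=> hx; have [] := pga x 0 hx i0.
pose G3 x := alx x (-1) + alx x 1 - 2 * alx x 0 - 2 * (rtA 1 - 1) * G1 x.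
have G2d x : x1 < x < x2 -> is_derive x 1 G2 (G3 x).
  move=> hx; have [d0 _] := pal x (-1) hx im1; have [d1 _] := pal x 1 hx i1.
  have [d2 _] := pal x 0 hx i0.
  apply: (@is_derive_eq_itv x1 x2 x
    (fun t => al t (-1) + al t 1 - 2 * al t 0 - 2 * (rtA 1 - 1) * G t) _ _ hx).
    by move=> t ht; rewrite (alE t 1) // (alE t (-1)) // rtAN; field.
  apply: is_derive_sub1 (is_derive_Zl1 _ (Gd x hx)).
(* Two formulas for [alx]: the first Killing equation, and [alE] differentiated in [x]. With [relN],
   the same relation at [- y], the difference makes [rtA'] linear unless [B = 0], and the sum is the
   relation excluded by [rtA_even_relation] unless [G1 = 0]. *)
have rel x (y : R) : x1 < x < x2 -> -2 < y < 2 -> 2^-1 * rtA' y * (B x - y * G1 x) =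
    (rtA y - 1) * G1 x - y * B2 x + 2^-1 * (y * y) * G3 x.
  move=> hx hy; rewrite -alxE //; have [d _] := pal x y hx hy; apply: (is_derive_unique d).
  apply: (@is_derive_eq_itv x1 x2 x
    (fun t => al t 0 + (rtA y - 1) * G t - y * B1 t + 2^-1 * (y * y) * G2 t) _ _ hx).
    by move=> t ht; rewrite (alE t y) //; ring.
  have [d0 _] := pal x 0 hx i0; rewrite alx0 // in d0.
  have dd := is_derive_add1 (is_derive_sub1 (is_derive_add1 d0 (is_derive_Zl1 (rtA y - 1) (Gd x hx)))
    (is_derive_Zl1 y (B1d x hx))) (is_derive_Zl1 (2^-1 * (y * y)) (G2d x hx)).
  by apply: is_derive_eq dd _; rewrite add0r.
have relN x (y : R) : x1 < x < x2 -> -2 < y < 2 -> - 2^-1 * rtA' y * (B x + y * G1 x) =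
    (rtA y - 1) * G1 x + y * B2 x + 2^-1 * (y * y) * G3 x.
  move=> hx /andP[hy1 hy2]; have hy : -2 < - y < 2 by apply/andP; split; lra.
  transitivity (2^-1 * rtA' (- y) * (B x - (- y) * G1 x)); first by rewrite rtA'N; ring.
  by rewrite rel // rtAN; ring.
have B0 x : x1 < x < x2 -> B x = 0.
  move=> hx; apply: contrapT => /eqP Bx.
  apply: (@rtA'_not_affine 0 1 (- 2 * B2 x / B x) 0 ltr01) => y /andP[y0 y1].
  have hy : -2 < y < 2 by apply/andP; split; lra.
  have r := rel x y hx hy; have rN := relN x y hx hy.
  apply: (mulIf Bx); transitivity (2^-1 * rtA' y * (B x - y * G1 x)
    - - 2^-1 * rtA' y * (B x + y * G1 x)); first by field.
  by rewrite r rN; field.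
have G10 x : x1 < x < x2 -> G1 x = 0.
  move=> hx; apply: contrapT => /eqP Gx.
  apply: (@rtA_even_relation (- 2^-1 * G3 x / G1 x)) => y /andP[y0 y1].
  have hy : -2 < y < 2 by apply/andP; split; lra.
  have r := rel x y hx hy; have rN := relN x y hx hy.
  apply: (mulIf Gx); transitivity ((rtA y - 1) * G1 x - 2^-1 * (2^-1 * rtA' y * (B x - y * G1 x)
    + - 2^-1 * rtA' y * (B x + y * G1 x))); first by field.
  by rewrite r rN; field.
have G20 x : x1 < x < x2 -> G2 x = 0 by move=> hx; exact: is_derive_eq0_itv hx G10 (G1d x hx).
have B10 x : x1 < x < x2 -> B1 x = 0.
  by move=> hx; have [d _] := pbe x 0 hx i0; exact: is_derive_eq0_itv hx B0 d.
pose x0 := (x1 + x2) / 2.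
have h0 : x1 < x0 < x2 by rewrite /x0; apply/andP; split; lra.
exists (G x0), (al x0 0 - G x0) => x y hx hy.
have GE : G x = G x0.
  by apply: (@cst_on_itv R G x1 x2) => // z hz; rewrite -(G10 z hz); exact: Gd.
have alE0 : al x 0 = al x0 0.
  apply: (@cst_on_itv R (al^~ 0) x1 x2) => // z hz; have [d _] := pal z 0 hz i0.
  by rewrite alx0 // in d.
split.
- by rewrite alE // B10 // G20 // GE alE0; ring.
- by rewrite beE // B0 // G10 // mulr0 subrr mulr0.
- by rewrite gaE // GE mulrC.
Qed.

End LocalIntegrals.

(** * Derivatives in the coordinates (phi, u, p0, p1) *)

Section PhaseSpace.
Variable R : realType.
Local Notation rV2 := 'rV[R]_2.
Local Notation e := (fun i : 'I_2 => delta_mx 0 i : rV2).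

Lemma derive_along (V : normedModType R) (f : V -> R) (b v : V) (k : R -> R) (x d : R) :
  (forall t, f (t *: v + b) = k (t + x)) -> is_derive x 1 k d -> 'D_v f b = d.
Proof.
move=> fk [_ <-]; have f0 : f b = k x by rewrite -[b in LHS](add0r b) -(scale0r v) fk add0r.
rewrite /derive.
have -> : (fun h : R => h^-1 *: ((f \o shift b) (h *: v) - f b)) =
          (fun h : R => h^-1 *: ((k \o shift x) (h *: (1 : R)) - k x)) => //.
by apply/funext => t /=; rewrite fk f0 -[t *: (1 : R)]/(t * 1) mulr1.
Qed.

Definition phase (f : rV2 * rV2 -> R) (x y p0 p1 : R) := f (vec2 x y, vec2 p0 p1).

Lemma pair_shift (t : R) (u u' v v' : rV2) :
  (t *: (u, v) + (u', v') : rV2 * rV2) = (t *: u + u', t *: v + v').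
Proof. by []. Qed.

Lemma vec2_shift0 (t x y : R) : t *: e 0 + vec2 x y = vec2 (t + x) y.
Proof. by apply: row2P; rewrite !mxE /= ?mulr1 ?mulr0 ?add0r. Qed.

Lemma vec2_shift1 (t x y : R) : t *: e 1 + vec2 x y = vec2 x (t + y).
Proof. by apply: row2P; rewrite !mxE /= ?mulr1 ?mulr0 ?add0r. Qed.

Variables (f : rV2 * rV2 -> R) (x y p0 p1 : R).

Lemma Dq0_phase d : is_derive x 1 (fun t => phase f t y p0 p1) d ->
  Dq 0 f (vec2 x y, vec2 p0 p1) = d.
Proof.
by apply: derive_along => t; rewrite pair_shift scaler0 add0r vec2_shift0.
Qed.

Lemma Dq1_phase d : is_derive y 1 (fun t => phase f x t p0 p1) d ->
  Dq 1 f (vec2 x y, vec2 p0 p1) = d.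
Proof.
by apply: derive_along => t; rewrite pair_shift scaler0 add0r vec2_shift1.
Qed.

Lemma Dp0_phase d : is_derive p0 1 (fun t => phase f x y t p1) d ->
  Dp 0 f (vec2 x y, vec2 p0 p1) = d.
Proof.
by apply: derive_along => t; rewrite pair_shift scaler0 add0r vec2_shift0.
Qed.

Lemma Dp1_phase d : is_derive p1 1 (fun t => phase f x y p0 t) d ->
  Dp 1 f (vec2 x y, vec2 p0 p1) = d.
Proof.
by apply: derive_along => t; rewrite pair_shift scaler0 add0r vec2_shift1.
Qed.

Hypothesis df : differentiable f (vec2 x y, vec2 p0 p1).

Lemma is_derive_phase0 : is_derive x 1 (fun t => phase f t y p0 p1) (Dq 0 f (vec2 x y, vec2 p0 p1)).
Proof.
have E t : (t *: (e 0, 0) + (vec2 0 y, vec2 p0 p1) : rV2 * rV2) = (vec2 t y, vec2 p0 p1).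
  by rewrite pair_shift scaler0 add0r vec2_shift0 addr0.
have df' : differentiable f (x *: (e 0, 0) + (vec2 0 y, vec2 p0 p1) : rV2 * rV2) by rewrite E.
have := is_derive_line df'; rewrite E.
by congr (is_derive _ _ _ _); apply/funext => t; rewrite E.
Qed.

Lemma is_derive_phase1 : is_derive y 1 (fun t => phase f x t p0 p1) (Dq 1 f (vec2 x y, vec2 p0 p1)).
Proof.
have E t : (t *: (e 1, 0) + (vec2 x 0, vec2 p0 p1) : rV2 * rV2) = (vec2 x t, vec2 p0 p1).
  by rewrite pair_shift scaler0 add0r vec2_shift1 addr0.
have df' : differentiable f (y *: (e 1, 0) + (vec2 x 0, vec2 p0 p1) : rV2 * rV2) by rewrite E.
have := is_derive_line df'; rewrite E.
by congr (is_derive _ _ _ _); apply/funext => t; rewrite E.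
Qed.

End PhaseSpace.

(** The values at ten well-chosen points form an invertible linear system for the ten
    coefficients. *)
Lemma cubic_zero (R : realType) (m30 m21 m12 m03 m20 m11 m02 m10 m01 m00 : R) :
  (forall p q : R, m30 * p ^+ 3 + m21 * (p ^+ 2 * q) + m12 * (p * q ^+ 2) + m03 * q ^+ 3
     + m20 * p ^+ 2 + m11 * (p * q) + m02 * q ^+ 2 + m10 * p + m01 * q + m00 = 0) ->
  [/\ m30 = 0, m21 = 0, m12 = 0, m03 = 0 & [/\ m20 = 0, m11 = 0, m02 = 0 & [/\ m10 = 0, m01 = 0 & m00 = 0]]].
Proof.
move=> H; have := H 0 0; have := H 1 0; have := H (-1) 0; have := H 2 0.
have := H 0 1; have := H 0 (-1); have := H 0 2.
have := H 1 1; have := H 1 (-1); have := H (-1) 1 => h1 h2 h3 h4 h5 h6 h7 h8 h9 h10.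
by do !split; lra.
Qed.

(** * Integrals of degree two in the strip *)

Section NoQuadraticIntegral.
Variables (R : realType) (a : R).
Hypotheses (a2 : -2 < a) (a_neq2 : a <> 2).
Local Notation rV2 := 'rV[R]_2.
Local Notation S := (rtA a).
Local Notation S' := (rtA' a).

Definition pot (y : R) : R := - (y / 2 * ((a + 2 * y ^+ 2) - 2 * S y)).
Definition pot' (y : R) : R := - (2^-1 * (a + 2 * y ^+ 2 - 2 * S y) + y / 2 * (4 * y - 2 * S' y)).

Lemma potentialE x y : potential a x y = pot y * cos x.
Proof. by rewrite /potential /pot -/(S y) mulNr. Qed.

Lemma is_derive_pot (y : R) : is_derive y 1 pot (pot' y).
Proof.
have i := is_derive_id y (1 : R).
have d1 := is_derive_sub1 (is_derive_add1 (is_derive_cst a y 1) (is_derive_Zl1 2 (is_derive_mul1 i i)))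
  (is_derive_Zl1 2 (is_derive_rtA a2 y)).
have d2 := is_derive_Zl1 (-1) (is_derive_mul1 (is_derive_Zl1 2^-1 i) d1).
rewrite (_ : pot = fun t => -1 * (2^-1 * t * (a + 2 * (t * t) - 2 * S t))).
  by apply: is_derive_eq d2 _; rewrite /pot' /=; field.
by apply/funext => t; rewrite /pot; field.
Qed.

Lemma pot0 : pot 0 = 0. Proof. by rewrite /pot mul0r mul0r oppr0. Qed.

Lemma pot1_neq0 : pot 1 <> 0.
Proof.
move=> E; have E1 : 2 * S 1 = a + 2 by move: E; rewrite /pot expr1n; lra.
have : (2 * S 1) ^+ 2 = 4 * (a + 2) by rewrite exprMn sqr_rtA // /A !expr1n; ring.
rewrite E1 => E2; have : (a + 2) * (a - 2) = 0.
  by transitivity ((a + 2) ^+ 2 - 4 * (a + 2)); [ring|rewrite E2 subrr].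
move=> /eqP; rewrite mulf_eq0 subr_eq0 => /orP[|/eqP//].
by rewrite gt_eqF // -ltrBlDr sub0r.
Qed.

Definition energy (z : rV2 * rV2) : R := 4^-1 * (S (z.1 0 1) * z.2 0 0 ^+ 2 + A a (z.1 0 1) * z.2 0 1 ^+ 2)
  + potential a (z.1 0 0) (z.1 0 1).

Lemma phase_energy x y p0 p1 :
  phase energy x y p0 p1 = 4^-1 * (S y * p0 ^+ 2 + A a y * p1 ^+ 2) + pot y * cos x.
Proof. by rewrite /phase /energy /= !vec2E potentialE. Qed.

Lemma phase_energyE : phase energy =
  fun x y p0 p1 => 4^-1 * (S y * p0 ^+ 2 + A a y * p1 ^+ 2) + pot y * cos x.
Proof. by apply/funext => x; apply/funext => y; apply/funext => p0; apply/funext => p1; exact: phase_energy. Qed.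

Lemma is_derive_energy_x (x y p0 p1 : R) :
  is_derive x 1 (fun t => phase energy t y p0 p1) (- (pot y * sin x)).
Proof.
rewrite phase_energyE.
have d := is_derive_add1 (is_derive_cst (4^-1 * (S y * p0 ^+ 2 + A a y * p1 ^+ 2)) x 1)
  (is_derive_Zl1 (pot y) (is_derive_cos x)).
by apply: is_derive_eq d _; rewrite add0r mulrN.
Qed.

Lemma is_derive_energy_y (x y p0 p1 : R) : is_derive y 1 (fun t => phase energy x t p0 p1)
  (4^-1 * (S' y * p0 ^+ 2 + 2 * S y * S' y * p1 ^+ 2) + pot' y * cos x).
Proof.
rewrite phase_energyE.
have d := is_derive_add1 (is_derive_Zl1 4^-1 (is_derive_add1 (is_derive_Zl1 (p0 ^+ 2) (is_derive_rtA a2 y))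
  (is_derive_Zl1 (p1 ^+ 2) (is_derive_A a2 y)))) (is_derive_Zl1 (cos x) (is_derive_pot y)).
rewrite (_ : (fun t => _) = fun t => 4^-1 * (p0 ^+ 2 * S t + p1 ^+ 2 * A a t) + cos x * pot t).
  by apply: is_derive_eq d _; ring.
by apply/funext => t; ring.
Qed.

Lemma is_derive_quad (c0 c1 c2 t : R) : is_derive t 1 (fun t => c0 + c1 * t + c2 * t ^+ 2) (c1 + 2 * c2 * t).
Proof.
have i := is_derive_id t (1 : R).
have d := is_derive_add1 (is_derive_add1 (is_derive_cst c0 t 1) (is_derive_Zl1 c1 i))
  (is_derive_Zl1 c2 (is_derive_mul1 i i)).
by apply: is_derive_eq d _; rewrite /id; ring.
Qed.

Lemma is_derive_energy_p0 (x y p0 p1 : R) :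
  is_derive p0 1 (fun t => phase energy x y t p1) (2^-1 * S y * p0).
Proof.
rewrite phase_energyE.
rewrite (_ : (fun t => _) = fun t => 4^-1 * (A a y * p1 ^+ 2) + pot y * cos x + 0 * t + 4^-1 * S y * t ^+ 2).
  by apply: is_derive_eq (is_derive_quad _ _ _ _) _; field.
by apply/funext => t; ring.
Qed.

Lemma is_derive_energy_p1 (x y p0 p1 : R) :
  is_derive p1 1 (fun t => phase energy x y p0 t) (2^-1 * A a y * p1).
Proof.
rewrite phase_energyE.
rewrite (_ : (fun t => _) = fun t => 4^-1 * (S y * p0 ^+ 2) + pot y * cos x + 0 * t + 4^-1 * A a y * t ^+ 2).
  by apply: is_derive_eq (is_derive_quad _ _ _ _) _; field.
by apply/funext => t; ring.
Qed.

Variables (f : rV2 * rV2 -> R) (c : nat -> nat -> rV2 -> R) (x1 x2 : R).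
Local Notation dom x y := (x1 < x < x2 -> -2 < y < 2).
Hypothesis df : forall x y p0 p1, x1 < x < x2 -> differentiable f (vec2 x y, vec2 p0 p1).
Hypothesis fE : forall x y p0 p1, x1 < x < x2 -> phase f x y p0 p1 =
  let q := vec2 x y in
  c 0 0 q + c 1 0 q * p0 + c 0 1 q * p1 + c 2 0 q * p0 ^+ 2 + c 1 1 q * (p0 * p1) + c 0 2 q * p1 ^+ 2.
Hypothesis fh : forall x y p0 p1, x1 < x < x2 -> poisson f energy (vec2 x y, vec2 p0 p1) = 0.

(** The coefficients [c] come without any regularity. Each is a fixed linear combination of the
    values of [f] at six momenta, and so inherits the differentiability of [f]. *)
Lemma coefficient_partials j k : (j + k <= 2)%N ->
  partials x1 x2 (-2) 2 (fun x y => c j k (vec2 x y))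
    (fun x y => 'D_1 (fun t => c j k (vec2 t y)) x) (fun x y => 'D_1 (fun t => c j k (vec2 x t)) y).
Proof.
move=> jk.
suff [w wE] : exists w : R -> R -> R -> R -> R -> R -> R,
    (forall x y, x1 < x < x2 -> c j k (vec2 x y) = w (phase f x y 0 0) (phase f x y 1 0)
      (phase f x y (-1) 0) (phase f x y 0 1) (phase f x y 0 (-1)) (phase f x y 1 1)) /\
    exists w0 w1 w2 w3 w4 w5 : R, forall s0 s1 s2 s3 s4 s5, w s0 s1 s2 s3 s4 s5 =
      w0 * s0 + w1 * s1 + w2 * s2 + w3 * s3 + w4 * s4 + w5 * s5.
  have [cE [w0 [w1 [w2 [w3 [w4 [w5 lw]]]]]]] := wE => x y hx hy.
  have dd (F : R -> R -> R -> R) (t : R) (D : R -> R -> R) :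
    (forall p0 p1, is_derive t 1 (F p0 p1) (D p0 p1)) ->
    derivable (fun s => w (F 0 0 s) (F 1 0 s) (F (-1) 0 s) (F 0 1 s) (F 0 (-1) s) (F 1 1 s)) t 1.
    move=> dF; rewrite (_ : (fun s => _) = fun s => w0 * F 0 0 s + w1 * F 1 0 s + w2 * F (-1) 0 s
      + w3 * F 0 1 s + w4 * F 0 (-1) s + w5 * F 1 1 s); last by apply/funext => s; rewrite lw.
    have z p0 p1 v := is_derive_Zl1 v (dF p0 p1).
    by have [] := is_derive_add1 (is_derive_add1 (is_derive_add1 (is_derive_add1 (is_derive_add1 (z 0 0 w0) (z 1 0 w1))
      (z (-1) 0 w2)) (z 0 1 w3)) (z 0 (-1) w4)) (z 1 1 w5).
  split; apply: DeriveDef => //.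
    have [] := is_derive_eq_itv hx (fun t ht => esym (cE t y ht)) (DeriveDef
       (dd (fun p0 p1 t => phase f t y p0 p1) x _ (fun p0 p1 => is_derive_phase0 (df y p0 p1 hx))) erefl) => //.
  have [] := is_derive_eq_itv hy (fun t ht => esym (cE x t hx)) (DeriveDef
       (dd (fun p0 p1 t => phase f x t p0 p1) y _ (fun p0 p1 => is_derive_phase1 (df y p0 p1 hx))) erefl) => //.
have lin w0 w1 w2 w3 w4 w5 : (forall x y, x1 < x < x2 -> c j k (vec2 x y) =
    w0 * phase f x y 0 0 + w1 * phase f x y 1 0 + w2 * phase f x y (-1) 0 + w3 * phase f x y 0 1
    + w4 * phase f x y 0 (-1) + w5 * phase f x y 1 1) ->
  exists w : R -> R -> R -> R -> R -> R -> R,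
    (forall x y, x1 < x < x2 -> c j k (vec2 x y) = w (phase f x y 0 0) (phase f x y 1 0)
      (phase f x y (-1) 0) (phase f x y 0 1) (phase f x y 0 (-1)) (phase f x y 1 1)) /\
    exists w0 w1 w2 w3 w4 w5 : R, forall s0 s1 s2 s3 s4 s5, w s0 s1 s2 s3 s4 s5 =
      w0 * s0 + w1 * s1 + w2 * s2 + w3 * s3 + w4 * s4 + w5 * s5.
  move=> H; exists (fun s0 s1 s2 s3 s4 s5 => w0 * s0 + w1 * s1 + w2 * s2 + w3 * s3 + w4 * s4 + w5 * s5).
  by split=> //; exists w0, w1, w2, w3, w4, w5.
move: j k jk lin => [|[|[|j]]] [|[|[|k]]] //= _ lin.
- by apply: (lin 1 0 0 0 0 0) => x y hx; rewrite !fE //=; field.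
- by apply: (lin 0 0 0 2^-1 (- 2^-1) 0) => x y hx; rewrite !fE //=; field.
- by apply: (lin (-1) 0 0 2^-1 2^-1 0) => x y hx; rewrite !fE //=; field.
- by apply: (lin 0 2^-1 (- 2^-1) 0 0 0) => x y hx; rewrite !fE //=; field.
- by apply: (lin 1 (-1) 0 (-1) 0 1) => x y hx; rewrite !fE //=; field.
- by apply: (lin (-1) 2^-1 2^-1 0 0 0) => x y hx; rewrite !fE //=; field.
Qed.

Let cE (j k : nat) (x y : R) := c j k (vec2 x y).
Let cx (j k : nat) (x y : R) := 'D_1 (fun t => c j k (vec2 t y)) x.
Let cy (j k : nat) (x y : R) := 'D_1 (fun t => c j k (vec2 x t)) y.

(** The bracket is a cubic in the momenta with ten coefficients: four equations for a Killing
    tensor, three for a Killing field, two for the free term, and one that couples the linear part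
    to the potential. *)
Lemma coefficient_equations (x y : R) : x1 < x < x2 -> -2 < y < 2 ->
  [/\ 2^-1 * S y * cx 2 0 x y - 4^-1 * S' y * cE 1 1 x y = 0,
      2^-1 * S y * cx 1 1 x y + 2^-1 * A a y * cy 2 0 x y - 2^-1 * S' y * cE 0 2 x y = 0,
      2^-1 * S y * cx 0 2 x y + 2^-1 * A a y * cy 1 1 x y - 2^-1 * S y * S' y * cE 1 1 x y = 0,
      2^-1 * A a y * cy 0 2 x y - S y * S' y * cE 0 2 x y = 0 &
      [/\ 2^-1 * S y * cx 1 0 x y - 4^-1 * S' y * cE 0 1 x y = 0,
          2^-1 * S y * cx 0 1 x y + 2^-1 * A a y * cy 1 0 x y = 0,
          2^-1 * A a y * cy 0 1 x y - 2^-1 * S y * S' y * cE 0 1 x y = 0 &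
      [/\ 2^-1 * S y * cx 0 0 x y + 2 * cE 2 0 x y * (pot y * sin x) - cE 1 1 x y * (pot' y * cos x) = 0,
          2^-1 * A a y * cy 0 0 x y + cE 1 1 x y * (pot y * sin x) - 2 * cE 0 2 x y * (pot' y * cos x) = 0 &
          cE 1 0 x y * (pot y * sin x) - cE 0 1 x y * (pot' y * cos x) = 0]]].
Proof.
move=> hx hy.
have P j k (jk : (j + k <= 2)%N) : is_derive x 1 (fun t => cE j k t y) (cx j k x y) /\
    is_derive y 1 (fun t => cE j k x t) (cy j k x y) := coefficient_partials jk hx hy.
have d0 p0 p1 : Dq 0 f (vec2 x y, vec2 p0 p1) = cx 0 0 x y + cx 1 0 x y * p0 + cx 0 1 x y * p1
    + cx 2 0 x y * p0 ^+ 2 + cx 1 1 x y * (p0 * p1) + cx 0 2 x y * p1 ^+ 2.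
  apply: Dq0_phase.
  have z j k v (jk : (j + k <= 2)%N) := is_derive_Zl1 v (P j k jk).1.
  have D := is_derive_add1 (is_derive_add1 (is_derive_add1 (is_derive_add1 (is_derive_add1 (P 0 0 isT).1
    (z 1 0 p0 isT)) (z 0 1 p1 isT)) (z 2 0 (p0 ^+ 2) isT)) (z 1 1 (p0 * p1) isT)) (z 0 2 (p1 ^+ 2) isT).
  apply: (is_derive_eq_itv hx _ (is_derive_eq D _)); last by ring.
  by move=> t ht; rewrite fE // /cE /=; ring.
have d1 p0 p1 : Dq 1 f (vec2 x y, vec2 p0 p1) = cy 0 0 x y + cy 1 0 x y * p0 + cy 0 1 x y * p1
    + cy 2 0 x y * p0 ^+ 2 + cy 1 1 x y * (p0 * p1) + cy 0 2 x y * p1 ^+ 2.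
  apply: Dq1_phase.
  have z j k v (jk : (j + k <= 2)%N) := is_derive_Zl1 v (P j k jk).2.
  have D := is_derive_add1 (is_derive_add1 (is_derive_add1 (is_derive_add1 (is_derive_add1 (P 0 0 isT).2
    (z 1 0 p0 isT)) (z 0 1 p1 isT)) (z 2 0 (p0 ^+ 2) isT)) (z 1 1 (p0 * p1) isT)) (z 0 2 (p1 ^+ 2) isT).
  apply: (is_derive_eq_itv hy _ (is_derive_eq D _)); last by ring.
  by move=> t ht; rewrite fE // /cE /=; ring.
have e0 p0 p1 : Dp 0 f (vec2 x y, vec2 p0 p1) = cE 1 0 x y + 2 * cE 2 0 x y * p0 + cE 1 1 x y * p1.
  apply: Dp0_phase; have D := is_derive_quad (cE 0 0 x y + cE 0 1 x y * p1 + cE 0 2 x y * p1 ^+ 2)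
    (cE 1 0 x y + cE 1 1 x y * p1) (cE 2 0 x y) p0.
  rewrite (_ : (fun t => _) = fun t => (cE 0 0 x y + cE 0 1 x y * p1 + cE 0 2 x y * p1 ^+ 2) +
    (cE 1 0 x y + cE 1 1 x y * p1) * t + cE 2 0 x y * t ^+ 2); first by apply: is_derive_eq D _; ring.
  by apply/funext => t; rewrite fE // /cE /=; ring.
have e1 p0 p1 : Dp 1 f (vec2 x y, vec2 p0 p1) = cE 0 1 x y + cE 1 1 x y * p0 + 2 * cE 0 2 x y * p1.
  apply: Dp1_phase; have D := is_derive_quad (cE 0 0 x y + cE 1 0 x y * p0 + cE 2 0 x y * p0 ^+ 2)
    (cE 0 1 x y + cE 1 1 x y * p0) (cE 0 2 x y) p1.
  rewrite (_ : (fun t => _) = fun t => (cE 0 0 x y + cE 1 0 x y * p0 + cE 2 0 x y * p0 ^+ 2) +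
    (cE 0 1 x y + cE 1 1 x y * p0) * t + cE 0 2 x y * t ^+ 2); first by apply: is_derive_eq D _; ring.
  by apply/funext => t; rewrite fE // /cE /=; ring.
have h p0 p1 := fh y p0 p1 hx.
have {}h p0 p1 : Dq 0 f (vec2 x y, vec2 p0 p1) * (2^-1 * S y * p0)
    - Dp 0 f (vec2 x y, vec2 p0 p1) * - (pot y * sin x)
    + (Dq 1 f (vec2 x y, vec2 p0 p1) * (2^-1 * A a y * p1) - Dp 1 f (vec2 x y, vec2 p0 p1) *
      (4^-1 * (S' y * p0 ^+ 2 + 2 * S y * S' y * p1 ^+ 2) + pot' y * cos x)) = 0.
  have := h p0 p1; rewrite /poisson sum2.
  by rewrite (Dq0_phase (is_derive_energy_x x y p0 p1)) (Dq1_phase (is_derive_energy_y x y p0 p1))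
    (Dp0_phase (is_derive_energy_p0 x y p0 p1)) (Dp1_phase (is_derive_energy_p1 x y p0 p1)).
apply: cubic_zero => p0 p1; have := h p0 p1; rewrite d0 d1 e0 e1 => <-; by field.
Qed.

(** The Killing lemmas leave [k] times the quadratic part of the energy, a term [d p0^2] and a
    linear term [mu p0] with constant [mu]. The equation of degree 0, taken at [(x0, 1)] where
    neither [pot] nor the sine vanishes, gives [mu = 0]. *)
Lemma quadratic_integral_trivial (x0 : R) : x1 < x0 < x2 -> sin x0 != 0 ->
  exists k m, forall x y p0 p1, x1 < x < x2 -> -2 < y < 2 ->
    phase f x y p0 p1 = k * phase energy x y p0 p1 + m.
Proof.
move=> hx0 s0.
have i0 : -2 < (0 : R) < 2 by apply/andP; split; lra.
have i1 : -2 < (1 : R) < 2 by apply/andP; split; lra.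
have P j k (jk : (j + k <= 2)%N) : partials x1 x2 (-2) 2 (cE j k) (cx j k) (cy j k) :=
  coefficient_partials jk.
have m22 : -2 < (2 : R) by lra.
have V1 : pot 1 != 0 by apply/eqP; exact: pot1_neq0.
have [k [d quad]] : exists k d : R, forall x y : R, x1 < x < x2 -> -2 < y < 2 ->
    [/\ cE 2 0 x y = k * S y + d, cE 1 1 x y = 0 & cE 0 2 x y = k * A a y].
  apply: (killing_quadratic a2 a_neq2 (P 2 0 isT) (P 1 1 isT) (P 0 2 isT)) => x y hx hy.
  have [q1 q2 q3 q4 _] := coefficient_equations hx hy; split; apply/eqP; rewrite -subr_eq0; apply/eqP.
  - by [].
  - by [].
  - by [].
  - by [].
have [nu0 mucst] : (forall x y, x1 < x < x2 -> -2 < y < 2 -> cE 0 1 x y = 0) /\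
    (forall x y x' y', x1 < x < x2 -> -2 < y < 2 -> x1 < x' < x2 -> -2 < y' < 2 ->
      cE 1 0 x y = cE 1 0 x' y').
  apply: (killing_linear a2 a_neq2 (P 1 0 isT) (P 0 1 isT) m22) => x y hx hy.
  have [_ _ _ _ [q1 q2 q3 _]] := coefficient_equations hx hy; split=> //; apply/eqP; rewrite -subr_eq0; apply/eqP.
  - by [].
  - by [].
have mu0 x y : x1 < x < x2 -> -2 < y < 2 -> cE 1 0 x y = 0.
  move=> hx hy; rewrite (mucst x y x0 1) //.
  have [_ _ _ _ [_ _ _ [_ _]]] := coefficient_equations hx0 i1.
  by rewrite nu0 // mul0r subr0 => /eqP; rewrite !mulf_eq0 (negbTE V1) (negbTE s0) !orbF => /eqP.
have cxE x y : x1 < x < x2 -> -2 < y < 2 -> cx 0 0 x y = - 4 * (k + d / S y) * (pot y * sin x).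
  move=> hx hy; have [_ _ _ _ [_ _ _ [q _ _]]] := coefficient_equations hx hy.
  have [q1 q2 _] := quad x y hx hy; rewrite q1 q2 mul0r subr0 in q.
  have S0 := rtA_neq0 a2 y; apply: (mulfI S0).
  transitivity (2 * (2^-1 * S y * cx 0 0 x y + 2 * (k * S y + d) * (pot y * sin x))
    - 4 * (k * S y + d) * (pot y * sin x)); first by field.
  by rewrite q; field.
have cyE x y : x1 < x < x2 -> -2 < y < 2 -> cy 0 0 x y = 4 * k * (pot' y * cos x).
  move=> hx hy; have [_ _ _ _ [_ _ _ [_ q _]]] := coefficient_equations hx hy.
  have [_ q2 q3] := quad x y hx hy; rewrite q2 q3 mul0r addr0 in q.
  have A0 : A a y != 0 by rewrite gt_eqF // A_gt0.
  apply: (mulfI A0).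
  transitivity (2 * (2^-1 * A a y * cy 0 0 x y - 2 * (k * A a y) * (pot' y * cos x))
    + 4 * k * A a y * (pot' y * cos x)); first by field.
  by rewrite q; ring.
(* [w] is independent of [y], while its derivative in [x] is [- 4 (d / S) pot sin x]. At [x0] the
   latter vanishes for [y = 0], but for [y = 1] only if [d = 0]. *)
pose w x y := cE 0 0 x y - 4 * k * (pot y * cos x).
have pw : partials x1 x2 (-2) 2 w (fun x y => - 4 * (d / S y) * (pot y * sin x)) (fun _ _ => 0).
  move=> x y hx hy; have [D0 D1] := P 0 0 isT x y hx hy; split.
    have D := is_derive_sub1 D0 (is_derive_Zl1 (4 * k) (is_derive_Zl1 (pot y) (is_derive_cos x))).
    by apply: is_derive_eq D _; rewrite cxE //; ring.
  have D := is_derive_sub1 D1 (is_derive_Zl1 (4 * k * cos x) (is_derive_pot y)).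
  rewrite (_ : w x = fun t => cE 0 0 x t - 4 * k * cos x * pot t).
    by apply: is_derive_eq D _; rewrite cyE //; ring.
  by apply/funext => t; rewrite /w; ring.
have wy x y : x1 < x < x2 -> -2 < y < 2 -> w x y = w x 0.
  move=> hx hy; apply: (@cst_on_itv R (w x) (-2) 2) => // z hz.
  by have [] := pw x z hx hz.
have d0 : d = 0.
  have E : - 4 * (d / S 1) * (pot 1 * sin x0) = - 4 * (d / S 0) * (pot 0 * sin x0).
    have [D1 _] := pw x0 1 hx0 i1; have [D0 _] := pw x0 0 hx0 i0.
    apply: (is_derive_unique D1); apply: (is_derive_eq_itv hx0 _ D0) => t ht.
    by rewrite (wy t 1).
  move/eqP: E; rewrite pot0 mul0r mulr0 !mulf_eq0 invr_eq0 (negbTE V1) (negbTE s0) (negbTE (rtA_neq0 a2 1)).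
  by rewrite !orbF oppr_eq0 pnatr_eq0 /= => /eqP.
have wc x y : x1 < x < x2 -> -2 < y < 2 -> w x y = w x0 0.
  move=> hx hy; apply: (partials_cst pw) => // x' y' hx' hy'.
  by rewrite d0 mul0r mulr0 mul0r.
exists (4 * k), (w x0 0) => x y p0 p1 hx hy.
have [q1 q2 q3] := quad x y hx hy.
have mu := mu0 x y hx hy; have nu := nu0 x y hx hy; have wE := wc x y hx hy.
rewrite phase_energy fE //=; move: q1 q2 q3 mu nu; rewrite /cE => -> -> -> -> ->.
by rewrite -wE /w /cE d0; field.
Qed.

End NoQuadraticIntegral.

Section QuadraticIntegrals.
Variables (R : realType) (a : R) (g : 'rV[R]_3 -> 'M[R]_3) (U : 'rV[R]_3 -> R).
Local Notation rV2 := 'rV[R]_2.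
Local Notation rV3 := 'rV[R]_3.

Lemma smooth_in_coord (O : set rV2) (psi : rV2 -> rV3) (F : rV3 * rV3 -> R) k :
  immersed_chart O psi -> smooth_on (TstarS2 (R := R)) F ->
  Ck k [set z : rV2 * rV2 | O z.1] (in_coord psi F).
Proof.
move=> ic sF; have [oO C onS _] := ic; have oO' := @open_fst _ rV2 rV2 O oO.
have b3 := finite_basis_row R 3.
apply: smooth_on_open => //.
apply: (smooth_on_comp (Y := TstarS2 (R := R)) (finite_basis_prod b3 b3) _ _ sF).
  by move=> _ [z Oz <-]; split; [exact: onS|exact: (covector_tangent ic)].
apply: (Ck_smooth_on oO') => // j; apply: Ck_pair => //; last exact: Ck_covector.
by apply: Ck_comp_fst => //; exact: finite_basis_row.
Qed.

Lemma sum3_cond (P : pred nat) (F : nat -> R) : \sum_(k < 3 | P k) F k =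
  (if P 0%N then F 0%N else 0) + (if P 1%N then F 1%N else 0) + (if P 2%N then F 2%N else 0).
Proof.
by rewrite -(big_mkord P F) big_mkcond !big_nat_recr //= big_geq // add0r.
Qed.

Lemma sum_degree2 (c : nat -> nat -> R) :
  \sum_(j < 3) \sum_(k < 3 | (j + k <= 2)%N) c j k =
  c 0%N 0%N + c 1%N 0%N + c 0%N 1%N + c 2%N 0%N + c 1%N 1%N + c 0%N 2%N.
Proof.
rewrite (sum3_cond xpredT (fun j => \sum_(k < 3 | (j + k <= 2)%N) c j k)).
by rewrite (sum3_cond (fun k => 0 + k <= 2)%N) (sum3_cond (fun k => 1 + k <= 2)%N)
  (sum3_cond (fun k => 2 + k <= 2)%N) /=; ring.
Qed.

Lemma no_quadratic_integral : -2 < a -> a <> 2 -> defined_by a g U ->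
  ~ exists F, integral_of_degree 2 (hamiltonian g U) F.
Proof.
move=> a2 a_neq2 [rg [sU [Psi [N [S [_ [dPsi [_ [gE UE]]]]]]]]] [F [sF FP]].
have lc := defined_local_coord dPsi; have ic := local_coord_immersed lc.
have := FP _ _ lc; set psi := Psi \o _ in lc ic gE UE *; set f := in_coord psi F => /= [[pois dense [c cE]]].
have hE : in_coord psi (hamiltonian g U) = energy a.
  by apply/funext => z; rewrite (defined_hamiltonian a2 rg dPsi gE UE).
rewrite hE in pois dense.
have stripE (x y : R) : - (pi / 2) < x < pi / 2 -> strip (vec2 x y) by rewrite /strip /= vec2E.
have df (x y p0 p1 : R) : - (pi / 2) < x < pi / 2 -> differentiable f (vec2 x y, vec2 p0 p1).
  by move=> hx; have [+ _] := (CkS _ _ _).1 (smooth_in_coord 1 ic sF); apply; exact: stripE.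
have fE (x y p0 p1 : R) : - (pi / 2) < x < pi / 2 -> phase f x y p0 p1 =
  let q := vec2 x y in
  c 0%N 0%N q + c 1%N 0%N q * p0 + c 0%N 1%N q * p1 + c 2%N 0%N q * p0 ^+ 2 + c 1%N 1%N q * (p0 * p1) + c 0%N 2%N q * p1 ^+ 2.
  move=> hx; rewrite /phase cE; last exact: stripE.
  rewrite (sum_degree2 (fun j k => c j k (vec2 x y) * vec2 p0 p1 0 0 ^+ j * vec2 p0 p1 0 1 ^+ k)) /= !vec2E; by ring.
have fh (x y p0 p1 : R) : - (pi / 2) < x < pi / 2 -> poisson f (energy a) (vec2 x y, vec2 p0 p1) = 0.
  by move=> hx; apply: pois; exact: stripE.
have pi2 : (2^-1 : R) < pi / 2 by have := @pi_ge2 R; lra.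
have h1 : - (pi / 2) < (2^-1 : R) < pi / 2 by rewrite pi2 andbT; lra.
have s1 : sin (2^-1 : R) != 0 by rewrite gt_eqF // sin_gt0_pi // invr_gt0 ltr0n /=; lra.
have [k [m fkm]] := quadratic_integral_trivial a2 a_neq2 df fE fh h1 s1.
have s0 : strip (0 : rV2) by rewrite /strip /= mxE; apply/andP; split; lra.
have := dense (0, 0) (conj s0 I).
pose B : set rV2 := (strip (R := R) `&` [set q : rV2 | -2 < q 0 1]) `&` [set q : rV2 | q 0 1 < 2].
have oB : open B.
  by apply: openI; [apply: openI; [exact: open_strip|exact: open_coord_gt]|exact: open_coord_lt].
have B0 : B 0 by split; [split=> //|]; rewrite /= mxE; lra.
have nb : nbhs ((0, 0) : rV2 * rV2) [set z : rV2 * rV2 | B z.1].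
  by apply: open_nbhs_nbhs; split=> //; exact: open_fst.
move=> /(_ _ nb) [[q p] [/= ind [[sq q1] q2]]].
have hx : - (pi / 2) < q 0 0 < pi / 2 by [].
have hy : -2 < q 0 1 < 2 by rewrite q1.
have qE := vec2_eta q; have pE := vec2_eta p.
set x := q 0 0 in qE hx; set y := q 0 1 in qE hy; set p0 := p 0 0 in pE; set p1 := p 0 1 in pE.
rewrite -qE -pE in ind.
(* Near this point [f] is [k] times the energy plus a constant, so [1] and [- k] form a nontrivial
   relation between the differentials. *)
have [] := ind 1 (- k); last by move=> /eqP; rewrite oner_eq0.
have key (d e : R) : d = k * e -> 1 * d + - k * e = 0 by move=> ->; ring.
have D (f0 e : R -> R) (x1 x2 t d : R) : x1 < t < x2 -> (forall s, x1 < s < x2 -> f0 s = k * e s + m) ->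
    is_derive t 1 e d -> is_derive t 1 f0 (k * d).
  move=> ht H De; apply: (is_derive_eq_itv ht (f := fun s => k * e s + m)) => [s hs|]; first by rewrite H.
  by have := is_derive_add1 (is_derive_Zl1 k De) (is_derive_cst m t 1); rewrite addr0.
move=> i; case: (ord2 i) => ->; split; apply: key.
- rewrite (Dq0_phase (is_derive_energy_x a x y p0 p1)); apply: Dq0_phase.
  by apply: (D _ _ _ _ _ _ hx _ (is_derive_energy_x a x y p0 p1)) => s hs; exact: fkm.
- rewrite (Dp0_phase (is_derive_energy_p0 a x y p0 p1)); apply: Dp0_phase.
  have ht : p0 - 1 < p0 < p0 + 1 by apply/andP; split; lra.
  by apply: (D _ _ _ _ _ _ ht _ (is_derive_energy_p0 a x y p0 p1)) => s hs; exact: fkm.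
- rewrite (Dq1_phase (is_derive_energy_y a2 x y p0 p1)); apply: Dq1_phase.
  by apply: (D _ _ _ _ _ _ hy _ (is_derive_energy_y a2 x y p0 p1)) => s hs; exact: fkm.
- rewrite (Dp1_phase (is_derive_energy_p1 a x y p0 p1)); apply: Dp1_phase.
  have ht : p1 - 1 < p1 < p1 + 1 by apply/andP; split; lra.
  by apply: (D _ _ _ _ _ _ ht _ (is_derive_energy_p1 a x y p0 p1)) => s hs; exact: fkm.
Qed.

End QuadraticIntegrals.

(** * The round sphere *)

Section SphereCurvature.
Variables (R : realType) (O : set 'rV[R]_2) (y : 'rV[R]_2 -> 'rV[R]_3) (G : 'rV[R]_2 -> 'M[R]_2).
Local Notation rV2 := 'rV[R]_2.
Hypothesis ic : immersed_chart O y.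
Hypothesis GE : forall q, O q -> G q = 2 *: (jacobian y q *m (jacobian y q)^T).
(** The first and second derivatives of [y] are named and known only through the next two equations,
    which keeps them opaque in the computations. *)
Variables (y1 : 'I_2 -> rV2 -> 'rV[R]_3) (y2 : 'I_2 -> 'I_2 -> rV2 -> 'rV[R]_3).
Hypothesis y1E : forall i, 'D_(delta_mx 0 i) y = y1 i.
Hypothesis y2E : forall i j, 'D_(delta_mx 0 i) (y1 j) = y2 i j.
Let y1p i q : 'D_(delta_mx 0 i) y q = y1 i q. Proof. by rewrite -y1E. Qed.
Let y2p i j q : 'D_(delta_mx 0 i) (y1 j) q = y2 i j q. Proof. by rewrite -y2E. Qed.
Let Cy k : Ck k O y. Proof. by have [_ C _ _] := ic. Qed.
Let oO : open O. Proof. by case: ic. Qed.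
Let Cy1 k i : Ck k O (y1 i).
Proof. by have [_ D] := (CkS _ _ _).1 (Cy k.+1); rewrite -y1E; exact: D. Qed.
Let Cy2 k i j : Ck k O (y2 i j).
Proof. by have [_ D] := (CkS _ _ _).1 (Cy1 k.+1 j); rewrite -y2E; exact: D. Qed.
Let d0 q : O q -> differentiable y q.
Proof. by have [d _] := (CkS _ _ _).1 (Cy 1); exact: d. Qed.
Let d1 i q : O q -> differentiable (y1 i) q.
Proof. by have [d _] := (CkS _ _ _).1 (Cy1 1 i); exact: d. Qed.
Let d2 i j q : O q -> differentiable (y2 i j) q.
Proof. by have [d _] := (CkS _ _ _).1 (Cy2 1 i j); exact: d. Qed.

Let nearO q (P : rV2 -> Prop) : O q -> (forall q', O q' -> P q') -> \forall q' \near q, P q'.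
Proof. by move=> Oq H; apply: filterS (open_nbhs_nbhs (conj oO Oq)) => q'; exact: H. Qed.

Lemma derive_mulcl (V : normedModType R) (f : V -> R) (c : R) x v : differentiable f x ->
  'D_v (fun t => c * f t) x = c * 'D_v f x.
Proof. by move=> df; apply: (etrans (deriveZ c (diff_derivable (v := v) df))). Qed.

Lemma row_jacobian q i : O q -> row i (jacobian y q) = y1 i q.
Proof. by move=> Oq; rewrite rowE jacobianE ?y1p //; exact: d0. Qed.

Lemma gramE q i j : O q -> (jacobian y q *m (jacobian y q)^T) i j = dot (y1 i q) (y1 j q).
Proof.
move=> Oq; rewrite -!row_jacobian // dotE mxE; apply: eq_bigr => k _.
by rewrite !mxE.
Qed.

Lemma metricE q i j : O q -> G q i j = 2 * dot (y1 i q) (y1 j q).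
Proof. by move=> Oq; rewrite GE // mxE gramE. Qed.

Lemma metric_unit q : O q -> G q \in unitmx.
Proof. by move=> Oq; rewrite GE // unitmxZ ?unitfE ?pnatr_eq0 //; exact: (gram_unit ic). Qed.

Lemma y2_sym q i j : O q -> y2 i j q = y2 j i q.
Proof. by move=> Oq; rewrite -!y2E -!y1E; exact: (schwarz_mx _ _ oO Oq (Cy 2)). Qed.

Lemma y1_normal q i : O q -> dot (y1 i q) (y q) = 0.
Proof. by move=> Oq; rewrite dotC -row_jacobian // rowE; exact: (chart_tangent ic). Qed.

(** The second fundamental form of the unit sphere, from differentiating [y1_normal]. *)
Lemma y2_normal q i j : O q -> dot (y2 i j q) (y q) = - dot (y1 i q) (y1 j q).
Proof.
move=> Oq; have := derive_dot (delta_mx 0 i) (d1 j Oq) (d0 Oq).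
rewrite (near_eq_derive (g := cst (0 : R))); last by apply: nearO => // q' Oq'; exact: y1_normal.
rewrite derive_cst y2p y1p => /esym/eqP; rewrite addr_eq0 => /eqP ->.
by rewrite dotC.
Qed.

Lemma pd_metric q k i j : O q ->
  pd k (fun q' => G q' i j) q = 2 * (dot (y2 k i q) (y1 j q) + dot (y2 k j q) (y1 i q)).
Proof.
move=> Oq; have := derive_dot (delta_mx 0 k) (d1 i Oq) (d1 j Oq).
rewrite !y2p (dotC (y1 i q)) => <-.
have dd := differentiable_dot (d1 i Oq) (d1 j Oq).
apply: (etrans _ (derive_mulcl _ _ dd)).
by apply: near_eq_derive; apply: nearO => // q' Oq'; exact: metricE.
Qed.

(** For an induced metric the three derivatives of [G] combine, by the symmetry of [y2], into the
    tangential part of one second derivative. *)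
Lemma christoffelE q k i j : O q -> christoffel G k i j q =
  \sum_l invmx (G q) k l * (2 * dot (y2 i j q) (y1 l q)).
Proof.
move=> Oq; rewrite /christoffel mulr_sumr; apply: eq_bigr => l _.
rewrite !pd_metric // (y2_sym j i Oq) (y2_sym l i Oq) (y2_sym l j Oq).
move: (dot (y2 i j q) (y1 l q)) (dot (y2 i l q) (y1 j q)) (dot (y2 j l q) (y1 i q)) => r s t.
by move: (invmx (G q) k l) => m; field.
Qed.

Lemma differentiable_christoffel q k i j : O q -> differentiable (christoffel G k i j) q.
Proof.
move=> Oq; have CG : Ck 1 O G.
  apply: (@Ck_eq _ _ _ _ _ (fun q => \matrix_(i, j) (2 * dot (y1 i q) (y1 j q)))) => //.
    by move=> q' Oq'; apply/matrixP => i' j'; rewrite mxE metricE.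
  apply: Ck_matrix => // i' j'; apply: (@Ck_eq _ _ _ _ _ (fun q => 2 * \sum_k y1 i' q 0 k * y1 j' q 0 k)) => //.
    by move=> q' _; rewrite mxE dotE.
  apply: Ck_mul => //; first exact: Ck_cst.
  apply: Ck_sum => // l _.
  by apply: Ck_mul => //; exact: Ck_coord.
have Cinv : Ck 1 O (fun q => invmx (G q)) by apply: Ck_invmx2 => // q' Oq'; exact: metric_unit.
have C1 : Ck 1 O (christoffel G k i j).
  apply: (@Ck_eq _ _ _ _ _ (fun q => \sum_l invmx (G q) k l * (2 * \sum_m y2 i j q 0 m * y1 l q 0 m))) => //.
    by move=> q' Oq'; rewrite christoffelE //; apply: eq_bigr => l _; rewrite dotE.
  apply: Ck_sum => // l _; apply: Ck_mul => //; first exact: Ck_coord.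
  apply: Ck_mul => //; first exact: Ck_cst.
  by apply: Ck_sum => // m _; apply: Ck_mul => //; exact: Ck_coord.
by have [d _] := (CkS _ _ _).1 C1; exact: d.
Qed.

Lemma metric_sym q i j : O q -> G q i j = G q j i.
Proof. by move=> Oq; rewrite !metricE // dotC. Qed.

Lemma christoffel_lower q i j k : O q ->
  \sum_l G q l k * christoffel G l i j q = 2 * dot (y2 i j q) (y1 k q).
Proof.
move=> Oq; have inv := mulmxV (metric_unit Oq).
under eq_bigr do rewrite christoffelE // mulr_sumr.
rewrite exchange_big /= (bigD1 k) //= [X in _ + X]big1 ?addr0 => [|m mk].
  have := congr1 (fun M : 'M[R]_2 => M k k) inv; rewrite !mxE eqxx => E.
  under eq_bigr do rewrite (metric_sym _ _ Oq) mulrA.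
  by rewrite -mulr_suml E mul1r.
have := congr1 (fun M : 'M[R]_2 => M k m) inv; rewrite !mxE eq_sym (negbTE mk) => E.
under eq_bigr do rewrite (metric_sym _ _ Oq) mulrA.
by rewrite -mulr_suml E mul0r.
Qed.

(** Comes from differentiating [christoffel_lower]; in this way the inverse of the metric need not
    be differentiated explicitly. *)
Lemma christoffel_derive_lower q i j k : O q ->
  \sum_l G q l 0 * pd i (christoffel G l j k) q =
  2 * (dot ('D_(delta_mx 0 i) (y2 j k) q) (y1 0 q) + dot (y2 j k q) (y2 i 0 q)) -
  \sum_l 2 * (dot (y2 i l q) (y1 0 q) + dot (y2 i 0 q) (y1 l q)) * christoffel G l j k q.
Proof.
move=> Oq.
have dG l : differentiable (fun q' => G q' l 0) q.
  have dd : differentiable (fun q' => 2 *: dot (y1 l q') (y1 0 q')) q.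
    apply: differentiable_scale; first exact: differentiable_cst.
    exact: differentiable_dot (d1 l Oq) (d1 0 Oq).
  by apply: near_eq_differentiable dd; apply: nearO => // q' Oq'; rewrite metricE.
have dC l : differentiable (christoffel G l j k) q by exact: differentiable_christoffel.
have E : 'D_(delta_mx 0 i) (fun q' => \sum_l G q' l 0 * christoffel G l j k q') q =
    2 * (dot ('D_(delta_mx 0 i) (y2 j k) q) (y1 0 q) + dot (y2 j k q) (y2 i 0 q)).
  have := derive_dot (delta_mx 0 i) (d2 j k Oq) (d1 0 Oq); rewrite y2p => <-.
  have dd := differentiable_dot (d2 j k Oq) (d1 0 Oq).
  apply: (etrans _ (derive_mulcl _ _ dd)).
  by apply: near_eq_derive; apply: nearO => // q' Oq'; exact: christoffel_lower.
rewrite -E; apply/eqP; rewrite eq_sym subr_eq -big_split /=; apply/eqP.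
have -> : (fun q' => \sum_l G q' l 0 * christoffel G l j k q') =
    \sum_(l < 2) ((fun q' => G q' l 0) * christoffel G l j k).
  by apply/funext => q'; rewrite fct_sumE.
rewrite derive_sum => [|l]; last by apply: diff_derivable; apply: differentiableM.
apply: eq_bigr => l _; rewrite deriveM; [|exact: diff_derivable|exact: diff_derivable].
rewrite -(pd_metric i l 0 Oq); congr (_ + _).
by rewrite mulrC.
Qed.

Lemma dot_chart q (a b : 'rV[R]_3) : O q -> dot a b = dot a (y q) * dot b (y q) +
  \sum_i \sum_l 2 * invmx (G q) i l * dot a (y1 l q) * dot b (y1 i q).
Proof.
move=> Oq; rewrite (chart_dot ic Oq); congr (_ + _); apply: eq_bigr => i _.
rewrite y1p -mulr_suml; congr (_ * _); rewrite /covector -rowE mulmx_sum_row.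
have -> : invmx (jacobian y q *m (jacobian y q)^T) = 2 *: invmx (G q).
  have u : (2 : R) \is a GRing.unit by rewrite unitfE pnatr_eq0.
  by rewrite GE // invmxZ ?unitmxZ ?(gram_unit ic) // scalerA divff ?scale1r // pnatr_eq0.
rewrite dotC [dot _ a]dotC.
elim/big_ind2 : _ => [|u s v t <- <-|l _]; rewrite ?dot0r ?dotDr //.
by rewrite dotZr row_jacobian // !mxE.
Qed.

Lemma det_mx22 (M : 'M[R]_2) : \det M = M 0 0 * M 1 1 - M 0 1 * M 1 0.
Proof.
have l0 : lift 0 0 = 1 :> 'I_2 by apply/val_inj.
have l1 : lift 1 0 = 0 :> 'I_2 by apply/val_inj.
by rewrite (expand_det_row _ 0) sum2 /cofactor !det_mx11 !mxE l0 l1 /=; ring.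
Qed.

(** Third derivatives cancel by symmetry, and the tangential parts of the products of second
    derivatives cancel against the products of Christoffel symbols. By [y2_normal] the normal parts
    leave the Gram determinant. The factor 2 of [G] enters once here and squared in [\det G], whence
    1/2. *)
Lemma sphere_curvature q : O q -> gauss_curvature G q = 2^-1.
Proof.
move=> Oq; have uG := metric_unit Oq.
have det0 : \det (G q) != 0 by move: uG; rewrite unitmxE unitfE.
rewrite /gauss_curvature; apply: (mulIf det0); rewrite divfK //.
have t011 : 'D_(delta_mx 0 0) (y2 1 1) q = 'D_(delta_mx 0 1) (y2 0 1) q.
  by rewrite -!y2E; exact: (schwarz_mx _ _ oO Oq (Cy1 2 1)).
have E1 := christoffel_derive_lower 0 1 1 Oq; have E2 := christoffel_derive_lower 1 0 1 Oq.
have L00 := christoffel_lower 0 0 0 Oq; have L01 := christoffel_lower 0 1 0 Oq.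
have L10 := christoffel_lower 1 0 0 Oq; have L11 := christoffel_lower 1 1 0 Oq.
do 2 (rewrite sum2 in E1; rewrite sum2 in E2).
rewrite sum2 in L00; rewrite sum2 in L01; rewrite sum2 in L10; rewrite sum2 in L11.
rewrite /riemann; do 3 rewrite sum2.
have C l i j : christoffel G l i j q = invmx (G q) l 0 * (2 * dot (y2 i j q) (y1 0 q))
    + invmx (G q) l 1 * (2 * dot (y2 i j q) (y1 1 q)) by rewrite christoffelE // sum2.
have P1 : dot (y2 1 1 q) (y2 0 0 q) = dot (y1 1 q) (y1 1 q) * dot (y1 0 q) (y1 0 q) +
    (christoffel G 0 1 1 q * dot (y2 0 0 q) (y1 0 q) + christoffel G 1 1 1 q * dot (y2 0 0 q) (y1 1 q)).
  rewrite (dot_chart _ _ Oq) !y2_normal // mulrNN; congr (_ + _).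
  by rewrite !C sum2; do 2 rewrite sum2; ring.
have P2 : dot (y2 0 1 q) (y2 0 1 q) = dot (y1 0 q) (y1 1 q) * dot (y1 0 q) (y1 1 q) +
    (christoffel G 0 0 1 q * dot (y2 0 1 q) (y1 0 q) + christoffel G 1 0 1 q * dot (y2 0 1 q) (y1 1 q)).
  rewrite (dot_chart _ _ Oq) !y2_normal // mulrNN; congr (_ + _).
  by rewrite !C sum2; do 2 rewrite sum2; ring.
rewrite det_mx22 !metricE // (dotC (y1 1 q) (y1 0 q)).
rewrite !metricE // (dotC (y1 1 q) (y1 0 q)) in E1 E2 L00 L01 L10 L11.
rewrite t011 P1 in E1; rewrite (y2_sym 1 0 Oq) P2 in E2; rewrite (y2_sym 1 0 Oq) in L10.
clear C P1 P2 uG det0 t011.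
move: (pd 0 (christoffel G 0 1 1) q) (pd 0 (christoffel G 1 1 1) q) (pd 1 (christoffel G 0 0 1) q)
  (pd 1 (christoffel G 1 0 1) q) E1 E2 L00 L01 L10 L11.
move: (christoffel G 0 1 1 q) (christoffel G 1 1 1 q) (christoffel G 0 0 1 q) (christoffel G 1 0 1 q)
  (christoffel G 0 0 0 q) (christoffel G 1 0 0 q) (christoffel G 0 1 0 q) (christoffel G 1 1 0 q).
move: (dot ('D_(delta_mx 0 1) (y2 0 1) q) (y1 0 q)) (dot (y2 0 0 q) (y1 0 q)) (dot (y2 0 0 q) (y1 1 q))
  (dot (y2 0 1 q) (y1 0 q)) (dot (y2 0 1 q) (y1 1 q)) (dot (y2 1 1 q) (y1 0 q)) (dot (y2 1 1 q) (y1 1 q)).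
move: (dot (y1 0 q) (y1 0 q)) (dot (y1 0 q) (y1 1 q)) (dot (y1 1 q) (y1 1 q)).
move=> g00 g01 g11 t d000 d001 d010 d011 d110 d111 c0 c1 e0 e1 f0 f1 h0 h1 p0 p1 r0 r1 E1 E2 L00 L01 L10 L11.
transitivity ((2 * g00 * p0 + 2 * g01 * p1) - (2 * g00 * r0 + 2 * g01 * r1)
  + c0 * (2 * g00 * f0 + 2 * g01 * f1) + c1 * (2 * g00 * e0 + 2 * g01 * e1)
  - e0 * (2 * g00 * h0 + 2 * g01 * h1) - e1 * (2 * g00 * c0 + 2 * g01 * c1)); first by ring.
by rewrite E1 E2 L00 L01 L10 L11; field.
Qed.

End SphereCurvature.

Lemma sphere_gram_curvature (R : realType) (O : set 'rV[R]_2) (y : 'rV[R]_2 -> 'rV[R]_3)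
    (G : 'rV[R]_2 -> 'M[R]_2) (q : 'rV[R]_2) : immersed_chart O y ->
  (forall q, O q -> G q = 2 *: (jacobian y q *m (jacobian y q)^T)) -> O q ->
  gauss_curvature G q = 2^-1.
Proof.
move=> ic GE; exact: (sphere_curvature ic GE (fun i => erefl) (fun i j => erefl)).
Qed.

(** * Differentials of maps into the cylinder *)

Section CylinderTransition.
Variable R : realType.
Local Notation rV2 := 'rV[R]_2.
Local Notation rV3 := 'rV[R]_3.

Lemma derive_comp1 (V : normedModType R) (f : V -> R) (k : R -> R) (x v : V) (d : R) :
  is_derive (f x) 1 k d -> differentiable f x -> 'D_v (fun y => k (f y)) x = d * 'D_v f x.
Proof.
move=> [dk kE] df; move/derivable1_diffP : (dk) => dk'.
apply: (etrans (derive_comp v df dk')); rewrite deriveE //.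
by rewrite -[X in 'd _ _ X]mulr1 linearZ /= -deriveE // kE -[_ *: _]/(_ * _) mulrC.
Qed.

Lemma derive_cyl (q v : rV2) :
  'D_v (@cyl R) q = vec3 (- sin (q 0 0) * v 0 0) (cos (q 0 0) * v 0 0) (v 0 1).
Proof.
have dv : derivable (@cyl R) q v.
  by apply: diff_derivable; have [+ _] := (CkS _ _ _).1 (@Ck_cyl R 1); apply.
have dq i : differentiable (fun y : rV2 => y 0 i) q by exact: differentiable_coord.
have Dq i : 'D_v (fun y : rV2 => y 0 i) q = v 0 i.
  by rewrite -derive_coord ?derive_id //; exact: derivable_id.
have coordE i := derive_coord 0 i dv.
apply: row3P; apply: (etrans (coordE _)); rewrite vec3E.
- have -> : (fun y : rV2 => cyl y 0 0) = (fun y : rV2 => cos (y 0 0)) by apply/funext => y; rewrite /cyl vec3E.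
  by apply: etrans (derive_comp1 v (is_derive_cos _) (dq 0)) _; rewrite Dq.
- have -> : (fun y : rV2 => cyl y 0 1) = (fun y : rV2 => sin (y 0 0)) by apply/funext => y; rewrite /cyl vec3E.
  by apply: etrans (derive_comp1 v (is_derive_sin _) (dq 0)) _; rewrite Dq.
- have -> : (fun y : rV2 => cyl y 0 2) = (fun y : rV2 => y 0 1) by apply/funext => y; rewrite /cyl vec3E.
  exact: Dq.
Qed.

Variables (O : set rV2) (c : rV2 -> rV3).
Hypotheses (oO : open O) (Cc : forall k, Ck k O c) (cc : forall q, O q -> cylinder (c q)).

Let dc q : O q -> differentiable c q.
Proof. by have [+ _] := (CkS _ _ _).1 (Cc 1); apply. Qed.

Let nearO q (P : rV2 -> Prop) : O q -> (forall q', O q' -> P q') -> \forall q' \near q, P q'.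
Proof. by move=> Oq H; apply: filterS (open_nbhs_nbhs (conj oO Oq)) => q'; exact: H. Qed.

(* The differential of [c] in the coordinates [(phi, u)] of the cylinder. *)
Definition angular (q v : rV2) : rV2 :=
  vec2 (c q 0 0 * 'D_v c q 0 1 - c q 0 1 * 'D_v c q 0 0) ('D_v c q 0 2).

Lemma derive_cylinder q v : O q -> c q 0 0 * 'D_v c q 0 0 + c q 0 1 * 'D_v c q 0 1 = 0.
Proof.
move=> Oq; have dv : derivable c q v by apply: diff_derivable; exact: dc.
have dx i : differentiable (fun y => c y 0 i) q by apply: differentiable_coord'; exact: dc.
have xE i : 'D_v c q 0 i = 'D_v (fun y => c y 0 i) q by exact: derive_coord.
have E : 'D_v (fun y => c y 0 0 * c y 0 0 + c y 0 1 * c y 0 1) q = 0.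
  have n1 : \forall q' \near q, c q' 0 0 * c q' 0 0 + c q' 0 1 * c q' 0 1 = cst (1 : R) q'.
    by apply: (nearO Oq) => q' Oq'; have := cc Oq'; rewrite /cylinder /= !expr2.
  by apply: etrans (near_eq_derive v n1) _; rewrite derive_cst.
have dm i : derivable (fun y => c y 0 i * c y 0 i) q v by apply: diff_derivable; exact: differentiableM.
have M i : 'D_v (fun y => c y 0 i * c y 0 i) q = 2 * (c q 0 i * 'D_v c q 0 i).
  have dvi : derivable (fun y => c y 0 i) q v by exact: diff_derivable.
  apply: (etrans (deriveM dvi dvi)); rewrite -xE -[_ *: _]/(_ * _); ring.
have := deriveD (dm 0) (dm 1); rewrite !M => E'.
have : 2 * (c q 0 0 * 'D_v c q 0 0 + c q 0 1 * 'D_v c q 0 1) = 0 by rewrite mulrDr -E'; exact: E.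
by move=> /eqP; rewrite mulf_eq0 pnatr_eq0 => /eqP.
Qed.

Lemma derive_angular q qh v : O q -> c q = cyl qh -> 'D_v c q = 'D_(angular q v) (@cyl R) qh.
Proof.
move=> Oq cq; have E := derive_cylinder v Oq.
rewrite derive_cyl; apply: row3P; rewrite vec3E /angular !vec2E //; move: E; rewrite cq /cyl !vec3E.
all: have cs := cos2Dsin2 (qh 0 0); move: ('D_v c q 0 0) ('D_v c q 0 1) => w0 w1 E.
  transitivity ((cos (qh 0 0) ^+ 2 + sin (qh 0 0) ^+ 2) * w0); first by rewrite cs mul1r.
  transitivity (- sin (qh 0 0) * (cos (qh 0 0) * w1 - sin (qh 0 0) * w0)
    + cos (qh 0 0) * (cos (qh 0 0) * w0 + sin (qh 0 0) * w1)); [by ring|by rewrite E mulr0 addr0].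
transitivity ((cos (qh 0 0) ^+ 2 + sin (qh 0 0) ^+ 2) * w1); first by rewrite cs mul1r.
transitivity (cos (qh 0 0) * (cos (qh 0 0) * w1 - sin (qh 0 0) * w0)
  + sin (qh 0 0) * (cos (qh 0 0) * w0 + sin (qh 0 0) * w1)); [by ring|by rewrite E mulr0 addr0].
Qed.

Variable Psi : rV3 -> rV3.
Hypothesis sPsi : smooth_on (cylinder (R := R)) Psi.

(** The comparison is made at one point [qh] over [c q], and [angular] supplies the vector there. No
    continuous choice of [qh], that is, of an angle, is required. *)
Lemma jacobian_cylinder q qh v : O q -> c q = cyl qh ->
  v *m jacobian (Psi \o c) q = angular q v *m jacobian (Psi \o @cyl R) qh.
Proof.
move=> Oq cq; have [Q [h [oQ Qx Ch hE]]] := sPsi (cc Oq).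
have dh : differentiable h (c q) by have [+ _] := (CkS _ _ _).1 (Ch 1%N); apply.
have dcy : differentiable (@cyl R) qh by have [+ _] := (CkS _ _ _).1 (@Ck_cyl R 1); apply.
have n1 : \forall q' \near q, (h \o c) q' = (Psi \o c) q'.
  have nb : nbhs q (c @^-1` Q).
    by apply: (differentiable_continuous (dc Oq)); exact: open_nbhs_nbhs.
  near=> q'; rewrite /= hE //; first by apply: cc; near: q'; exact: open_nbhs_nbhs.
  by near: q'; exact: nb.
have n2 : \forall q' \near qh, (h \o @cyl R) q' = (Psi \o @cyl R) q'.
  have nb : nbhs qh (@cyl R @^-1` Q).
    by apply: (differentiable_continuous dcy); rewrite -cq; exact: open_nbhs_nbhs.
  near=> q'; rewrite /= hE //; first by exact: cyl_cylinder.
  by near: q'; exact: nb.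
have d1 : differentiable (h \o c) q by apply: differentiable_comp => //; exact: dc.
have d2 : differentiable (h \o @cyl R) qh by apply: differentiable_comp => //; rewrite -cq.
have d1' := near_eq_differentiable n1 d1; have d2' := near_eq_differentiable n2 d2.
rewrite (jacobianE _ d1') (jacobianE _ d2') -(near_eq_derive _ n1) -(near_eq_derive _ n2).
rewrite (derive_comp _ (dc Oq) dh) (derive_comp _ dcy); last by rewrite -cq.
by rewrite (derive_angular v Oq cq) -cq.
Unshelve. all: by end_near. Qed.

End CylinderTransition.

(** * Curvature and potential for a = 2 *)

Section RoundSphere.
Variables (R : realType) (g : 'rV[R]_3 -> 'M[R]_3) (U : 'rV[R]_3 -> R).
Local Notation rV2 := 'rV[R]_2.
Local Notation rV3 := 'rV[R]_3.

Lemma gram_form m n (J : 'M[R]_(m, n)) (v : 'rV_m) : form (J *m J^T) v v = dot (v *m J) (v *m J).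
Proof. by rewrite -[X in X *m J^T]mulmx1 form_mul formE mulmx1. Qed.

Lemma eq_quadratic_forms (G M : 'M[R]_2) : G^T = G -> M^T = M ->
  (forall v, form G v v = 2 * form M v v) -> G = 2 *: M.
Proof.
move=> GT MT H.
have G10 : G 1 0 = G 0 1 by rewrite -{1}GT mxE.
have M10 : M 1 0 = M 0 1 by rewrite -{1}MT mxE.
have := H (vec2 1 0); have := H (vec2 0 1); have := H (vec2 1 1).
rewrite !form2 !vec2E G10 M10 => h1 h2 h3.
apply/matrixP => i j; rewrite mxE; case: (ord2 i) => ->; case: (ord2 j) => ->.
- by move: h3; rewrite !expr2 !mulr0 !mul0r !mul1r !addr0.
- by move: h1 h2 h3; rewrite !expr2 !mulr0 !mul0r !mul1r !addr0 !add0r; lra.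
- by rewrite G10 M10; move: h1 h2 h3; rewrite !expr2 !mulr0 !mul0r !mul1r !addr0 !add0r; lra.
- by move: h2; rewrite !expr2 !mulr0 !mul0r !mul1r !add0r.
Qed.

Lemma open_avoid (O : set rV2) (psi : rV2 -> rV3) (P Q : rV3) : open O -> Ck 0 O psi ->
  open (O `&` [set q | ~ [set P; Q] (psi q)]).
Proof.
move=> oO C; have clNS : closed [set P; Q].
  by apply: closedU; apply: accessible_closed_set1; exact: hausdorff_accessible.
rewrite openE => q [Oq nq].
have nb : nbhs q (psi @^-1` (~` [set P; Q])).
  by apply: (Ck_continuous C Oq); apply: open_nbhs_nbhs; split=> //; exact: closed_openC.
by apply: filterI; [exact: open_nbhs_nbhs|exact: nb].
Qed.

Lemma potential2 (x u : R) : potential 2 x u = 0.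
Proof.
have E : A 2 u = (1 + u ^+ 2) ^+ 2 by rewrite /A; ring.
rewrite /potential E sqrtr_sqr ger0_norm ?addr_ge0 ?sqr_ge0 //.
by rewrite (_ : 2 + 2 * u ^+ 2 - 2 * (1 + u ^+ 2) = 0) ?mulr0 ?mul0r ?oppr0 //; ring.
Qed.

Lemma model_form2 x (v w : rV3) : form (model_metric 2 x) v w = 2 * dot v w.
Proof.
have s1 : sq (2 : R) (x 0 2) = 1 by rewrite /sq subrr !mul0r subr0 sqrtr1.
by rewrite model_formE s1 subrr mulr0 !mul0r addr0 divr1.
Qed.

Variables (Psi : rV3 -> rV3) (N S : rV3).
Hypothesis dPsi : diffeo (cylinder (R := R)) (S2 (R := R) `\` [set N; S]) Psi.

Lemma sphere_minus_poles x : S2 x -> ~ [set N; S] x -> exists q, x = (Psi \o @cyl R) q.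
Proof.
move=> Sx Nx; have [_ [_ _ surjP] _] := dPsi.
have [y cy <-] := surjP x (conj Sx Nx); have [phi yE] := cyl_onto cy.
by exists (vec2 phi (y 0 2)); rewrite /= -yE.
Qed.

(** The lift is the inverse of [Psi] after the chart. Its values lie in the cylinder in space, so no
    branch of the angle has to be chosen. *)
Lemma cylinder_lift (O : set rV2) (psi : rV2 -> rV3) : open O -> (forall k, Ck k O psi) ->
  (forall q, O q -> S2 (psi q) /\ ~ [set N; S] (psi q)) ->
  exists c : rV2 -> rV3, (forall k, Ck k O c) /\
    forall q, O q -> exists qh, c q = cyl qh /\ Psi (c q) = psi q.
Proof.
move=> oO C onS; have [sPsi [fP injP surjP] [Ginv [sG GK]]] := dPsi.
exists (Ginv \o psi); split=> [k|q Oq].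
  apply: smooth_on_open => //; apply: (smooth_on_comp (finite_basis_row R 3) _ _ sG).
    by move=> _ [q' Oq' <-]; exact: onS.
  by apply: (Ck_smooth_on oO) => // j; exact: C.
have [Sq nq] := onS q Oq; have [qh E] := sphere_minus_poles Sq nq.
have cE : Ginv (psi q) = cyl qh by rewrite E /= GK //; exact: cyl_cylinder.
by exists qh; split=> //; rewrite /= cE E.
Qed.

Lemma jacobian_lift (O : set rV2) (psi c : rV2 -> rV3) q qh v : open O -> (forall k, Ck k O psi) ->
  (forall k, Ck k O c) -> (forall q, O q -> exists qh, c q = cyl qh /\ Psi (c q) = psi q) ->
  O q -> c q = cyl qh -> v *m jacobian psi q = angular c q v *m jacobian (Psi \o @cyl R) qh.
Proof.
move=> oO C Cc cK Oq cq; have [sPsi _ _] := dPsi.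
have cc q' : O q' -> cylinder (c q') by move=> /cK[? [-> _]]; exact: cyl_cylinder.
rewrite -(jacobian_cylinder oO Cc cc sPsi v Oq cq).
have n1 : \forall q1 \near q, psi q1 = (Psi \o c) q1.
  by apply: filterS (open_nbhs_nbhs (conj oO Oq)) => q1 /cK[? []].
have d1 : differentiable psi q by have [+ _] := (CkS _ _ _).1 (C 1%N); apply.
have d2 := near_eq_differentiable n1 d1.
exact (etrans (jacobianE v d1) (etrans (near_eq_derive v n1) (esym (jacobianE v d2)))).
Qed.

(** At the two poles the value follows by continuity along the meridian of angle 0. *)
Lemma zero_potential : smooth_on (S2 (R := R)) U -> S2 N -> S2 S ->
  (forall phi : R, Psi (vec3 (cos phi) (sin phi) u) @[u --> +oo] --> N /\
                   Psi (vec3 (cos phi) (sin phi) u) @[u --> -oo] --> S) ->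
  (forall q, U ((Psi \o @cyl R) q) = 0) -> forall x, S2 x -> U x = 0.
Proof.
move=> sU SN SS lim UE.
have pole (P : rV3) (F : set_system R) (FF : ProperFilter F) : S2 P ->
    Psi (vec3 (cos 0) (sin 0) u) @[u --> F] --> P -> U P = 0.
  move=> SP cv; have [Q [h [oQ QP Ch hE]]] := sU P SP.
  have ch : {for P, continuous h} by exact: (Ck_continuous (Ch 0%N)).
  apply: contrapT => /eqP UP.
  have nb : nbhs P ([set x | h x != 0] `&` Q).
    apply: filterI; last exact: open_nbhs_nbhs.
    have nh : nbhs (h P) [set t : R | t != 0].
      by apply: open_nbhs_nbhs; split; [exact: open_neq|rewrite /= -hE].
    exact: (ch _ nh).
  have [u [hu Qu]] := @filter_ex _ F FF (fun u : R => ([set x | h x != 0] `&` Q) (Psi (vec3 (cos 0) (sin 0) u))) (cv _ nb).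
  have cE : vec3 (cos 0) (sin 0) u = cyl (vec2 0 u) by rewrite /cyl !vec2E.
  move: hu Qu; rewrite /= cE => /eqP hu Qu; apply: hu; rewrite -hE //; first exact: UE.
  by have [_ [fP _ _] _] := dPsi; have [] := fP _ (cyl_cylinder (vec2 0 u)).
move=> x Sx; have [[->|->]|NSx] := pselect ([set N; S] x).
- exact: pole SN (lim 0).1.
- exact: pole SS (lim 0).2.
by have [q ->] := sphere_minus_poles Sx NSx; exact: UE.
Qed.

Hypothesis rg : riemannian g.
Hypothesis gE : forall q v : rV2,
  2^-1 * form (metric_in_coord (Psi \o @cyl R) g q) v v = quad_form 2 (q 0 1) v.
Variables (O : set rV2) (psi : rV2 -> rV3).
Hypothesis lc : local_coord O psi.
Let ic := local_coord_immersed lc.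
Let G := metric_in_coord psi g.

Let oO : open O. Proof. by case: ic. Qed.

(** The chart, moved through the cylinder to the standard sphere by [model_chart], is an immersed
    chart [y] with Gram matrix half of [G], since in the coordinates of the cylinder both metrics
    are given by the same [quad_form]. *)
Lemma regular_curvature q : O q -> ~ [set N; S] (psi q) -> gauss_curvature G q = 2^-1.
Proof.
move=> Oq nq; have [_ C onS inj] := ic; have oO' := open_avoid (P := N) (Q := S) oO (C 0%N).
set O' := _ `&` _ in oO'.
have a2 : -2 < (2 : R) by lra.
have [c [Cc cK]] : exists c : rV2 -> rV3, (forall k, Ck k O' c) /\
    forall q, O' q -> exists qh, c q = cyl qh /\ Psi (c q) = psi q.
  apply: cylinder_lift => // [k|q' [Oq' nq']]; last by split=> //; exact: onS.
  by apply: Ck_sub (C k) => q' [].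
have cc q' : O' q' -> cylinder (c q') by move=> /cK[qh [-> _]]; exact: cyl_cylinder.
have sT : smooth_on (cylinder (R := R)) (@model_chart R).
  by apply: (Ck_smooth_on openT) => // k; exact: Ck_model_chart.
pose y := @model_chart R \o c.
have Cy k : Ck k O' y.
  by apply: (Ck_comp (Q := setT) (finite_basis_row R 3) oO') => //; exact: Ck_model_chart.
have yS q' : O' q' -> S2 (y q').
  by move=> /cc /model_chart_S2[].
have Gv q' v : O' q' -> form (G q') v v = 2 * dot (v *m jacobian y q') (v *m jacobian y q').
  move=> O'q'; have [qh [cE PE]] := cK q' O'q'.
  set th := angular c q' v.
  have jE1 : v *m jacobian psi q' = th *m jacobian (Psi \o @cyl R) qh.
    apply: (jacobian_lift _ oO' _ Cc cK O'q' cE) => k.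
    by apply: Ck_sub (C k) => q1 [].
  have jE2 : v *m jacobian y q' = th *m jacobian (@model_chart R \o @cyl R) qh.
    exact (jacobian_cylinder oO' Cc cc sT v O'q' cE).
  have E1 := gE qh th; have E2 := model_quad_form a2 qh th.
  rewrite /metric_in_coord form_mul in E1; rewrite /metric_in_coord form_mul model_form2 in E2.
  have key a1 b1 : a1 = th *m jacobian (Psi \o @cyl R) qh ->
      b1 = th *m jacobian (@model_chart R \o @cyl R) qh -> form (g (psi q')) a1 a1 = 2 * dot b1 b1.
    have n2 : (2^-1 : R) != 0 by rewrite invr_eq0 pnatr_eq0.
    by move=> -> ->; rewrite -PE cE; exact (mulfI n2 (etrans E1 (esym E2))).
  exact: etrans (form_mul (g (psi q')) (jacobian psi q') v v) (key _ _ jE1 jE2).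
have icy : immersed_chart O' y.
  split=> // q' v O'q' v0; have := Gv q' v O'q'; rewrite v0 dot0l mulr0.
  have [Oq' _] := O'q'; rewrite /G /metric_in_coord form_mul => F0.
  apply: (inj q' v Oq'); apply/eqP/negPn/negP => n0; have [_ _ pos] := rg.
  by have := pos _ _ (onS _ Oq') (chart_tangent ic Oq' v) n0; rewrite F0 ltxx.
apply: (sphere_gram_curvature icy) => // q' O'q'.
have [Oq' _] := O'q'; have GT : (G q')^T = G q' by exact: (metric_in_coord_sym rg ic).
apply: eq_quadratic_forms GT _ _ => [|v]; first by rewrite trmx_mul trmxK.
exact (etrans (Gv q' v O'q') (congr1 (fun r => 2 * r) (esym (gram_form (jacobian y q') v)))).
Qed.

Lemma Ck_gauss_curvature : Ck 0 O (gauss_curvature G).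
Proof.
have [_ C onS inj] := ic.
have CG k : Ck k O G.
  have CJ : Ck k O (jacobian psi) by exact: Ck_jacobian.
  have Cg : Ck k O (g \o psi).
    apply: smooth_on_open => //; apply: (smooth_on_comp (finite_basis_row R 3) _ _ (let: And3 s _ _ := rg in s)).
      by move=> _ [q Oq <-]; exact: onS.
    by apply: (Ck_smooth_on oO) => // j; exact: C.
  apply: Ck_mulmx => //; first by apply: Ck_mulmx.
  exact: Ck_trmx.
have uG q : O q -> G q \in unitmx by move=> Oq; exact: (metric_in_coord_unit rg ic).
have Ci k : Ck k O (fun q => invmx (G q)) by exact: Ck_invmx2.
have CGij k i j : Ck k O (fun q => G q i j) by exact: Ck_coord.
have Cpd k i (f : rV2 -> R) : (forall k, Ck k O f) -> Ck k O (pd i f).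
  by move=> Cf; have [_ D] := (CkS _ _ _).1 (Cf k.+1); exact: D.
have Cch k l i j : Ck k O (christoffel G l i j).
  apply: Ck_mul => //; first exact: Ck_cst.
  apply: Ck_sum => // m _; apply: Ck_mul => //; first exact: Ck_coord.
  apply: Ck_add => //; last by apply: Ck_opp => //; exact: Cpd.
  by apply: Ck_add => //; exact: Cpd.
have Crm l k i j : Ck 0 O (riemann G l k i j).
  apply: Ck_add => //; first apply: Ck_add => //; first exact: Cpd.
    by apply: Ck_opp => //; exact: Cpd.
  apply: Ck_sum => // m _; apply: Ck_add => //; first exact: Ck_mul.
  by apply: Ck_opp => //; exact: Ck_mul.
apply: Ck_mul => //.
  by apply: Ck_sum => // l _; exact: Ck_mul.
apply: Ck_inv => //; first by move=> q /uG; rewrite unitmxE unitfE.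
apply: (@Ck_eq _ _ _ _ _ (fun q => G q 0 0 * G q 1 1 - G q 0 1 * G q 1 0)) => //.
  by move=> q _; rewrite det_mx22.
apply: Ck_add => //; first exact: Ck_mul.
by apply: Ck_opp => //; exact: Ck_mul.
Qed.

(* At most two points of the chart lie over the poles, and the curvature is
   continuous. *)
Lemma constant_curvature_chart q : O q -> gauss_curvature G q = 2^-1.
Proof.
move=> Oq; apply: contrapT => /eqP K0.
have cK : {for q, continuous (gauss_curvature G)} by exact: (Ck_continuous Ck_gauss_curvature).
have [B [nb BP]] : exists B : set rV2, nbhs q B /\ forall q', B q' -> O q' /\ [set N; S] (psi q').
  exists (O `&` [set q' | gauss_curvature G q' != 2^-1]); split.
    apply: filterI; first exact: open_nbhs_nbhs.
    have nh : nbhs (gauss_curvature G q) [set t : R | t != 2^-1].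
      by apply: open_nbhs_nbhs; split; [exact: open_neq|].
    exact: (cK _ nh).
  move=> q' [Oq' /eqP Kq']; split=> //; apply: contrapT => nq'; apply: Kq'; exact: regular_curvature.
have cl : {for (0 : R), continuous (fun t : R => t *: (delta_mx 0 0 : rV2) + q)}.
  apply: (Ck_continuous (k := 0) (O := setT)) => //.
  by apply: Ck_add; [exact: openT|apply: Ck_scale; [exact: openT|exact: Ck_id|exact: Ck_cst]|exact: Ck_cst].
have n0 : nbhs (0 : R) [set t : R | B (t *: (delta_mx 0 0 : rV2) + q)].
  have nb' : nbhs ((0 : R) *: (delta_mx 0 0 : rV2) + q) B by rewrite scale0r add0r.
  exact: (cl _ nb').
have [r /= r0 rP] := (nbhs_ballP _ _).1 n0.
have P (t : R) : 0 <= t < r -> O (t *: (delta_mx 0 0 : rV2) + q) /\ [set N; S] (psi (t *: (delta_mx 0 0 : rV2) + q)).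
  by move=> /andP[t0 tr]; apply: BP; apply: rP; rewrite /ball /= sub0r normrN ger0_norm.
have [_ [_ [_ injp _] _] _] := lc.
have ne (t t' : R) : 0 <= t < r -> 0 <= t' < r -> psi (t *: (delta_mx 0 0 : rV2) + q) = psi (t' *: (delta_mx 0 0 : rV2) + q) -> t = t'.
  move=> ht ht' E; have [inO _] := P t ht; have [inO' _] := P t' ht'.
  have /(congr1 (fun v : rV2 => v 0 0)) := injp _ _ (mem_set inO) (mem_set inO') E.
  by rewrite !mxE /= !mulr1 => /addIr.
(* Three points of the segment have distinct images, but only two poles are available. *)
have h0 : 0 <= (0 : R) < r by rewrite lexx.
have h1 : 0 <= r / 2 < r by apply/andP; split; lra.
have h2 : 0 <= r / 3 < r by apply/andP; split; lra.
have := ne _ _ h0 h1; have := ne _ _ h0 h2; have := ne _ _ h1 h2.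
have [_ p0] := P _ h0; have [_ p1] := P _ h1; have [_ p2] := P _ h2.
have z1 : (0 : R) <> r / 2 by move=> E; lra.
have z2 : (0 : R) <> r / 3 by move=> E; lra.
have z3 : r / 2 <> r / 3 by move=> E; lra.
move: p0 p1 p2 => [->|->] [->|->] [->|->] e1 e2 e3.
all: by [case: (z3 (e1 erefl))|case: (z2 (e2 erefl))|case: (z1 (e3 erefl))].
Qed.

End RoundSphere.

Lemma round_case (R : realType) (g : 'rV[R]_3 -> 'M[R]_3) (U : 'rV[R]_3 -> R) : defined_by 2 g U ->
  (forall x, S2 x -> U x = 0) /\ constant_curvature g 2^-1.
Proof.
move=> [rg [sU [Psi [N [S [[SN SS _] [dPsi [lim [gE UE]]]]]]]]]; split.
  by apply: (zero_potential dPsi sU SN SS lim) => q; rewrite UE potential2.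
by move=> O psi lc q Oq; exact: (constant_curvature_chart dPsi rg gE lc).
Qed.

(** * Equivalences *)

Section LocalIsometry.
Variable R : realType.

(* [f = mu p0 + nu p1] and [rho p0 + tau p1] are commuting momenta, [f] commutes
   with the position [w], and the kinetic energy is a function of these three. *)
Lemma killing_of_isometry (kappa S S1 T T1 mu nu rho tau mux muy nux nuy rhox rhoy taux tauy
    w0 w1 sb sb1 Ab : R) : kappa != 0 ->
  kappa * sb = S * mu * mu + T * rho * rho ->
  S * mu * nu + T * rho * tau = 0 ->
  kappa * Ab = S * nu * nu + T * tau * tau ->
  S1 * w0 * mu * mu + S * (mux * mu + mu * mux) + T1 * w0 * rho * rho + T * (rhox * rho + rho * rhox) = 0 ->
  S1 * w1 * mu * mu + S * (muy * mu + mu * muy) + T1 * w1 * rho * rho + T * (rhoy * rho + rho * rhoy) = kappa * sb1 ->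
  S1 * w0 * mu * nu + S * (mux * nu + mu * nux) + T1 * w0 * rho * tau + T * (rhox * tau + rho * taux) = 0 ->
  S1 * w1 * mu * nu + S * (muy * nu + mu * nuy) + T1 * w1 * rho * tau + T * (rhoy * tau + rho * tauy) = 0 ->
  S1 * w0 * nu * nu + S * (nux * nu + nu * nux) + T1 * w0 * tau * tau + T * (taux * tau + tau * taux) = 0 ->
  S1 * w1 * nu * nu + S * (nuy * nu + nu * nuy) + T1 * w1 * tau * tau + T * (tauy * tau + tau * tauy) = kappa * (2 * sb * sb1) ->
  mux * rho + muy * tau - mu * rhox - nu * rhoy = 0 ->
  nux * rho + nuy * tau - mu * taux - nu * tauy = 0 ->
  mu * w0 + nu * w1 = 0 ->
  [/\ 2^-1 * sb * mux = 4^-1 * sb1 * nu, 2^-1 * sb * nux + 2^-1 * Ab * muy = 0 &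
      2^-1 * Ab * nuy = 2^-1 * sb * sb1 * nu].
Proof.
move=> k0 I1 I2 I3 X1 Y1 X2 Y2 X3 Y3 c1 c2 xw.
split; apply: (mulfI k0); apply/eqP; rewrite -subr_eq0; apply/eqP.
- transitivity (2^-1 * mux * (kappa * sb) - 4^-1 * nu * (kappa * sb1)); first by field.
  rewrite I1 -Y1; transitivity (2^-1 * T * rho * (mux * rho + muy * tau - mu * rhox - nu * rhoy)
    - 2^-1 * muy * (S * mu * nu + T * rho * tau) - 4^-1 * (S1 * mu ^+ 2 + T1 * rho ^+ 2) * (mu * w0 + nu * w1)
    + 4^-1 * mu * (S1 * w0 * mu * mu + S * (mux * mu + mu * mux) + T1 * w0 * rho * rho + T * (rhox * rho + rho * rhox))); first by field.
  by rewrite c1 I2 xw X1 !mulr0 !subr0 addr0.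
- rewrite mulr0 subr0; transitivity (2^-1 * nux * (kappa * sb) + 2^-1 * muy * (kappa * Ab)); first by field.
  rewrite I1 I3; transitivity (2^-1 * T * tau * (mux * rho + muy * tau - mu * rhox - nu * rhoy)
    + 2^-1 * T * rho * (nux * rho + nuy * tau - mu * taux - nu * tauy)
    - 2^-1 * (mux + nuy) * (S * mu * nu + T * rho * tau)
    - 2^-1 * (S1 * mu * nu + T1 * rho * tau) * (mu * w0 + nu * w1)
    + 2^-1 * mu * (S1 * w0 * mu * nu + S * (mux * nu + mu * nux) + T1 * w0 * rho * tau + T * (rhox * tau + rho * taux))
    + 2^-1 * nu * (S1 * w1 * mu * nu + S * (muy * nu + mu * nuy) + T1 * w1 * rho * tau + T * (rhoy * tau + rho * tauy))).
    by field.
  by rewrite c1 c2 I2 xw X2 Y2 !mulr0 !subr0 !addr0.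
- transitivity (2^-1 * nuy * (kappa * Ab) - 4^-1 * nu * (kappa * (2 * sb * sb1))); first by field.
  rewrite I3 -Y3; transitivity (2^-1 * T * tau * (nux * rho + nuy * tau - mu * taux - nu * tauy)
    - 2^-1 * nux * (S * mu * nu + T * rho * tau) - 4^-1 * (S1 * nu ^+ 2 + T1 * tau ^+ 2) * (mu * w0 + nu * w1)
    + 4^-1 * mu * (S1 * w0 * nu * nu + S * (nux * nu + nu * nux) + T1 * w0 * tau * tau + T * (taux * tau + tau * taux))); first by field.
  by rewrite c2 I2 xw X3 !mulr0 !subr0 addr0.
Qed.

Lemma is_derive_comp_real (f g : R -> R) (x df dg : R) :
  is_derive (f x) 1 g dg -> is_derive x 1 f df -> is_derive x 1 (fun t => g (f t)) (dg * df).
Proof. by move=> h1 h2; apply: is_derive_eq (is_derive1_comp h1 h2) _. Qed.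

Lemma bilinear_derive (lo hi z : R) (S T m n r t k : R -> R) (dS dT dm dn dr dt dk : R) : lo < z < hi ->
  (forall s, lo < s < hi -> S s * m s * n s + T s * r s * t s = k s) ->
  is_derive z 1 S dS -> is_derive z 1 T dT -> is_derive z 1 m dm -> is_derive z 1 n dn ->
  is_derive z 1 r dr -> is_derive z 1 t dt -> is_derive z 1 k dk ->
  dS * m z * n z + S z * (dm * n z + m z * dn) + dT * r z * t z + T z * (dr * t z + r z * dt) = dk.
Proof.
move=> hz H hS hT hm hn hr ht hk; have d := is_derive_add1 (is_derive_mul1 (is_derive_mul1 hS hm) hn)
  (is_derive_mul1 (is_derive_mul1 hT hr) ht).
have E := is_derive_unique (is_derive_eq_itv hz H d) hk.
by rewrite -E; ring.
Qed.

Lemma itv_midpoint (r s : R) : r < s -> r < (r + s) / 2 < s.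
Proof. by move=> rs; apply/andP; split; lra. Qed.

Variables (a b kappa x1 x2 y1 y2 : R).
Hypotheses (a2 : -2 < a) (b2 : -2 < b) (b_neq2 : b <> 2) (kappa0 : kappa != 0) (x12 : x1 < x2) (y12 : y1 < y2).
(** [w] is the height of the image point, and [al dx + be dy] stands for the differential of its
    angle [Theta]. Its closedness is encoded in [al1], which serves as both mixed derivatives;
    likewise [w01] for [w]. *)
Variables (w w0 w1 w00 w01 w11 al be al0 al1 be1 : R -> R -> R).
Local Notation partials := (partials x1 x2 y1 y2).
Hypotheses (pw : partials w w0 w1) (pw0 : partials w0 w00 w01) (pw1 : partials w1 w01 w11).
Hypotheses (pal : partials al al0 al1) (pbe : partials be al1 be1).
Let D (x y : R) : R := al x y * w1 x y - be x y * w0 x y.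
Hypothesis D0 : forall x y, x1 < x < x2 -> y1 < y < y2 -> D x y != 0.
(** By inversion of the Jacobian matrix, the momenta conjugate to [Theta] and [w] are
    [mu p0 + nu p1] and [rho p0 + tau p1]. *)
Let mu (x y : R) : R := w1 x y / D x y.
Let nu (x y : R) : R := - w0 x y / D x y.
Let rho (x y : R) : R := - be x y / D x y.
Let tau (x y : R) : R := al x y / D x y.
Hypothesis iso : forall x y, x1 < x < x2 -> y1 < y < y2 ->
  [/\ kappa * rtA b y = rtA a (w x y) * mu x y * mu x y + A a (w x y) * rho x y * rho x y,
      rtA a (w x y) * mu x y * nu x y + A a (w x y) * rho x y * tau x y = 0 &
      kappa * A b y = rtA a (w x y) * nu x y * nu x y + A a (w x y) * tau x y * tau x y].

Let Dx (x y : R) : R := al0 x y * w1 x y + al x y * w01 x y - (al1 x y * w0 x y + be x y * w00 x y).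
Let Dy (x y : R) : R := al1 x y * w1 x y + al x y * w11 x y - (be1 x y * w0 x y + be x y * w01 x y).
Let quot (f fx fy : R -> R -> R) := partials f fx fy -> partials (fun x y => f x y / D x y)
  (fun x y => (fx x y * D x y - f x y * Dx x y) / D x y ^+ 2)
  (fun x y => (fy x y * D x y - f x y * Dy x y) / D x y ^+ 2).

Let pD : partials D Dx Dy.
Proof.
move=> x y hx hy; have [a0 a1] := pal hx hy; have [b0 b1] := pbe hx hy.
have [u0 u1] := pw0 hx hy; have [v0 v1] := pw1 hx hy; split.
  by apply: is_derive_eq (is_derive_sub1 (is_derive_mul1 a0 v0) (is_derive_mul1 b0 u0)) _; rewrite /Dx; ring.
by apply: is_derive_eq (is_derive_sub1 (is_derive_mul1 a1 v1) (is_derive_mul1 b1 u1)) _; rewrite /Dy; ring.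
Qed.

Let quotP f fx fy : quot f fx fy.
Proof.
move=> pf x y hx hy; have [f0 f1] := pf _ _ hx hy; have [d0 d1] := pD hx hy.
split; first exact: (@is_derive_div1 R (f^~ y) (D^~ y) x _ _ (D0 hx hy) f0 d0).
exact: (@is_derive_div1 R (f x) (D x) y _ _ (D0 hx hy) f1 d1).
Qed.

Let oppP f fx fy : partials f fx fy -> partials (fun x y => - f x y) (fun x y => - fx x y) (fun x y => - fy x y).
Proof. by move=> pf x y hx hy; have [f0 f1] := pf _ _ hx hy; split; apply: is_deriveN. Qed.

Let pmu := quotP pw1.
Let pnu := quotP (oppP pw0).
Let prho := quotP (oppP pbe).
Let ptau := quotP pal.

Lemma isometry_killing : (forall x y, x1 < x < x2 -> y1 < y < y2 -> nu x y = 0) /\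
  (forall x y x' y', x1 < x < x2 -> y1 < y < y2 -> x1 < x' < x2 -> y1 < y' < y2 -> mu x y = mu x' y').
Proof.
apply: (killing_linear b2 b_neq2 pmu pnu y12) => x y hx hy.
have [I1 I2 I3] := iso hx hy; have D0' := D0 hx hy.
have [mx my] := pmu hx hy; have [nx ny] := pnu hx hy; have [rx ry] := prho hx hy; have [tx ty] := ptau hx hy.
have [wx wy] := pw hx hy.
have Sx := is_derive_comp_real (is_derive_rtA a2 (w x y)) wx; have Sy := is_derive_comp_real (is_derive_rtA a2 (w x y)) wy.
have Tx := is_derive_comp_real (is_derive_A a2 (w x y)) wx; have Ty := is_derive_comp_real (is_derive_A a2 (w x y)) wy.
apply: (killing_of_isometry kappa0 I1 I2 I3 (S1 := rtA' a (w x y)) (T1 := 2 * rtA a (w x y) * rtA' a (w x y))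
  (w0 := w0 x y) (w1 := w1 x y)).
- apply: (bilinear_derive hx _ Sx Tx mx mx rx rx (is_derive_cst (kappa * rtA b y) x 1)).
  by move=> t ht; have [-> _ _] := iso ht hy.
- apply: (bilinear_derive hy _ Sy Ty my my ry ry (is_derive_Zl1 kappa (is_derive_rtA b2 y))).
  by move=> t ht; have [-> _ _] := iso hx ht.
- apply: (bilinear_derive hx _ Sx Tx mx nx rx tx (is_derive_cst (0 : R) x 1)).
  by move=> t ht; have [_ -> _] := iso ht hy.
- apply: (bilinear_derive hy _ Sy Ty my ny ry ty (is_derive_cst (0 : R) y 1)).
  by move=> t ht; have [_ -> _] := iso hx ht.
- apply: (bilinear_derive hx _ Sx Tx nx nx tx tx (is_derive_cst (kappa * A b y) x 1)).
  by move=> t ht; have [_ _ ->] := iso ht hy.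
- apply: (bilinear_derive hy _ Sy Ty ny ny ty ty (is_derive_Zl1 kappa (is_derive_A b2 y))).
  by move=> t ht; have [_ _ ->] := iso hx ht.
(* The last three goals state that [p_Theta] commutes with [p_w] (two components) and with [w]. *)
- by move: D0'; rewrite /mu /nu /rho /tau /Dx /Dy /D => D0'; field.
- by move: D0'; rewrite /mu /nu /rho /tau /Dx /Dy /D => D0'; field.
- by move: D0'; rewrite /mu /nu /D => D0'; field.
Qed.

(** With [nu = 0] and [mu = m] constant the isometry reads [kappa S_b = m^2 S_a] and
    [kappa A_b = A_a / w1^2], where [S_a] and [A_a] are taken at [w]. Squaring the first and
    comparing gives [w1^2 m^4 = kappa], so [w = l y + l0]. The coefficients of
    [kappa^2 A_b (y) = m^4 A_a (l y + l0)] then yield [l0 = 0], [m^4 = kappa^2], [l^2 = 1] and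
    [a = b]. *)
Lemma isometry_parameters : a = b.
Proof.
have [nu0 mucst] := isometry_killing.
pose x0 := (x1 + x2) / 2; pose y0 := (y1 + y2) / 2.
have h0 : x1 < x0 < x2 by exact: itv_midpoint.
have k0 : y1 < y0 < y2 by exact: itv_midpoint.
have [m mE0] : exists m, mu x0 y0 = m by exists (mu x0 y0).
have pt y : y1 < y < y2 -> [/\ kappa * rtA b y = rtA a (w x0 y) * m ^+ 2, m != 0 &
    w1 x0 y * w1 x0 y * m ^+ 4 = kappa].
  move=> hy; have [I1 I2 I3] := iso h0 hy; have D0' := D0 h0 hy.
  have n0 := nu0 x0 y h0 hy; have mE := mucst x0 y x0 y0 h0 hy h0 k0.
  rewrite n0 mulr0 add0r in I2; rewrite n0 !mulr0 add0r in I3; rewrite mE mE0 in I1.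
  have w00' : w0 x0 y = 0.
    by move/eqP: n0; rewrite /nu mulf_eq0 invr_eq0 (negbTE D0') orbF oppr_eq0 => /eqP.
  have DE : D x0 y = al x0 y * w1 x0 y by rewrite /D w00' mulr0 subr0.
  have [al0' w10] : al x0 y != 0 /\ w1 x0 y != 0.
    by move: D0'; rewrite DE mulf_eq0 negb_or => /andP.
  have tE : tau x0 y = (w1 x0 y)^-1 by rewrite /tau DE; field; rewrite al0' w10.
  have Sa := rtA_neq0 a2 (w x0 y); have Sb := rtA_neq0 b2 y.
  have Aa : A a (w x0 y) != 0 by rewrite gt_eqF // A_gt0.
  have r0 : rho x0 y = 0.
    by apply: (mulfI Aa); apply: (mulIf (invr_neq0 w10)); rewrite mulr0 mul0r -tE.
  rewrite r0 !mulr0 addr0 in I1; rewrite tE in I3.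
  have J1 : kappa * rtA b y = rtA a (w x0 y) * m ^+ 2 by rewrite I1; ring.
  split=> //.
    apply/eqP => m0; move/eqP: J1; rewrite m0 expr0n /= mulr0 mulf_eq0.
    by rewrite (negbTE kappa0) (negbTE Sb).
  have J2 : kappa ^+ 2 * A b y = A a (w x0 y) * m ^+ 4.
    by rewrite -(sqr_rtA a2) -(sqr_rtA b2) -exprMn J1; ring.
  apply: (mulfI (mulf_neq0 kappa0 Aa)).
  transitivity (kappa * (w1 x0 y * w1 x0 y) * (A a (w x0 y) * m ^+ 4)); first by ring.
  rewrite -J2; transitivity (kappa ^+ 2 * (w1 x0 y * w1 x0 y) * (kappa * A b y)); first by ring.
  by rewrite I3; field.
have m0 : m != 0 by have [] := pt y0 k0.
have w10 y : y1 < y < y2 -> w1 x0 y != 0.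
  move=> /pt[_ _ E]; apply/eqP => z; move/eqP: E.
  by rewrite z !mul0r eq_sym (negbTE kappa0).
have w110 y : y1 < y < y2 -> w11 x0 y = 0.
  move=> hy; have [_ d] := pw1 h0 hy.
  have E : w1 x0 y * w11 x0 y + w1 x0 y * w11 x0 y = 0.
    apply: (is_derive_unique (is_derive_mul1 d d)).
    apply: (is_derive_eq_itv hy _ (is_derive_cst (kappa / m ^+ 4) y 1)) => t ht.
    by have [_ _ <-] := pt t ht; rewrite /= mulfK // expf_neq0.
  have : 2 * w1 x0 y * w11 x0 y = 0 by rewrite -E; ring.
  by move=> /eqP; rewrite !mulf_eq0 pnatr_eq0 (negbTE (w10 y hy)) => /eqP.
pose l := w1 x0 y0; pose l0 := w x0 y0 - l * y0.
have l_neq0 : l != 0 := w10 y0 k0.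
have w1E y : y1 < y < y2 -> w1 x0 y = l.
  move=> hy; apply: (@cst_on_itv R (w1 x0) y1 y2) => // t ht.
  by have [_ d] := pw1 h0 ht; rewrite w110 in d.
have wE y : y1 < y < y2 -> w x0 y = l * y + l0.
  move=> hy; suff : w x0 y - l * y = w x0 y0 - l * y0 by rewrite /l0 => <-; ring.
  apply: (@cst_on_itv R (fun y => w x0 y - l * y) y1 y2) => // t ht.
  have [_ d] := pw h0 ht; rewrite w1E // in d.
  by apply: is_derive_eq (is_derive_sub1 d (is_derive_Zl1 l (is_derive_id t (1 : R)))) _; ring.
pose s : seq R := [:: m ^+ 4 * (1 + a * l0 ^+ 2 + l0 ^+ 4) - kappa ^+ 2;
  m ^+ 4 * (2 * a * l * l0 + 4 * l * l0 ^+ 3); m ^+ 4 * (a * l ^+ 2 + 6 * l ^+ 2 * l0 ^+ 2) - kappa ^+ 2 * b;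
  m ^+ 4 * (4 * l ^+ 3 * l0); m ^+ 4 * l ^+ 4 - kappa ^+ 2].
have Z : forall i, s`_i = 0.
  apply: (horner_rec_itv y12) => y hy; rewrite /s /=.
  have [J1 _ _] := pt y hy.
  have J2 : kappa ^+ 2 * A b y = A a (l * y + l0) * m ^+ 4.
    by rewrite -wE // -(sqr_rtA a2) -(sqr_rtA b2) -exprMn J1; ring.
  transitivity (A a (l * y + l0) * m ^+ 4 - kappa ^+ 2 * A b y); first by rewrite /A; ring.
  by rewrite J2 subrr.
have := Z 0%N; have := Z 2%N; have := Z 3%N; have := Z 4%N; rewrite /s /= => z4 z3 z2 z0.
have l00 : l0 = 0.
  have n4 : (4 : R) != 0 by rewrite pnatr_eq0.
  have n : m ^+ 4 * (4 * l ^+ 3) != 0 := mulf_neq0 (expf_neq0 4 m0) (mulf_neq0 n4 (expf_neq0 3 l_neq0)).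
  by apply: (mulfI n); rewrite mulr0 -z3; ring.
have mk : m ^+ 4 = kappa ^+ 2.
  by apply/eqP; rewrite -subr_eq0 -z0 l00; apply/eqP; ring.
have l4 : l ^+ 4 = 1.
  have m4 : m ^+ 4 != 0 by rewrite expf_neq0.
  apply: (mulfI m4); rewrite mulr1; apply/eqP; rewrite -subr_eq0 {2}mk; exact/eqP.
have l2 : l ^+ 2 = 1.
  by apply/eqP; rewrite -(@eqrXn2 _ 2) ?sqr_ge0 ?ler01 // -exprM expr1n; exact/eqP.
have k2 : kappa ^+ 2 != 0 by rewrite expf_neq0.
apply: (mulfI k2); apply/eqP; rewrite -subr_eq0 -z2 l00 mk l2; apply/eqP; ring.
Qed.

End LocalIsometry.

(** * The angular form on a rectangle *)

Section PlanePartials.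
Variable R : realType.
Local Notation rV2 := 'rV[R]_2.
Local Notation rV3 := 'rV[R]_3.

Lemma open_rectangle (O : set rV2) (q : rV2) : open O -> O q -> exists2 r : R, 0 < r &
  forall x y, q 0 0 - r < x < q 0 0 + r -> q 0 1 - r < y < q 0 1 + r -> O (vec2 x y).
Proof.
move=> oO Oq; have [r /= r0 rP] := (nbhs_ballP _ _).1 (open_nbhs_nbhs (conj oO Oq)).
exists r; first exact: r0.
move=> x y hx hy; apply: rP; split=> // i j; rewrite [i]ord1 /ball /=.
by case: (ord2 j) => ->; rewrite vec2E distrC ltr_distl.
Qed.

Variables (O : set rV2) (x1 x2 y1 y2 : R).
Hypothesis oO : open O.
Hypothesis rect : forall x y, x1 < x < x2 -> y1 < y < y2 -> O (vec2 x y).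

Lemma partials_coord (F : rV2 -> rV3) i : Ck 1 O F ->
  partials x1 x2 y1 y2 (fun x y => F (vec2 x y) 0 i)
    (fun x y => 'D_(delta_mx 0 0) F (vec2 x y) 0 i) (fun x y => 'D_(delta_mx 0 1) F (vec2 x y) 0 i).
Proof.
move=> CF x y hx hy; have [dF _] := (CkS _ _ _).1 CF; have d := dF _ (rect hx hy).
have dv v : derivable F (vec2 x y) v by exact: diff_derivable.
rewrite !derive_coord //; set f := fun q => F q 0 i.
have df : differentiable f (vec2 x y) by exact: differentiable_coord'.
split.
  have E t : t *: (delta_mx 0 0 : rV2) + vec2 0 y = vec2 t y by rewrite vec2_shift0 addr0.
  have df' : differentiable f (x *: (delta_mx 0 0 : rV2) + vec2 0 y) by rewrite E.
  have := is_derive_line df'; rewrite E.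
  by congr (is_derive _ _ _ _); apply/funext => t; rewrite E.
have E t : t *: (delta_mx 0 1 : rV2) + vec2 x 0 = vec2 x t by rewrite vec2_shift1 addr0.
have df' : differentiable f (y *: (delta_mx 0 1 : rV2) + vec2 x 0) by rewrite E.
have := is_derive_line df'; rewrite E.
by congr (is_derive _ _ _ _); apply/funext => t; rewrite E.
Qed.

Lemma eq_partials (f fx fy gx gy : R -> R -> R) : partials x1 x2 y1 y2 f fx fy ->
  (forall x y, x1 < x < x2 -> y1 < y < y2 -> fx x y = gx x y /\ fy x y = gy x y) ->
  partials x1 x2 y1 y2 f gx gy.
Proof. by move=> pf E x y hx hy; have [<- <-] := E x y hx hy; exact: pf. Qed.

Variable c : rV2 -> rV3.
Hypotheses (Cc : forall k, Ck k O c) (cc : forall q, O q -> cylinder (c q)).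
Let c1 (i : 'I_2) := 'D_(delta_mx 0 i) c.
Let Cc1 k i : Ck k O (c1 i).
Proof. by have [_ D] := (CkS _ _ _).1 (Cc k.+1); exact: D. Qed.

(** [X dY - Y dX] is the differential of the angle. Its exterior derivative is twice the Jacobian
    determinant of [(X, Y)], which vanishes because both partial derivatives of [(X, Y)] are
    orthogonal to [(X, Y)]. *)
Lemma closed_form (X X0 X1 X00 X01 X11 Y Y0 Y1 Y00 Y01 Y11 : R -> R -> R) :
  partials x1 x2 y1 y2 X X0 X1 -> partials x1 x2 y1 y2 X0 X00 X01 -> partials x1 x2 y1 y2 X1 X01 X11 ->
  partials x1 x2 y1 y2 Y Y0 Y1 -> partials x1 x2 y1 y2 Y0 Y00 Y01 -> partials x1 x2 y1 y2 Y1 Y01 Y11 ->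
  (forall x y, x1 < x < x2 -> y1 < y < y2 -> X x y * X0 x y + Y x y * Y0 x y = 0) ->
  (forall x y, x1 < x < x2 -> y1 < y < y2 -> X x y * X1 x y + Y x y * Y1 x y = 0) ->
  (forall x y, x1 < x < x2 -> y1 < y < y2 -> X x y ^+ 2 + Y x y ^+ 2 = 1) ->
  exists al0 al1 be1 : R -> R -> R,
  partials x1 x2 y1 y2 (fun x y => X x y * Y0 x y - Y x y * X0 x y) al0 al1 /\
  partials x1 x2 y1 y2 (fun x y => X x y * Y1 x y - Y x y * X1 x y) al1 be1.
Proof.
move=> pX pX0 pX1 pY pY0 pY1 T0 T1 N.
exists (fun x y => X0 x y * Y0 x y + X x y * Y00 x y - (Y0 x y * X0 x y + Y x y * X00 x y)).
exists (fun x y => X1 x y * Y0 x y + X x y * Y01 x y - (Y1 x y * X0 x y + Y x y * X01 x y)).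
exists (fun x y => X1 x y * Y1 x y + X x y * Y11 x y - (Y1 x y * X1 x y + Y x y * X11 x y)).
split=> x y hx hy; have [X0d X1d] := pX x y hx hy; have [Y0d Y1d] := pY x y hx hy.
  have [X00d X10d] := pX0 x y hx hy; have [Y00d Y10d] := pY0 x y hx hy.
  split; first by apply: is_derive_eq (is_derive_sub1 (is_derive_mul1 X0d Y00d) (is_derive_mul1 Y0d X00d)) _; ring.
  by apply: is_derive_eq (is_derive_sub1 (is_derive_mul1 X1d Y10d) (is_derive_mul1 Y1d X10d)) _; ring.
have [X01d X11d] := pX1 x y hx hy; have [Y01d Y11d] := pY1 x y hx hy.
have Z : X1 x y * Y0 x y - Y1 x y * X0 x y = 0.
  rewrite -[LHS]mul1r -(N x y hx hy); have := T0 x y hx hy; have := T1 x y hx hy => E1 E0.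
  transitivity ((X x y * X1 x y + Y x y * Y1 x y) * (X x y * Y0 x y - Y x y * X0 x y)
    - (X x y * X0 x y + Y x y * Y0 x y) * (X x y * Y1 x y - Y x y * X1 x y)); first by ring.
  by rewrite E0 E1 !mul0r subrr.
split; last by apply: is_derive_eq (is_derive_sub1 (is_derive_mul1 X1d Y11d) (is_derive_mul1 Y1d X11d)) _; ring.
apply: is_derive_eq (is_derive_sub1 (is_derive_mul1 X0d Y01d) (is_derive_mul1 Y0d X01d)) _.
apply/eqP; rewrite -subr_eq0; apply/eqP.
by transitivity (-2 * (X1 x y * Y0 x y - Y1 x y * X0 x y)); [ring|rewrite Z mulr0].
Qed.

Lemma second_partials i : exists f00 f01 f11 : R -> R -> R,
  [/\ partials x1 x2 y1 y2 (fun x y => c (vec2 x y) 0 i)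
        (fun x y => c1 0 (vec2 x y) 0 i) (fun x y => c1 1 (vec2 x y) 0 i),
      partials x1 x2 y1 y2 (fun x y => c1 0 (vec2 x y) 0 i) f00 f01 &
      partials x1 x2 y1 y2 (fun x y => c1 1 (vec2 x y) 0 i) f01 f11].
Proof.
exists (fun x y => 'D_(delta_mx 0 0) (c1 0) (vec2 x y) 0 i), (fun x y => 'D_(delta_mx 0 0) (c1 1) (vec2 x y) 0 i),
  (fun x y => 'D_(delta_mx 0 1) (c1 1) (vec2 x y) 0 i); split.
- exact (partials_coord i (Cc 1)).
- apply: eq_partials (partials_coord i (Cc1 1 0)) _ => x y hx hy; split; first by [].
  exact (congr1 (fun v : rV3 => v 0 i) (schwarz_mx _ _ oO (rect hx hy) (Cc 2))).
- exact (partials_coord i (Cc1 1 1)).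
Qed.

Lemma angular_partials : exists al0 al1 be1 : R -> R -> R,
  partials x1 x2 y1 y2 (fun x y => angular c (vec2 x y) (delta_mx 0 0) 0 0) al0 al1 /\
  partials x1 x2 y1 y2 (fun x y => angular c (vec2 x y) (delta_mx 0 1) 0 0) al1 be1.
Proof.
have [X00 [X01 [X11 [pX pX0 pX1]]]] := second_partials 0.
have [Y00 [Y01 [Y11 [pY pY0 pY1]]]] := second_partials 1.
have [al0 [al1 [be1 [pal pbe]]]] := closed_form pX pX0 pX1 pY pY0 pY1
  (fun x y hx hy => derive_cylinder oO Cc cc (delta_mx 0 0) (rect hx hy))
  (fun x y hx hy => derive_cylinder oO Cc cc (delta_mx 0 1) (rect hx hy)) (fun x y hx hy => cc (rect hx hy)).
exists al0, al1, be1; split.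
  rewrite (_ : (fun x y => _) = fun x y => c (vec2 x y) 0 0 * c1 0 (vec2 x y) 0 1 - c (vec2 x y) 0 1 * c1 0 (vec2 x y) 0 0) //.
  by apply/funext => x; apply/funext => y; rewrite /angular vec2E.
rewrite (_ : (fun x y => _) = fun x y => c (vec2 x y) 0 0 * c1 1 (vec2 x y) 0 1 - c (vec2 x y) 0 1 * c1 1 (vec2 x y) 0 0) //.
by apply/funext => x; apply/funext => y; rewrite /angular vec2E.
Qed.

End PlanePartials.

(** A quadratic form in two variables is known from its values at [(1, 0)], [(0, 1)] and [(1, 1)];
    the last one gives the mixed coefficient by polarisation. That the first two momenta are
    attained makes [D] invertible. *)
Lemma isometry_of_momenta (R : realType) (kappa al be w0 w1 S T s t m1 r1 m2 r2 m3 r3 : R) :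
  1 = m1 * al + r1 * w0 -> 0 = m1 * be + r1 * w1 -> 0 = m2 * al + r2 * w0 -> 1 = m2 * be + r2 * w1 ->
  1 = m3 * al + r3 * w0 -> 1 = m3 * be + r3 * w1 ->
  S * m1 ^+ 2 + T * r1 ^+ 2 = kappa * (s * 1 ^+ 2 + t * 0 ^+ 2) ->
  S * m2 ^+ 2 + T * r2 ^+ 2 = kappa * (s * 0 ^+ 2 + t * 1 ^+ 2) ->
  S * m3 ^+ 2 + T * r3 ^+ 2 = kappa * (s * 1 ^+ 2 + t * 1 ^+ 2) ->
  let D := al * w1 - be * w0 in
  D != 0 /\ [/\ kappa * s = S * (w1 / D) * (w1 / D) + T * (- be / D) * (- be / D),
      S * (w1 / D) * (- w0 / D) + T * (- be / D) * (al / D) = 0 &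
      kappa * t = S * (- w0 / D) * (- w0 / D) + T * (al / D) * (al / D)].
Proof.
move=> e10 e11 e20 e21 e30 e31 K1 K2 K3 D.
have DD : D * (m1 * r2 - m2 * r1) = 1.
  transitivity ((m1 * al + r1 * w0) * (m2 * be + r2 * w1) - (m1 * be + r1 * w1) * (m2 * al + r2 * w0)).
    by rewrite /D; ring.
  by rewrite -e10 -e11 -e20 -e21; ring.
have D0 : D != 0 by apply/eqP => z; move/eqP: DD; rewrite z mul0r eq_sym oner_eq0.
have solve (m r p0 p1 : R) : p0 = m * al + r * w0 -> p1 = m * be + r * w1 ->
    m = (p0 * w1 - p1 * w0) / D /\ r = (p1 * al - p0 * be) / D.
  by move=> -> ->; split; apply: (mulIf D0); rewrite divfK // /D; ring.
have [m1E r1E] := solve _ _ _ _ e10 e11; have [m2E r2E] := solve _ _ _ _ e20 e21.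
have [m3E r3E] := solve _ _ _ _ e30 e31.
rewrite !mul1r !mul0r !subr0 !sub0r in m1E r1E m2E r2E m3E r3E.
split=> //; rewrite -m1E -m2E -r1E -r2E.
have m3' : m3 = m1 + m2 by rewrite m3E m1E m2E; field.
have r3' : r3 = r1 + r2 by rewrite r3E r1E r2E; field.
move: K1 K2 K3; rewrite m3' r3' !expr2 !mulr0 !mulr1 !addr0 !add0r => K1 K2 K3.
split.
- by rewrite -K1; ring.
- have n2 : (2 : R) != 0 by rewrite pnatr_eq0.
  apply: (mulfI n2); rewrite mulr0; transitivity ((S * ((m1 + m2) * (m1 + m2)) + T * ((r1 + r2) * (r1 + r2)))
    - (S * (m1 * m1) + T * (r1 * r1)) - (S * (m2 * m2) + T * (r2 * r2))); first by ring.
  by rewrite K1 K2 K3; ring.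
- by rewrite -K2; ring.
Qed.

(** * Comparison of two systems *)

Section Nonequivalence.
Variable R : realType.
Local Notation rV2 := 'rV[R]_2.
Local Notation rV3 := 'rV[R]_3.
Variables (a b : R) (g1 g2 : rV3 -> 'M[R]_3) (U1 U2 : rV3 -> R).
Hypotheses (a2 : -2 < a) (b2 : -2 < b).
Variables (Psi1 Psi2 : rV3 -> rV3) (N1 S1 N2 S2' : rV3).
Hypothesis rg1 : riemannian g1.
Hypothesis dPsi1 : diffeo (cylinder (R := R)) (S2 (R := R) `\` [set N1; S1]) Psi1.
Hypothesis gE1 : forall q v : rV2,
  2^-1 * form (metric_in_coord (Psi1 \o @cyl R) g1 q) v v = quad_form a (q 0 1) v.
Hypothesis rg2 : riemannian g2.
Hypothesis dPsi2 : diffeo (cylinder (R := R)) (S2 (R := R) `\` [set N2; S2']) Psi2.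
Hypothesis gE2 : forall q v : rV2,
  2^-1 * form (metric_in_coord (Psi2 \o @cyl R) g2 q) v v = quad_form b (q 0 1) v.
Variables (phi : rV3 -> rV3) (Phi : rV3 * rV3 -> rV3 * rV3) (kappa : R).
Hypothesis dphi : diffeo (S2 (R := R)) (S2 (R := R)) phi.
Hypothesis dPhi : diffeo (TstarS2 (R := R)) (TstarS2 (R := R)) Phi.
Hypothesis Phi1 : forall z, TstarS2 z -> (Phi z).1 = phi z.1.
Hypothesis cotangent : forall O psi, local_coord O psi -> forall (q : rV2) (xi : rV3) (v : rV2), O q ->
  TstarS2 (psi q, xi) ->
  dot (Phi (psi q, xi)).2 (v *m jacobian (phi \o psi) q) = dot xi (v *m jacobian psi q).
Hypothesis kappa0 : kappa != 0.
Hypothesis kinE : forall z, TstarS2 z -> kinetic g1 (Phi z) = kappa * kinetic g2 z.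

Let psi2 := Psi2 \o @cyl R.
Let chi := phi \o psi2.
Let O := strip (R := R) `&` [set q | ~ [set N1; S1] (chi q)].

Let lc2 : local_coord (strip (R := R)) psi2 := defined_local_coord dPsi2.
Let ic2 : immersed_chart (strip (R := R)) psi2 := local_coord_immersed lc2.

Let C_strip k : Ck k (strip (R := R)) chi.
Proof.
have [oS C onS _] := ic2; have [sphi _ _] := dphi; apply: smooth_on_open => //.
apply: (smooth_on_comp (finite_basis_row R 3) _ _ sphi).
  by move=> _ [q sq <-]; exact: onS.
by apply: (Ck_smooth_on oS) => // j; exact: C.
Qed.

Let oO : open O.
Proof. by apply: open_avoid (C_strip 0); exact: open_strip. Qed.

Let Cchi k : Ck k O chi.
Proof. by apply: Ck_sub (C_strip k) => q []. Qed.

(** [chi] is injective on the strip, so of three points at least one avoids the two poles. *)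
Lemma regular_point : exists q, O q.
Proof.
have [_ _ onS _] := ic2; have [_ [_ injphi _] _] := dphi; have [_ [_ [_ inj2 _] _] _] := lc2.
pose q (t : R) := vec2 0 t.
have sq t : strip (q t).
  by rewrite /strip /= vec2E oppr_lt0 andbb divr_gt0 // pi_gt0.
have inj t t' : chi (q t) = chi (q t') -> t = t'.
  move=> E; have E2 := injphi _ _ (mem_set (onS _ (sq t))) (mem_set (onS _ (sq t'))) E.
  have /(congr1 (fun v : rV2 => v 0 1)) := inj2 _ _ (mem_set (sq t)) (mem_set (sq t')) E2.
  by rewrite !vec2E.
apply: contrapT => nO.
have P t : [set N1; S1] (chi (q t)).
  by apply: contrapT => nt; apply: nO; exists (q t); split; [exact: sq|exact: nt].
have z1 : (0 : R) <> 1 by lra.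
have z2 : (0 : R) <> 2 by lra.
have z3 : (1 : R) <> 2 by lra.
have := @inj 0 1; have := @inj 0 2; have := @inj 1 2.
move: (P 0) (P 1) (P 2) => [->|->] [->|->] [->|->] e1 e2 e3.
all: by [case: (z3 (e1 erefl))|case: (z2 (e2 erefl))|case: (z1 (e3 erefl))].
Qed.

Variable c : rV2 -> rV3.
Hypothesis Cc : forall k, Ck k O c.
Hypothesis cK : forall q, O q -> exists qh, c q = cyl qh /\ Psi1 (c q) = chi q.

Lemma angular2 (q v : rV2) : angular c q v 0 1 = 'D_v c q 0 2.
Proof. by rewrite /angular vec2E. Qed.

(** [p'] consists of the components of the image covector in the coordinates of the first system.
    The cotangent condition becomes the transformation rule for momenta, and the condition on
    kinetic energies becomes the second equation. *)
Lemma momentum_pullback (q p : rV2) : O q -> exists p' : rV2,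
  (forall i, p 0 i = p' 0 0 * angular c q (delta_mx 0 i) 0 0 + p' 0 1 * 'D_(delta_mx 0 i) c q 0 2) /\
  rtA a (c q 0 2) * p' 0 0 ^+ 2 + A a (c q 0 2) * p' 0 1 ^+ 2 =
  kappa * (rtA b (q 0 1) * p 0 0 ^+ 2 + A b (q 0 1) * p 0 1 ^+ 2).
Proof.
move=> Oq; have [sq _] := Oq; have [_ _ onS _] := ic2.
have [qh [cq PE]] := cK Oq; have chiE : chi q = (Psi1 \o @cyl R) qh by rewrite -PE cq.
pose xi := covector psi2 q p.
have tz : TstarS2 (psi2 q, xi) by split; [exact: onS|exact: (covector_tangent ic2)].
have [_ [fP _ _] _] := dPhi; have tPz := fP _ tz.
have Pz1 := Phi1 tz; set eta := (Phi (psi2 q, xi)).2.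
have Pz1' : (Phi (psi2 q, xi)).1 = (Psi1 \o @cyl R) qh := etrans Pz1 chiE.
have tw : tangent ((Psi1 \o @cyl R) qh) eta by case: tPz => _; rewrite Pz1'.
exists (eta *m (jacobian (Psi1 \o @cyl R) qh)^T); split=> [i|].
  transitivity (dot (eta *m (jacobian (Psi1 \o @cyl R) qh)^T) (angular c q (delta_mx 0 i))); last first.
    by rewrite dot2 angular2.
  rewrite -dot_mul -(jacobian_lift dPsi1 (delta_mx 0 i) oO Cchi Cc cK Oq cq).
  rewrite (cotangent lc2 _ sq tz) dot_mul (covector_comp ic2) // dot_delta //.
have K := kinE tz; rewrite (defined_kinetic b2 rg2 dPsi2 gE2) in K; last by case: tz.
have Pz : Phi (psi2 q, xi) = ((Psi1 \o @cyl R) qh, eta).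
  by rewrite [LHS]surjective_pairing Pz1'.
rewrite Pz (defined_kinetic a2 rg1 dPsi1 gE1 tw) in K.
rewrite (covector_comp ic2) // in K.
have ch : c q 0 2 = qh 0 1 by rewrite cq /cyl vec3E.
rewrite ch; move: K; rewrite -/(rtA a (qh 0 1)) -/(rtA b (q 0 1)) => K.
have n4 : (4^-1 : R) != 0 by rewrite invr_eq0 pnatr_eq0.
by apply: (mulfI n4); rewrite K; ring.
Qed.

Lemma momentum_isometry (q : rV2) : O q ->
  let al := angular c q (delta_mx 0 0) 0 0 in let be := angular c q (delta_mx 0 1) 0 0 in
  let w0 := 'D_(delta_mx 0 0) c q 0 2 in let w1 := 'D_(delta_mx 0 1) c q 0 2 in
  let D := al * w1 - be * w0 in
  D != 0 /\ [/\ kappa * rtA b (q 0 1) = rtA a (c q 0 2) * (w1 / D) * (w1 / D)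
                  + A a (c q 0 2) * (- be / D) * (- be / D),
      rtA a (c q 0 2) * (w1 / D) * (- w0 / D) + A a (c q 0 2) * (- be / D) * (al / D) = 0 &
      kappa * A b (q 0 1) = rtA a (c q 0 2) * (- w0 / D) * (- w0 / D)
        + A a (c q 0 2) * (al / D) * (al / D)].
Proof.
move=> Oq al be w0 w1 D.
have [p1 [P1 K1]] := momentum_pullback (vec2 1 0) Oq.
have [p2 [P2 K2]] := momentum_pullback (vec2 0 1) Oq.
have [p3 [P3 K3]] := momentum_pullback (vec2 1 1) Oq.
have e10 := P1 0; have e11 := P1 1; have e20 := P2 0; have e21 := P2 1; have e30 := P3 0; have e31 := P3 1.
rewrite vec2E in e10; rewrite vec2E in e11; rewrite vec2E in e20; rewrite vec2E in e21.
rewrite vec2E in e30; rewrite vec2E in e31; rewrite !vec2E in K1 K2 K3.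
exact (isometry_of_momenta e10 e11 e20 e21 e30 e31 K1 K2 K3).
Qed.

Lemma lifted_parameters : b <> 2 -> a = b.
Proof.
move=> b_neq2; have [q Oq] := regular_point; have [r r0 rect] := open_rectangle oO Oq.
have cc q' : O q' -> cylinder (c q') by move=> /cK[? [-> _]]; exact: cyl_cylinder.
have x12 : q 0 0 - r < q 0 0 + r by lra.
have y12 : q 0 1 - r < q 0 1 + r by lra.
have [al0 [al1 [be1 [pal pbe]]]] := angular_partials oO rect Cc cc.
have [w00 [w01 [w11 [pw pw0 pw1]]]] := second_partials oO rect Cc 2.
apply: (isometry_parameters a2 b2 b_neq2 kappa0 x12 y12 pw pw0 pw1 pal pbe).
  by move=> x y hx hy; have [] := momentum_isometry (rect x y hx hy).
move=> x y hx hy; have [_] := momentum_isometry (rect x y hx hy).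
by rewrite vec2E.
Qed.

End Nonequivalence.

Lemma pot_eq_potential (R : realType) (a : R) : potential a 0 1 = pot a 1.
Proof. by rewrite potentialE cos0 mulr1. Qed.

(** The point [phi = 0], [u = 1] detects the potential of every [a] other than 2. *)
Lemma potential_vanishes (R : realType) (a : R) (g : 'rV[R]_3 -> 'M[R]_3) (U : 'rV[R]_3 -> R) :
  -2 < a -> defined_by a g U -> (forall x, S2 x -> U x = 0) -> a = 2.
Proof.
move=> a2 [_ [_ [Psi [N [S [_ [dPsi [_ [_ UE]]]]]]]]] U0; apply: contrapT => a_neq2.
apply: (pot1_neq0 a2 a_neq2); rewrite -pot_eq_potential.
have := UE (vec2 0 1); rewrite !vec2E => <-; apply: U0.
by have [_ [fP _ _] _] := dPsi; have [] := fP _ (cyl_cylinder (vec2 0 1)).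
Qed.

Lemma equivalent_parameters (R : realType) (a b : R) (g1 g2 : 'rV[R]_3 -> 'M[R]_3)
    (U1 U2 : 'rV[R]_3 -> R) : -2 < a -> -2 < b -> defined_by a g1 U1 -> defined_by b g2 U2 ->
  equivalent g1 U1 g2 U2 -> a = b.
Proof.
move=> a2 b2 d1 d2 [phi [Phi [kappa [kappa' [[dphi dPhi] [Phi1 [_ [cotan [[k0 k0'] [kinE potE]]]]]]]]]].
have [_ [fphi _ sphi] _] := dphi.
(* For [b = 2] the second metric has constant curvature and further Killing fields, so the momentum
   argument fails; there the vanishing potentials decide. *)
have [bE|b_neq2] := pselect (b = 2).
  rewrite bE; apply: (potential_vanishes a2 d1) => x Sx; have [y Sy <-] := sphi x Sx.
  rewrite bE in d2; have [U20 _] := round_case d2.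
  by rewrite potE // U20 // mulr0.
have [rg1 [_ [Psi1 [N1 [S1 [_ [dPsi1 [_ [gE1 _]]]]]]]]] := d1.
have [rg2 [_ [Psi2 [N2 [S2' [_ [dPsi2 [_ [gE2 _]]]]]]]]] := d2.
have lc2 := defined_local_coord dPsi2; have [oS C onS _] := local_coord_immersed lc2.
have sphi' : smooth_on (S2 (R := R)) phi by case: dphi.
have Cs k : Ck k (strip (R := R)) (phi \o (Psi2 \o @cyl R)).
  apply: smooth_on_open => //; apply: (smooth_on_comp (finite_basis_row R 3) _ _ sphi').
    by move=> _ [q sq <-]; exact: onS.
  by apply: (Ck_smooth_on oS) => // j; exact: C.
have [c [Cc cK]] := @cylinder_lift R Psi1 N1 S1 dPsi1 _ _ (open_avoid (P := N1) (Q := S1) oS (Cs 0%N))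
  (fun k => Ck_sub (@subIsetl _ _ _) (Cs k)) (fun q h => conj (fphi _ (onS q (proj1 h))) (proj2 h)).
exact: (lifted_parameters a2 b2 rg1 dPsi1 gE1 rg2 dPsi2 gE2 dphi dPhi Phi1 cotan k0 kinE Cc cK b_neq2).
Qed.

Theorem theorem2p7 (R : realType) :
  (forall a u : R, -2 < a -> 0 < A a u) /\
  (* (1) *)
  (forall a : R, -2 < a ->
     exists (g : 'rV[R]_3 -> 'M[R]_3) (U : 'rV[R]_3 -> R),
       defined_by a g U /\
       exists F, integral_of_degree 4 (hamiltonian g U) F) /\
  (* (2) *)
  (forall (a : R) (g : 'rV[R]_3 -> 'M[R]_3) (U : 'rV[R]_3 -> R),
     -2 < a -> defined_by a g U ->
     (a <> 2 -> ~ exists F, integral_of_degree 2 (hamiltonian g U) F) /\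
     (a = 2 ->
        (forall z, TstarS2 z -> hamiltonian g U z = kinetic g z) /\
        exists c : R, 0 < c /\ constant_curvature g c)) /\
  (* (3) *)
  (forall (a b : R) (g1 : 'rV[R]_3 -> 'M[R]_3) (U1 : 'rV[R]_3 -> R)
          (g2 : 'rV[R]_3 -> 'M[R]_3) (U2 : 'rV[R]_3 -> R),
     -2 < a -> -2 < b -> a <> b ->
     defined_by a g1 U1 -> defined_by b g2 U2 ->
     ~ equivalent g1 U1 g2 U2).
Proof.
split; first by move=> a u a2; exact: A_gt0.
split.
  move=> a a2; exists (model_metric a), (model_potential a).
  split; first exact: model_defined_by.
  by exists (model_integral a); exact: model_integral_of_degree.
split.
  move=> a g U a2 d; split; first by move=> a_neq2; exact: no_quadratic_integral d.
  move=> aE; rewrite aE in d; have [U0 K] := round_case d; split.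
    by move=> z [Sz _]; rewrite /hamiltonian U0 // addr0.
  by exists 2^-1; split; [rewrite invr_gt0 ltr0n|exact: K].
move=> a b g1 U1 g2 U2 a2 b2 ab d1 d2 E; apply: ab; exact: equivalent_parameters d1 d2 E.
Qed.
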